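(* Let $H$ be a finite-dimensional complex Hopf algebra with a positive basis $B$, and let $R\in H\otimes H$ be a quasi-triangular structure on $H$ that is positive with respect to $B$. Then $(H,R)$ is quasi-isomorphic to a normal pair: there exist a finite group $G$ with a unique factorization $G=G_+'G_-$ and a normal positive quasi-triangular structure $R'$ on $H'=H(G;G_+',G_-)$, together with an algebra isomorphism $\phi:H'\to H$ and an invertible $T\in H\otimes H$, such that $(\phi\otimes\phi)\Delta'(a)=T\Delta(\phi(a))T^{-1}$ for all $a\in H'$, $(T\otimes1)(\Delta\otimes\mathrm{id})T=(1\otimes T)(\mathrm{id}\otimes\Delta)T$, $(\varepsilon\otimes\mathrm{id})T=(\mathrm{id}\otimes\varepsilon)T=1$, and $(\phi\otimes\phi)(R')=(\tau T)\,R\,T^{-1}$.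
   Context: A basis $B$ of a finite-dimensional Hopf algebra $H$ is positive if all the structure constants of $H$ relative to $B$ (the coefficients of products $bb'$ in $B$ and of coproducts $\Delta(b)$ in $B\otimes B$, $b,b'\in B$) are non-negative real numbers; an element of $H\otimes H$ is positive with respect to $B$ if its coefficients in the basis $B\otimes B$ are non-negative reals. A quasi-triangular structure on $H$ is an invertible $R\in H\otimes H$ with $\tau\Delta(a)=R\Delta(a)R^{-1}$ for all $a$ ($\tau$ the flip of tensor factors), $(\Delta\otimes\mathrm{id})R=R_{13}R_{23}$, $(\mathrm{id}\otimes\Delta)R=R_{13}R_{12}$, and $(\varepsilon\otimes\mathrm{id})R=(\mathrm{id}\otimes\varepsilon)R=1$. A unique factorization $G=K G_-$ consists of subgroups $K,G_-$ with every $g\in G$ uniquely $g=g_Kg_-$, $g_K\in K$, $g_-\in G_-$; for $u\in K$, $x\in G_-$ define ${}^u x\in G_-$, $u^x\in K$, ${}^x u\in K$, $x^u\in G_-$ by $ux=({}^u x)(u^x)$, $xu=({}^x u)(x^u)$. $H(G;K,G_-)$ is the complex vector space with basis $\{g\}$, $g\in G$, and Hopf structure $\{g\}\{h\}=\delta_{g_K^{\,g_-},\,h_K}\{g h_-\}$, $1=\sum_{u\in K}\{u\}$, $\Delta\{g\}=\sum_{h\in K}\{g_Kh^{-1}({}^{h}g_-)\}\otimes\{h g_-\}$, $\varepsilon\{g\}=\delta_{g_K,e}$, $S\{g\}=\{g^{-1}\}$; it is positive with respect to the basis $G$. Every positive quasi-triangular structure on $H(G;K,G_-)$ has the form $\sum_{u,v\in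 K}\{u(\eta(v)^{u})^{-1}\}\otimes\{v\xi(u)\}$ for group homomorphisms $\xi,\eta:K\to G_-$; it is called normal if $\xi(u)=e$ for all $u\in K$. *)

(* Defs.v *)
From mathcomp Require Import all_boot all_order all_algebra all_fingroup.
From mathcomp Require Import reals complex.
Set Implicit Arguments. Unset Strict Implicit. Unset Printing Implicit Defensive.
Import Order.TTheory GRing.Theory Num.Theory.
Local Open Scope ring_scope.

(* Finite-dimensional algebras/coalgebras/Hopf algebras given by their       *)
(* structure constants with respect to a basis indexed by a finite type I.   *)
(* An element of H is its coordinate vector (I -> C); an element of H (x) H  *)
(* is a vector (I * I -> C) in the basis B (x) B; H (x) H (x) H uses the     *)
(* index type (I * I) * I.                                                   *)

Section StructureConstants.
Variable C : numDomainType.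

Record hdata (I : finType) := HData {
  hmul    : I -> I -> I -> C;  (* hmul a b c = coefficient of c in a b      *)
  hunit   : I -> C;
  hcomul  : I -> I -> I -> C;  (* hcomul a b c = coefficient of b(x)c in D a *)
  hcounit : I -> C;
  hanti   : I -> I -> C        (* hanti a b = coefficient of b in S a       *)
}.

Variable I : finType.
Variable H : hdata I.

Definition vec (J : Type) := J -> C.

Definition mulH (x y : vec I) : vec I :=
  fun c => \sum_a \sum_b x a * y b * hmul H a b c.
Definition oneH : vec I := hunit H.
Definition comulH (x : vec I) : vec (I * I) :=
  fun p => \sum_a x a * hcomul H a p.1 p.2.
Definition counitH (x : vec I) : C := \sum_a x a * hcounit H a.
Definition antiH (x : vec I) : vec I := fun b => \sum_a x a * hanti H a b.

Definition mul2 (s t : vec (I * I)) : vec (I * I) :=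
  fun p => \sum_q \sum_r s q * t r * hmul H q.1 r.1 p.1 * hmul H q.2 r.2 p.2.
Definition one2 : vec (I * I) := fun p => hunit H p.1 * hunit H p.2.
Definition mul3 (s t : vec ((I * I) * I)) : vec ((I * I) * I) :=
  fun p => \sum_q \sum_r s q * t r * hmul H q.1.1 r.1.1 p.1.1
                 * hmul H q.1.2 r.1.2 p.1.2 * hmul H q.2 r.2 p.2.

Definition mmap (t : vec (I * I)) : vec I :=
  fun c => \sum_q t q * hmul H q.1 q.2 c.
Definition anti_l (t : vec (I * I)) : vec (I * I) :=
  fun p => \sum_a t (a, p.2) * hanti H a p.1.
Definition anti_r (t : vec (I * I)) : vec (I * I) :=
  fun p => \sum_b t (p.1, b) * hanti H b p.2.
Definition comul_l (t : vec (I * I)) : vec ((I * I) * I) :=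
  fun p => \sum_a t (a, p.2) * hcomul H a p.1.1 p.1.2.
Definition comul_r (t : vec (I * I)) : vec ((I * I) * I) :=
  fun p => \sum_b t (p.1.1, b) * hcomul H b p.1.2 p.2.
Definition counit_l (t : vec (I * I)) : vec I :=
  fun b => \sum_a t (a, b) * hcounit H a.
Definition counit_r (t : vec (I * I)) : vec I :=
  fun a => \sum_b t (a, b) * hcounit H b.
Definition flip (t : vec (I * I)) : vec (I * I) := fun p => t (p.2, p.1).
Definition leg12 (t : vec (I * I)) : vec ((I * I) * I) :=
  fun p => t p.1 * hunit H p.2.
Definition leg13 (t : vec (I * I)) : vec ((I * I) * I) :=
  fun p => t (p.1.1, p.2) * hunit H p.1.2.
Definition leg23 (t : vec (I * I)) : vec ((I * I) * I) :=
  fun p => hunit H p.1.1 * t (p.1.2, p.2).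
Definition tens_1 (t : vec (I * I)) : vec ((I * I) * I) := leg12 t.
Definition tens1_ (t : vec (I * I)) : vec ((I * I) * I) := leg23 t.

Definition is_hopf : Prop :=
  (forall x y z, mulH (mulH x y) z =1 mulH x (mulH y z)) /\
  (forall x, mulH oneH x =1 x /\ mulH x oneH =1 x) /\
  (forall x, comul_l (comulH x) =1 comul_r (comulH x)) /\
  (forall x, counit_l (comulH x) =1 x /\ counit_r (comulH x) =1 x) /\
  (forall x y, comulH (mulH x y) =1 mul2 (comulH x) (comulH y)) /\
  comulH oneH =1 one2 /\
  (forall x y, counitH (mulH x y) = counitH x * counitH y) /\
  counitH oneH = 1 /\
  (forall x, mmap (anti_l (comulH x)) =1 (fun c => counitH x * oneH c)
          /\ mmap (anti_r (comulH x)) =1 (fun c => counitH x * oneH c)).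

Definition positive_basis : Prop :=
  (forall a b c, 0 <= hmul H a b c) /\ (forall a b c, 0 <= hcomul H a b c).

Definition positive2 (t : vec (I * I)) : Prop := forall p, 0 <= t p.

Definition inverse2 (t tinv : vec (I * I)) : Prop :=
  mul2 t tinv =1 one2 /\ mul2 tinv t =1 one2.

Definition is_qt (R : vec (I * I)) : Prop :=
  exists Rinv, [/\ inverse2 R Rinv,
    (forall a, flip (comulH a) =1 mul2 (mul2 R (comulH a)) Rinv),
    comul_l R =1 mul3 (leg13 R) (leg23 R),
    comul_r R =1 mul3 (leg13 R) (leg12 R) &
    counit_l R =1 oneH /\ counit_r R =1 oneH].

End StructureConstants.

Section Factorization.
Variable gT : finGroupType.
Implicit Types K Gm : {group gT}.

Definition unique_fact K Gm : Prop :=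
  forall g : gT, exists! p : gT * gT,
    [/\ p.1 \in K, p.2 \in Gm & g = (p.1 * p.2)%g].

Variables K Gm : {group gT}.

Definition fK (g : gT) : gT :=
  odflt 1%g [pick k | (k \in K) && ((k^-1 * g)%g \in Gm)].
Definition fm (g : gT) : gT := ((fK g)^-1 * g)%g.
(* the factorization in the order G = G_- K : g = gm' gK' *)
Definition fK' (g : gT) : gT := ((fK g^-1)^-1)%g.
Definition fm' (g : gT) : gT := ((fm g^-1)^-1)%g.

(* for u in K, x in G_- : u x = (^u x) (u^x),  x u = (^x u) (x^u) *)
Definition lact_m (u x : gT) : gT := fm' (u * x)%g.
Definition ract_K (u x : gT) : gT := fK' (u * x)%g.
Definition lact_K (x u : gT) : gT := fK (x * u)%g.
Definition ract_m (x u : gT) : gT := fm (x * u)%g.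

Variable C : numDomainType.

Definition delta (b : bool) : C := if b then 1 else 0.

Definition HG_mul (g h c : gT) : C :=
  delta ((ract_K (fK g) (fm g) == fK h) && (c == (g * fm h)%g)).
Definition HG_unit (c : gT) : C := delta (c \in K).
Definition HG_comul (g a b : gT) : C :=
  \sum_(h in K) delta ((a == (fK g * h^-1 * lact_m h (fm g))%g)
                       && (b == (h * fm g)%g)).
Definition HG_counit (g : gT) : C := delta (fK g == 1%g).
Definition HG_anti (g b : gT) : C := delta (b == g^-1)%g.

Definition HG : hdata C gT := HData HG_mul HG_unit HG_comul HG_counit HG_anti.

Definition R_form (xi eta : gT -> gT) : vec C (gT * gT) :=
  fun p => \sum_(u in K) \sum_(v in K)
     delta ((p.1 == (u * (ract_m (eta v) u)^-1)%g) && (p.2 == (v * xi u)%g)).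

Definition hom_to_m (f : gT -> gT) : Prop :=
  {in K &, {morph f : x y / (x * y)%g}} /\ {in K, forall x, f x \in Gm}.

Definition normal_pos_qt (R' : vec C (gT * gT)) : Prop :=
  [/\ is_qt HG R', positive2 R' &
      exists eta, hom_to_m eta /\ R' =1 R_form (fun _ => 1%g) eta].

End Factorization.

Section Lin.
Variable C : numDomainType.
Variables (J I : finType).

Definition lin (phi : J -> vec C I) (x : vec C J) : vec C I :=
  fun i => \sum_j x j * phi j i.
Definition lin2 (phi : J -> vec C I) (t : vec C (J * J)) : vec C (I * I) :=
  fun p => \sum_q t q * phi q.1 p.1 * phi q.2 p.2.

End Lin.

Section Maps.
Variable C : numDomainType.
Variables (J I : finType) (H' : hdata C J) (H : hdata C I).

Definition alg_iso (phi : J -> vec C I) : Prop :=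
  [/\ (exists psi : I -> vec C J,
         (forall x, lin psi (lin phi x) =1 x) /\
         (forall y, lin phi (lin psi y) =1 y)),
      (forall x y, lin phi (mulH H' x y) =1 mulH H (lin phi x) (lin phi y)) &
      lin phi (oneH H') =1 oneH H].

End Maps.

(* Main.v *)
(* The terms of the expansion of 1 in the basis are orthogonal idempotents, and
   dually for the counit; the two supports are finite groups K and G_-, which
   grade the basis from the left and from the right.  The counit is nonnegative because
   its positive part is supermultiplicative, and a supermultiplicative function
   is bounded, so that its convolution powers cannot grow.  The same boundedness
   shows that a basis vector of trivial G_--degree lies in K: otherwise some
   element would have a power that is nilpotent but nonzero.  Hence the basis is
   K x G_-, the structure constants are supported on a bicrossed product, and
   geometric means yield a rescaling of the basis making them 0 or 1.

   There a positive R is the sum over u, v of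
     (u, u^-1 |> zeta v) (x) (v, xi u)
   for a homomorphism xi and an antihomomorphism zeta from K to G_-, all of whose
   coefficients are 1 because they multiply along K.  Twisting by the sum over
   a, b of (a, (xi b)^-1) (x) (b, 1) keeps the algebra and makes the left action
   of K on G_- trivial: K is replaced by the set K' of the elements (xi u)^-1 u of
   the factorized group, which is normalized by G_-.  The twisted R is the sum of
   (u, zeta v * xi v) (x) (v, 1), which is normal. *)
Require Import Defs.
From HB Require Import structures.
From mathcomp Require Import all_boot all_order all_algebra all_fingroup.
From mathcomp Require Import reals complex.
From mathcomp Require Import boolp ring.
Set Implicit Arguments. Unset Strict Implicit. Unset Printing Implicit Defensive.
Import Order.TTheory GRing.Theory Num.Theory.
Local Open Scope ring_scope.

(** Each structural step rests on the absence of cancellation: a sum of nonnegative coefficients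
    vanishes only term by term. Only products and coproducts are assumed nonnegative, so the signs
    of the counit and of the unit have to be settled before anything else. The obstacle is the
    possible presence of basis vectors of trivial [gT] degree outside the support of the unit, which
    the gradings alone do not exclude. Such a vector produces a nonnegative nonzero [y] with
    [y ⊗ 1 + g ⊗ y <= Δ(y)], an inequality form of skew-primitivity. Two properties of the powers of
    [y] then collide: the inequality keeps them nonzero, while bounded functionals force diagonal
    coefficients of left multiplication by some of them to vanish. Once this is excluded, inverses
    up to nonzero coefficients show that two degrees determine a basis vector. After the twist, the
    axioms of the new R-matrix reduce to the identities of a crossed module for the map [kap]. *)

Section FinGroupOf.
Variables (T : finType) (op : T -> T -> T) (e : T) (iv : T -> T).
Hypotheses (opA : associative op) (op1 : left_id e op) (opV : left_inverse e iv op).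

(* The [let] makes the type depend on the axioms, so that the structures
   attached to it do not leak to [T]. *)
Definition group_of_axioms : Type := let _ := (opA, op1, opV) in T.
HB.instance Definition _ := Finite.copy group_of_axioms T.
HB.instance Definition _ := Finite_isGroup.Build group_of_axioms opA op1 opV.

End FinGroupOf.

Lemma finGroup_of_axioms (T : finType) (op : T -> T -> T) (e : T) (iv : T -> T) :
  associative op -> left_id e op -> left_inverse e iv op ->
  exists (gT : finGroupType) (f : T -> gT), bijective f /\ {morph f : x y / op x y >-> (x * y)%g}.
Proof.
by move=> A L V; exists (group_of_axioms A L V), id; split=> //; exists id.
Qed.

(** Serves to turn the support of the unit or of the counit, a subset of the basis, into a group
    type. *)
Lemma finGroup_of_pred (I : finType) (A : pred I) (op : I -> I -> I) (e : I) :
  A e -> (forall x y, A x -> A y -> A (op x y)) ->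
  (forall x y z, A x -> A y -> A z -> op x (op y z) = op (op x y) z) ->
  (forall x, A x -> op e x = x) ->
  (forall x, A x -> exists2 y, A y & op y x = e) ->
  exists (gT : finGroupType) (f : gT -> I),
    [/\ injective f, forall x, A x <-> exists y, f y = x,
        {morph f : x y / (x * y)%g >-> op x y} & f 1%g = e].
Proof.
move=> Ae Aop opA op1 opV.
pose T := {x : I | A x}.
pose opT (x y : T) : T := exist (fun z => A z) _ (Aop _ _ (valP x) (valP y)).
have opTA : associative opT by move=> x y z; apply: val_inj; apply: opA; exact: valP.
have opT1 : left_id (exist (fun z => A z) e Ae : T) opT.
  by move=> x; apply: val_inj; apply: op1 (valP x).
have /fin_all_exists[iv opTV] (x : T) : exists y : T, opT y x = exist (fun z => A z) e Ae.
  have [y Ay yx] := opV _ (valP x).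
  by exists (exist (fun z => A z) y Ay); apply: val_inj.
have [gT [f [[g fK gK] fM]]] := finGroup_of_axioms opTA opT1 opTV.
have gM : {morph g : x y / (x * y)%g >-> opT x y}.
  by move=> x y; rewrite -[in LHS](gK x) -[in LHS](gK y) -fM fK.
exists gT, (fun x => val (g x)); split.
- by move=> x y /val_inj /(can_inj gK).
- move=> x; split=> [Ax|[y <-]]; last exact: valP.
  by exists (f (exist (fun z => A z) x Ax)); rewrite fK.
- by move=> x y; rewrite gM.
- have : opT (g 1%g) (g 1%g) = g 1%g by rewrite -gM mulg1.
  by move=> /(congr1 (opT (iv (g 1%g)))); rewrite opTA !opTV opT1 => ->.
Qed.

(** * Hopf axioms on structure constants, and duality *)

Section BasisLevel.
Variables (C : numClosedFieldType) (I : finType).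

(** The axioms tested on basis vectors. This form is stable under exchanging products with
    coproducts ([hopf_basis_dual]), so each statement about the unit also yields one about the
    counit. *)
Record hopf_basis (H : hdata C I) : Prop := HopfBasis {
  hb_assoc a b c d : \sum_e hmul H a b e * hmul H e c d
                   = \sum_e hmul H b c e * hmul H a e d;
  hb_unitl b c : \sum_a hunit H a * hmul H a b c = (b == c)%:R;
  hb_unitr b c : \sum_a hunit H a * hmul H b a c = (b == c)%:R;
  hb_coassoc a b c d : \sum_e hcomul H e a b * hcomul H d e c
                     = \sum_e hcomul H e b c * hcomul H d a e;
  hb_counitl b c : \sum_a hcounit H a * hcomul H c a b = (b == c)%:R;
  hb_counitr b c : \sum_a hcounit H a * hcomul H c b a = (b == c)%:R;
  hb_compat a b c d : \sum_e hmul H a b e * hcomul H e c d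
    = \sum_a1 \sum_a2 \sum_b1 \sum_b2 hcomul H a a1 a2 * hcomul H b b1 b2
        * (hmul H a1 b1 c * hmul H a2 b2 d);
  hb_comul1 b c : \sum_a hunit H a * hcomul H a b c = hunit H b * hunit H c;
  hb_counitM a b : \sum_c hcounit H c * hmul H a b c = hcounit H a * hcounit H b;
  hb_counit1 : \sum_a hunit H a * hcounit H a = 1;
  hb_anti a e : \sum_b \sum_c \sum_d hcomul H a b c * hanti H b d * hmul H d c e
              = hcounit H a * hunit H e
}.

Definition dualH (H : hdata C I) : hdata C I :=
  HData (fun a b c => hcomul H c a b) (hcounit H)
        (fun a b c => hmul H b c a) (hunit H) (fun a b => hanti H b a).

Lemma hopf_basis_dual H : hopf_basis H -> hopf_basis (dualH H).
Proof.
case=> A U1 U2 CA E1 E2 K K1 M M1 S; split=> /=.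
- exact: CA.
- exact: E1.
- exact: E2.
- by move=> a b c d; rewrite A.
- by move=> b c; rewrite U1 eq_sym.
- by move=> b c; rewrite U2 eq_sym.
- move=> a b c d; under eq_bigr do rewrite mulrC.
  rewrite K; apply: eq_bigr => a1 _; rewrite exchange_big /=.
  apply: eq_bigr => b1 _; apply: eq_bigr => a2 _; apply: eq_bigr => b2 _.
  by rewrite mulrC.
- exact: M.
- exact: K1.
- by under eq_bigr do rewrite mulrC.
- move=> a e; rewrite mulrC -S.
  rewrite exchange_big [RHS]exchange_big; apply: eq_bigr => c _ /=.
  rewrite [RHS]exchange_big; apply: eq_bigr => b _; apply: eq_bigr => d _ /=.
  by rewrite mulrC [_ * hanti H d b]mulrC mulrA.
Qed.

Definition bvec (J : finType) (j : J) : vec C J := fun i => (i == j)%:R.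

Lemma sum_bvecl (J : finType) (j : J) (F : J -> C) :
  \sum_i bvec j i * F i = F j.
Proof.
rewrite (bigD1 j) //= /bvec eqxx mul1r big1 ?addr0 // => i /negPf ->.
by rewrite mul0r.
Qed.

Lemma sum_delta (J : finType) (j : J) (F : J -> C) :
  \sum_i F i * (i == j)%:R = F j.
Proof. by rewrite -[RHS](sum_bvecl j); apply: eq_bigr => i _; rewrite mulrC. Qed.

Lemma mulH_bvec (H : hdata C I) a b c : mulH H (bvec a) (bvec b) c = hmul H a b c.
Proof.
rewrite /mulH; under eq_bigr do under eq_bigr do rewrite -mulrA.
under eq_bigr do rewrite -mulr_sumr sum_bvecl.
by rewrite sum_bvecl.
Qed.

Lemma mulH_bvecr (H : hdata C I) x b c :
  mulH H x (bvec b) c = \sum_a x a * hmul H a b c.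
Proof.
rewrite /mulH; apply: eq_bigr => a _.
under eq_bigr do rewrite -mulrA; by rewrite -mulr_sumr sum_bvecl.
Qed.

Lemma mulH_bvecl (H : hdata C I) y a c :
  mulH H (bvec a) y c = \sum_b y b * hmul H a b c.
Proof.
rewrite /mulH; under eq_bigr do under eq_bigr do rewrite -mulrA.
by under eq_bigr do rewrite -mulr_sumr; rewrite sum_bvecl.
Qed.

Lemma is_hopf_basis H : is_hopf H -> hopf_basis H.
Proof.
case=> A [U [CA [CU [K [K1 [M [M1 S]]]]]]]; split.
- move=> a b c d; have := A (bvec a) (bvec b) (bvec c) d.
  rewrite mulH_bvecr mulH_bvecl.
  by under eq_bigr do rewrite mulH_bvec; under [in RHS]eq_bigr do rewrite mulH_bvec.
- by move=> b c; have [/(_ c) + _] := U (bvec b); rewrite mulH_bvecr /bvec eq_sym.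
- by move=> b c; have [_ /(_ c)] := U (bvec b); rewrite mulH_bvecl /bvec eq_sym.
- move=> a b c d; have := CA (bvec d) ((a, b), c).
  rewrite /comul_l /comul_r /comulH /=.
  under eq_bigr do rewrite sum_bvecl mulrC.
  by under [X in _ = X]eq_bigr do rewrite sum_bvecl mulrC.
- move=> b c; have [/(_ b) + _] := CU (bvec c).
  rewrite /counit_l /comulH /=; under eq_bigr do rewrite sum_bvecl mulrC.
  by [].
- move=> b c; have [_ /(_ b)] := CU (bvec c).
  rewrite /counit_r /comulH /=; under eq_bigr do rewrite sum_bvecl mulrC.
  by [].
- move=> a b c d; have := K (bvec a) (bvec b) (c, d).
  rewrite /comulH /mul2 /=; under eq_bigr do rewrite mulH_bvec.
  move=> ->; rewrite -(pair_bigA _ (fun a1 a2 => \sum_(r : I * I)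
     (\sum_a0 bvec a a0 * hcomul H a0 a1 a2) * (\sum_a0 bvec b a0 * hcomul H a0 r.1 r.2)
     * hmul H a1 r.1 c * hmul H a2 r.2 d)) /=.
  apply: eq_bigr => a1 _; apply: eq_bigr => a2 _.
  rewrite -(pair_bigA _ (fun b1 b2 =>
     (\sum_a0 bvec a a0 * hcomul H a0 a1 a2) * (\sum_a0 bvec b a0 * hcomul H a0 b1 b2)
     * hmul H a1 b1 c * hmul H a2 b2 d)) /=.
  by apply: eq_bigr => b1 _; apply: eq_bigr => b2 _; rewrite !sum_bvecl !mulrA.
- by move=> b c; have := K1 (b, c).
- move=> a b; have := M (bvec a) (bvec b).
  rewrite /counitH !sum_bvecl => <-; apply: eq_bigr => c _.
  by rewrite mulH_bvec mulrC.
- exact: M1.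
- move=> a e; have [/(_ e) + _] := S (bvec a).
  rewrite /mmap /anti_l /comulH /counitH sum_bvecl => <-.
  rewrite -(pair_bigA _ (fun d c => (\sum_a0 (\sum_a1 bvec a a1 * hcomul H a1 a0 c)
     * hanti H a0 d) * hmul H d c e)) /=.
  under [RHS]eq_bigr do under eq_bigr do rewrite mulr_suml.
  under [RHS]eq_bigr do rewrite exchange_big.
  rewrite [RHS]exchange_big; apply: eq_bigr => b _ /=.
  rewrite exchange_big; apply: eq_bigr => d _; apply: eq_bigr => c _.
  by rewrite sum_bvecl.
Qed.

End BasisLevel.

(** * Positivity of the counit and of the unit *)

(** The order of [C] is partial, so the Archimedean property is asked of nonnegative elements only.
    It turns linear growth into a contradiction with a uniform bound. *)
Definition arch_pos (C : numDomainType) : Prop :=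
  forall x y : C, 0 < x -> 0 <= y -> exists n, y < x *+ n.

Section Superm.
Variables (C : numClosedFieldType) (I : finType) (H : hdata C I).
Hypotheses (arch : arch_pos C) (hopfH : hopf_basis H) (posH : positive_basis H).

Let mu := hmul H.
Let un := hunit H.
Let de := hcomul H.
Let ep := hcounit H.

Lemma mu_ge0 a b c : 0 <= mu a b c. Proof. exact: posH.1. Qed.
Lemma de_ge0 a b c : 0 <= de a b c. Proof. exact: posH.2. Qed.

Definition conv (f g : I -> C) (a : I) : C := \sum_b \sum_c de a b c * (f b * g c).

(** With [f] extended linearly, the second part reads [f a * f b <= f (a b)]. Unlike
    multiplicativity, this also holds for the positive part of the counit and for diagonal
    coefficients of left multiplication. *)
Definition superm (f : I -> C) : Prop :=
  (forall a, 0 <= f a) /\ forall a b, f a * f b <= \sum_c mu a b c * f c.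

Lemma conv_ge0 f g : (forall a, 0 <= f a) -> (forall a, 0 <= g a) ->
  forall a, 0 <= conv f g a.
Proof.
move=> f0 g0 a; apply: sumr_ge0 => b _; apply: sumr_ge0 => c _.
by rewrite mulr_ge0 ?de_ge0 // mulr_ge0.
Qed.

(** The functional [f ⊗ g] is supermultiplicative on the tensor square, and the convolution is its
    composite with the coproduct, an algebra morphism with nonnegative coefficients. *)
Lemma superm_conv f g : superm f -> superm g -> superm (conv f g).
Proof.
move=> [f0 fM] [g0 gM]; split; first exact: conv_ge0.
move=> a b.
have -> : \sum_c mu a b c * conv f g c =
  \sum_a1 \sum_a2 \sum_b1 \sum_b2 de a a1 a2 * de b b1 b2 *
   ((\sum_c mu a1 b1 c * f c) * (\sum_d mu a2 b2 d * g d)).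
  transitivity (\sum_c \sum_d (f c * g d) * \sum_e mu a b e * de e c d).
    under eq_bigr do rewrite mulr_sumr.
    rewrite exchange_big; apply: eq_bigr => c _ /=.
    under eq_bigr do rewrite mulr_sumr.
    rewrite exchange_big; apply: eq_bigr => d _ /=; rewrite mulr_sumr.
    by apply: eq_bigr => e _; rewrite mulrA mulrC.
  under eq_bigr do under eq_bigr do rewrite (hb_compat hopfH) mulr_sumr.
  under eq_bigr do rewrite exchange_big.
  rewrite exchange_big; apply: eq_bigr => a1 _ /=.
  under eq_bigr do under eq_bigr do rewrite mulr_sumr.
  under eq_bigr do rewrite exchange_big.
  rewrite exchange_big; apply: eq_bigr => a2 _ /=.
  under eq_bigr do under eq_bigr do rewrite mulr_sumr.
  under eq_bigr do rewrite exchange_big.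
  rewrite exchange_big; apply: eq_bigr => b1 _ /=.
  under eq_bigr do under eq_bigr do rewrite mulr_sumr.
  under eq_bigr do rewrite exchange_big.
  rewrite exchange_big; apply: eq_bigr => b2 _ /=.
  rewrite mulr_suml mulr_sumr; apply: eq_bigr => c _ /=.
  rewrite 2!mulr_sumr; apply: eq_bigr => d _ /=.
  rewrite mulrCA; congr (_ * _).
  by rewrite mulrC mulrACA.
rewrite /conv mulr_suml; apply: ler_sum => a1 _.
rewrite mulr_suml; apply: ler_sum => a2 _.
rewrite mulr_sumr; apply: ler_sum => b1 _.
rewrite mulr_sumr; apply: ler_sum => b2 _.
rewrite mulrACA; apply: ler_wpM2l; first by rewrite mulr_ge0 ?de_ge0.
rewrite mulrACA; apply: ler_pM; rewrite ?mulr_ge0 //.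
Qed.

Definition superm_cst : C := \sum_a \sum_b \sum_c mu a b c.

Lemma superm_cst_ge0 : 0 <= superm_cst.
Proof. by do 3!(apply: sumr_ge0 => ? _); apply: mu_ge0. Qed.

(** Summing the inequality over all pairs gives [S * S <= superm_cst * S] for the total mass [S].
    The bound does not depend on [f], so it holds for all convolution powers at once. *)
Lemma superm_bound f : superm f -> forall a, f a <= superm_cst.
Proof.
move=> [f0 fM]; set S := \sum_a f a.
have S0 : 0 <= S by apply: sumr_ge0.
have fS a : f a <= S by rewrite /S (bigD1 a) //= lerDl sumr_ge0.
have SS : S * S <= superm_cst * S.
  rewrite {1}/S mulr_suml /superm_cst mulr_suml; apply: ler_sum => a _.
  rewrite /S mulr_sumr mulr_suml; apply: ler_sum => b _.
  apply: le_trans (fM a b) _; rewrite mulr_suml; apply: ler_sum => c _.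
  by apply: ler_wpM2l (fS c); apply: mu_ge0.
suff SK : S <= superm_cst by move=> a; apply: le_trans (fS a) SK.
have [->|Sn0] := eqVneq S 0; first exact: superm_cst_ge0.
by rewrite -(ler_pM2r (_ : 0 < S)) // lt_def Sn0.
Qed.

(** The counit is the identity for convolution. As the coproduct has real coefficients, the
    conjugate of [ep] is an identity too, and the two coincide. *)
Lemma ep_conj a : (ep a)^* = ep a.
Proof.
have decj b c d : (de b c d)^* = de b c d by apply: geC0_conj; apply: de_ge0.
transitivity (\sum_b \sum_c (ep b)^* * de a b c * ep c).
  transitivity (\sum_b (ep b)^* * (b == a)%:R); first by rewrite sum_delta.
  apply: eq_bigr => b _; rewrite -(hb_counitr hopfH b a) mulr_sumr.
  by apply: eq_bigr => c _; rewrite mulrAC mulrA.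
rewrite exchange_big /= -[RHS](sum_delta a ep); apply: eq_bigr => c _.
rewrite -mulr_suml mulrC; congr (_ * _).
have -> : (c == a)%:R = ((c == a)%:R : C)^* by rewrite conjC_nat.
rewrite -(hb_counitl hopfH c a) rmorph_sum; apply: eq_bigr => b _.
by rewrite rmorphM /=; congr (_ * _); exact/esym/decj.
Qed.

(* Let [phi] be the positive part of [ep] and [psi = phi - ep].  Then [phi] is
   supermultiplicative and its [n]-th convolution power dominates [ep + n psi];
   supermultiplicative functions being bounded, [psi = 0]. *)
Lemma ep_ge0 a : 0 <= ep a.
Proof.
have ep_real b : ep b \is Num.real by apply/CrealP; apply: ep_conj.
pose phi b := if 0 <= ep b then ep b else 0.
pose psi b := phi b - ep b.
have phi0 b : 0 <= phi b by rewrite /phi; case: ifP.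
have ep_phi b : ep b <= phi b.
  rewrite /phi; case: ifP => // /negbT.
  by rewrite -real_ltNge ?real0 // => /ltW.
have psi0 b : 0 <= psi b by rewrite subr_ge0.
have phiM : superm phi.
  split=> // b c.
  have pos : 0 <= \sum_e mu b c e * phi e.
    by apply: sumr_ge0 => e _; rewrite mulr_ge0 ?mu_ge0.
  rewrite {1}/phi; case: ifP => _; last by rewrite mul0r.
  rewrite {1}/phi; case: ifP => _; last by rewrite mulr0.
  rewrite -(hb_counitM hopfH); apply: ler_sum => e _.
  by rewrite mulrC; apply: ler_wpM2l (ep_phi e); apply: mu_ge0.
pose pk n := iter n (conv phi) phi.
have pkM n : superm (pk n) by elim: n => //= n; apply: superm_conv.
have epc f b : conv ep f b = f b.
  rewrite /conv exchange_big /= -[RHS](sum_delta b f); apply: eq_bigr => c _.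
  rewrite -(hb_counitl hopfH c b) mulr_sumr; apply: eq_bigr => e _.
  by rewrite mulrA mulrC [de _ _ _ * _]mulrC.
have cep f b : conv f ep b = f b.
  rewrite /conv -[RHS](sum_delta b f); apply: eq_bigr => c _.
  rewrite -(hb_counitr hopfH c b) mulr_sumr; apply: eq_bigr => e _.
  by rewrite mulrCA [ep e * _]mulrC.
have pkge n b : ep b + psi b *+ n.+1 <= pk n b.
  elim: n b => [|n IH] b; first by rewrite mulr1n /psi addrC subrK.
  have -> : pk n.+1 b = pk n b + conv psi (pk n) b.
    rewrite /= -[X in X + _](epc (pk n)) /conv -big_split; apply: eq_bigr => c _ /=.
    rewrite -big_split; apply: eq_bigr => d _ /=.
    by rewrite -mulrDr -mulrDl /psi addrC subrK.
  rewrite mulrSr addrA; apply: lerD => //.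
  rewrite -[X in X <= _]cep /conv; apply: ler_sum => c _; apply: ler_sum => d _.
  apply: ler_wpM2l; first exact: de_ge0.
  apply: ler_wpM2l => //; apply: le_trans (IH d).
  by rewrite lerDl mulrn_wge0.
have : psi a = 0.
  apply: contraTeq isT => psin; have psi_gt : 0 < psi a by rewrite lt_def psin /=.
  have [n] := arch psi_gt (addr_ge0 superm_cst_ge0 (normr_ge0 (ep a))).
  have le1 := superm_bound (pkM n) a.
  have := le_trans (pkge n a) le1.
  rewrite -lerBrDl => le2.
  have le3 : psi a *+ n <= psi a *+ n.+1 by rewrite mulrS lerDr.
  move=> /lt_le_trans/(_ (le_trans le3 le2)).
  rewrite ltrD2l => lt; suff : `|ep a| < `|ep a| by rewrite ltxx.
  by apply: lt_le_trans lt _; rewrite -normrN real_ler_norm // realN.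
by move/eqP; rewrite subr_eq0 => /eqP <-.
Qed.

End Superm.

Lemma positive_basis_dual (C : numClosedFieldType) (I : finType) (H : hdata C I) :
  positive_basis H -> positive_basis (dualH H).
Proof. by case=> p q; split=> a b c /=. Qed.

Lemma un_ge0 (C : numClosedFieldType) (I : finType) (H : hdata C I) :
  arch_pos C -> hopf_basis H -> positive_basis H -> forall a, 0 <= hunit H a.
Proof.
move=> ar /hopf_basis_dual hH /positive_basis_dual pH a.
exact: (ep_ge0 ar hH pH a).
Qed.

(** * The unit idempotents and the two groups *)

Section Units.
Variable (C : numClosedFieldType) (I : finType).

(** Orthogonality leaves a single nonzero value, which must be 1. The idempotents attached to a
    basis vector, and later the values of [xi] and [zeta], are all found in this way. *)
Lemma orth_sum1 (D : I -> C) :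
  (forall w v, w != v -> D w * D v = 0) -> \sum_w D w = 1 ->
  exists w, forall v, D v = (v == w)%:R.
Proof.
move=> D0 D1.
have /existsP[w Dw] : [exists w, D w != 0].
  apply: contraNT (oner_neq0 C) => /existsPn D_0.
  by rewrite -D1 big1 // => w _; apply/eqP; have := D_0 w; rewrite negbK.
have Dv v : v != w -> D v = 0.
  by move=> /D0/eqP; rewrite mulf_eq0 (negPf Dw) orbF => /eqP.
exists w => v; case: eqVneq => [->|/Dv //].
by rewrite -D1 (bigD1 w) //= big1 ?addr0 // => i /Dv.
Qed.

Lemma sumr_eq0_term (J : finType) (F : J -> C) :
  (forall j, 0 <= F j) -> \sum_j F j = 0 -> forall j, F j = 0.
Proof.
move=> F0 /eqP; rewrite psumr_eq0 // => /allP S j.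
by apply/eqP; apply: (implyP (S j _)); rewrite ?mem_index_enum.
Qed.

Lemma term_le_sum (J : finType) (F : J -> C) j :
  (forall i, 0 <= F i) -> F j <= \sum_i F i.
Proof. by move=> F0; rewrite (bigD1 j) //= lerDl sumr_ge0. Qed.

Lemma sumr_neq0_ex (J : finType) (F : J -> C) :
  \sum_j F j != 0 -> exists j, F j != 0.
Proof.
move=> S; apply/existsP; apply: contraNT S => /existsPn F0.
by rewrite big1 // => j _; apply/eqP; have := F0 j; rewrite negbK.
Qed.

Lemma sumr_neq0 (J : finType) (F : J -> C) j :
  (forall i, 0 <= F i) -> F j != 0 -> \sum_i F i != 0.
Proof. by move=> F0; apply: contra => /eqP/(sumr_eq0_term F0)/(_ j)->. Qed.

(** Nothing cancels in the expansion of [1 b = b], so each term of the unit sends [b] to a multiple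
    of [b]. The weighted multiples sum to 1 and, distinct unit terms having product zero, only one
    of them is nonzero. *)
Lemma alg_unit_ex (mu : I -> I -> I -> C) (un : I -> C) :
  (forall a b c, 0 <= mu a b c) -> (forall a, 0 <= un a) ->
  (forall a b c d, \sum_e mu a b e * mu e c d = \sum_e mu b c e * mu a e d) ->
  (forall b c, \sum_a un a * mu a b c = (b == c)%:R) ->
  (forall b c, \sum_a un a * mu b a c = (b == c)%:R) ->
  exists l, forall u b c, un u * mu u b c = ((u == l b) && (b == c))%:R.
Proof.
move=> mu0 un0 A U1 U2.
have L u b c : b != c -> un u * mu u b c = 0.
  move=> bc; apply: (@sumr_eq0_term _ (fun u => un u * mu u b c)).
    by move=> ?; rewrite mulr_ge0.
  by rewrite U1 (negPf bc).
have Rr u b c : b != c -> un u * mu b u c = 0.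
  move=> bc; apply: (@sumr_eq0_term _ (fun u => un u * mu b u c)).
    by move=> ?; rewrite mulr_ge0.
  by rewrite U2 (negPf bc).
(* The product of two unit terms is a multiple of the second by [L] and of the first by [Rr]. *)
have O u v c : u != v -> un u * un v * mu u v c = 0.
  move=> uv; case: (eqVneq v c) => [<-|vc]; last by rewrite mulrAC L // mul0r.
  by rewrite -mulrA Rr // mulr0.
have /fin_all_exists[l lP] b : exists u, forall v, un v * mu v b b = (v == u)%:R.
  apply: orth_sum1; last by rewrite U1 eqxx.
  move=> w v wv; have := A w v b b => /(congr1 (fun x => un w * un v * x)).
  rewrite mulr_sumr big1; last by move=> e _; rewrite mulrA O // mul0r.
  have R4 x y z t : x * y * (z * t) = (x * t) * (y * z) :> C.
    by rewrite [z * t]mulrC mulrACA.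
  rewrite mulr_sumr (bigD1 b) //= R4 big1 ?addr0 // => e eb.
  by rewrite R4 [X in _ * X]L ?mulr0 // eq_sym.
exists l => u b c; case: (eqVneq b c) => [<-|bc]; first by rewrite andbT.
by rewrite andbF L.
Qed.

(** [l b] and [r b] label the unit terms that fix [b] on the left and on the right. As the unit is
    group-like, two unit terms [p] and [q] occur together in the coproduct of exactly one unit term,
    [k p q]. Outside the support of the unit the values of [k] are arbitrary. *)
Record units (H : hdata C I) (l r : I -> I) (k : I -> I -> I) : Prop := Units {
  un_l u b c : hunit H u * hmul H u b c = ((u == l b) && (b == c))%:R;
  un_r u b c : hunit H u * hmul H b u c = ((u == r b) && (b == c))%:R;
  un_k w p q : hunit H w * hcomul H w p q
             = (w == k p q)%:R * (hunit H p * hunit H q) }.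

Section Given.
Variable (H : hdata C I).
Hypotheses (arch : arch_pos C) (hopfH : hopf_basis H) (posH : positive_basis H).
Let mu := hmul H.
Let un := hunit H.
Let de := hcomul H.
Let ep := hcounit H.
Let mu0 : forall a b c, 0 <= mu a b c := mu_ge0 posH.
Let de0 : forall a b c, 0 <= de a b c := de_ge0 posH.
Let un0 : forall a, 0 <= un a := un_ge0 arch hopfH posH.

Lemma units_ex : exists l r k, units H l r k.
Proof.
have [l lP] := @alg_unit_ex mu un mu0 un0 (hb_assoc hopfH) (hb_unitl hopfH) (hb_unitr hopfH).
have [r rP] : exists r, forall u b c, un u * mu b u c = ((u == r b) && (b == c))%:R.
  apply: (@alg_unit_ex (fun a b c => mu b a c)) => //=.
  - by move=> a b c d; rewrite -(hb_assoc hopfH).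
  - exact: hb_unitr hopfH.
  - exact: hb_unitl hopfH.
have lun u : un (l u) != 0.
  have : un (l u) * mu (l u) u u != 0 by rewrite lP !eqxx oner_neq0.
  by rewrite mulf_eq0 => /norP[].
have lu u : un u != 0 -> l u = u.
  move=> u0; have := rP u (l u) u; have := lP (l u) u u.
  rewrite !eqxx /= => e1 /(congr1 ( *%R (un (l u)))).
  rewrite mulrCA e1 mulr1; case: (eqVneq (l u) u) => // _.
  by rewrite andbF mulr0 => u00; rewrite u00 eqxx in u0.
have /fin_all_exists[k kP] (pq : I * I) : exists w0, forall w,
    un w * de w pq.1 pq.2 = (w == w0)%:R * (un pq.1 * un pq.2).
  case: pq => p q /=; case: (eqVneq (un p * un q) 0) => [pq0|pq0].
    exists p => w; rewrite pq0 mulr0.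
    apply: (@sumr_eq0_term _ (fun w => un w * de w p q)).
      by move=> ?; rewrite mulr_ge0.
    by rewrite (hb_comul1 hopfH).
  have [] := @orth_sum1 (fun w => un w * de w p q / (un p * un q)); first last.
  - by move=> w wP; exists w => v; rewrite -wP mulfVK.
  - by rewrite -mulr_suml (hb_comul1 hopfH) divff.
  move=> w v wv; have /andP[p0 q0] : (un p != 0) && (un q != 0).
    by rewrite -negb_or -mulf_eq0.
  have mun0 z : un z != 0 -> mu z z z != 0.
    move=> z0; have := lP z z z; rewrite lu // !eqxx => /eqP.
    by apply: contraTneq => ->; rewrite mulr0 eq_sym oner_neq0.
  have wv0 e : un w * un v * mu w v e = 0.
    apply: contraNeq wv => nz.
    have : un w * mu w v e != 0 by apply: contra nz => /eqP z; rewrite mulrAC z mul0r.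
    have : un v * mu w v e != 0 by apply: contra nz => /eqP z; rewrite -mulrA z mulr0.
    by rewrite lP rP !pnatr_eq0 !eqb0 !negbK => /andP[_ /eqP ->] /andP[_ /eqP ->].
  (* The product of [w] and [v] is zero, hence so is that of their coproducts. If both contained
     [p ⊗ q], its square would survive by positivity, as [p p] contains [p] and [q q] contains
     [q]. *)
  have : un w * un v * (de w p q * de v p q * (mu p p p * mu q q q)) = 0.
    have := hb_compat hopfH w v p q => /(congr1 (fun x => un w * un v * x)).
    rewrite mulr_sumr big1; last by move=> e _; rewrite mulrA wv0 mul0r.
    move=> /esym S; apply/eqP; rewrite eq_le !mulr_ge0 ?un0 ?mu0 ?de0 // andbT.
    rewrite -S; apply: ler_wpM2l; first by rewrite mulr_ge0.
    apply: le_trans (term_le_sum p _); last first.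
      by move=> i; do 3!(apply: sumr_ge0 => ? _); rewrite !mulr_ge0 ?un0 ?mu0 ?de0.
    apply: le_trans (term_le_sum q _); last first.
      by move=> i; do 2!(apply: sumr_ge0 => ? _); rewrite !mulr_ge0 ?un0 ?mu0 ?de0.
    apply: le_trans (term_le_sum p _); last first.
      by move=> i; do 1!(apply: sumr_ge0 => ? _); rewrite !mulr_ge0 ?un0 ?mu0 ?de0.
    apply: le_trans (term_le_sum q _); last first.
      by move=> i; rewrite !mulr_ge0 ?un0 ?mu0 ?de0.
    by [].
  have nz := mulf_neq0 (mun0 p p0) (mun0 q q0).
  rewrite mulrA => /eqP; rewrite mulf_eq0 (negPf nz) orbF => /eqP E.
  by rewrite mulf_div mulrACA E mul0r.
exists l, r, (fun p q => k (p, q)); split=> // w p q; exact: kP (p, q) w.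
Qed.

End Given.
End Units.

Section UnitsTheory.
Variables (C : numClosedFieldType) (I : finType) (H : hdata C I).
Hypotheses (hopfH : hopf_basis H) (posH : positive_basis H).
Variables (l r : I -> I) (k : I -> I -> I).
Hypothesis (UH : units H l r k).
Let mu := hmul H.
Let un := hunit H.
Let de := hcomul H.
Let ep := hcounit H.

Lemma l_neq0 b : un (l b) != 0.
Proof.
have : un (l b) * mu (l b) b b != 0 by rewrite (un_l UH) !eqxx oner_neq0.
by rewrite mulf_eq0 => /norP[].
Qed.

Lemma r_neq0 b : un (r b) != 0.
Proof.
have : un (r b) * mu b (r b) b != 0 by rewrite (un_r UH) !eqxx oner_neq0.
by rewrite mulf_eq0 => /norP[].
Qed.

(** The product of [l u] and [u] contains [u] because [l u] fixes [u]; being a unit term, [u] acts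
    on the right of [l u] by a scalar, so only [l u] can occur. *)
Lemma l_id u : un u != 0 -> l u = u.
Proof.
move=> u0; have := un_r UH u (l u) u; have := un_l UH (l u) u u.
rewrite !eqxx /= => e1 /(congr1 ( *%R (un (l u)))).
rewrite mulrCA e1 mulr1; case: (eqVneq (l u) u) => // _.
by rewrite andbF mulr0 => u00; rewrite /un u00 eqxx in u0.
Qed.

Lemma r_id u : un u != 0 -> r u = u.
Proof.
move=> u0; have := un_l UH u (r u) u; have := un_r UH (r u) u u.
rewrite !eqxx /= => e1 /(congr1 ( *%R (un (r u)))).
rewrite mulrCA e1 mulr1; case: (eqVneq (r u) u) => // _.
by rewrite andbF mulr0 => u00; rewrite /un u00 eqxx in u0.
Qed.

(** Associativity with an idempotent inserted: between the factors for [r a = l b], before them for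
    [l c = l a], after them for [r c = r b]. *)
Lemma mu_deg a b c : mu a b c != 0 -> [/\ r a = l b, l c = l a & r c = r b].
Proof.
move=> nz; split.
- have := hb_assoc hopfH a (l b) b c => /(congr1 ( *%R (un (l b)))).
  rewrite !mulr_sumr; under eq_bigr do rewrite mulrA (un_r UH).
  under [in RHS]eq_bigr do rewrite mulrA (un_l UH) eqxx /=.
  under [in RHS]eq_bigr do rewrite eq_sym mulrC.
  rewrite sum_delta; case: (eqVneq (l b) (r a)) => // _ /=.
  by rewrite big1 => [/esym/eqP|e _]; rewrite ?(negPf nz) ?mul0r.
- have := hb_assoc hopfH (l a) a b c => /(congr1 ( *%R (un (l a)))).
  rewrite !mulr_sumr; under eq_bigr do rewrite mulrA (un_l UH) eqxx /= eq_sym mulrC.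
  rewrite sum_delta; under eq_bigr do rewrite mulrCA (un_l UH).
  rewrite (bigD1 c) //= eqxx andbT big1 ?addr0; last first.
    by move=> e /negPf->; rewrite andbF mulr0.
  by case: (eqVneq (l a) (l c)) => // _ /eqP; rewrite mulr0 (negPf nz).
- have := hb_assoc hopfH a b (r b) c => /(congr1 ( *%R (un (r b)))).
  rewrite !mulr_sumr; under [in RHS]eq_bigr do rewrite mulrA (un_r UH) eqxx /= eq_sym mulrC.
  rewrite sum_delta; under eq_bigr do rewrite mulrCA (un_r UH).
  rewrite (bigD1 c) //= eqxx andbT big1 ?addr0; last first.
    by move=> e /negPf->; rewrite andbF mulr0.
  by case: (eqVneq (r b) (r c)) => // _ /esym/eqP; rewrite mulr0 (negPf nz).
Qed.

Lemma sum_delta2 (J : finType) (b : J) (B : bool) (F : J -> C) :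
  \sum_i F i * (B && (b == i))%:R = F b * B%:R.
Proof.
case: B => /=; last by rewrite mulr0 big1 // => i _; rewrite mulr0.
by rewrite mulr1; under eq_bigr do rewrite eq_sym; rewrite sum_delta.
Qed.

(** Up to a scalar [(l a) a] is [a]. In its coproduct, a term [b ⊗ c] arises from a term [p ⊗ q] of
    the coproduct of [l a], where [p] fixes [b] and [q] fixes [c]; and [k p q = l a]. The second
    equality uses [a (r a)]. *)
Lemma de_deg a b c : de a b c != 0 -> k (l b) (l c) = l a /\ k (r b) (r c) = r a.
Proof.
move=> nz; split.
- have := hb_compat hopfH (l a) a b c => /(congr1 ( *%R (un (l a)))).
  rewrite mulr_sumr; under eq_bigr do rewrite mulrA mulrC (un_l UH) eqxx.
  rewrite sum_delta2 mulr1 => E; apply/eqP; apply: contraNT nz => ne; apply/eqP.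
  rewrite /de E mulr_sumr big1 // => p _; rewrite mulr_sumr big1 // => q _.
  rewrite mulr_sumr big1 // => b1 _; rewrite mulr_sumr big1 // => b2 _.
  rewrite mulrA mulrA mulrA (un_k UH) -!mulrA.
  have [pq|] := eqVneq (l a) (k p q); last by rewrite mul0r.
  have P x y z : un x * mu x y z != 0 -> x = l z.
    by rewrite (un_l UH) pnatr_eq0 eqb0 negbK => /andP[/eqP -> /eqP ->].
  apply: contraNeq ne => nz2.
  suff [-> ->] : l b = p /\ l c = q by rewrite pq.
  split; symmetry; [apply: (P p b1)|apply: (P q b2)]; apply: contra nz2 => /eqP;
    rewrite /un /mu => /eqP; rewrite mulf_eq0 => /orP[] /eqP ->; by rewrite !(mul0r, mulr0).
- have := hb_compat hopfH a (r a) b c => /(congr1 ( *%R (un (r a)))).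
  rewrite mulr_sumr; under eq_bigr do rewrite mulrA mulrC (un_r UH) eqxx.
  rewrite sum_delta2 mulr1 => E; apply/eqP; apply: contraNT nz => ne; apply/eqP.
  rewrite /de E mulr_sumr big1 // => b1 _; rewrite mulr_sumr big1 // => b2 _.
  rewrite mulr_sumr big1 // => p _; rewrite mulr_sumr big1 // => q _.
  rewrite mulrA [X in X * _]mulrCA (un_k UH) -!mulrA.
  have [pq|] := eqVneq (r a) (k p q); last by rewrite !(mul0r, mulr0).
  have P x y z : un x * mu y x z != 0 -> x = r z.
    by rewrite (un_r UH) pnatr_eq0 eqb0 negbK => /andP[/eqP -> /eqP ->].
  apply: contraNeq ne => nz2.
  suff [-> ->] : r b = p /\ r c = q by rewrite pq.
  split; symmetry; [apply: (P p b1)|apply: (P q b2)]; apply: contra nz2 => /eqP;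
    rewrite /un /mu => /eqP; rewrite mulf_eq0 => /orP[] /eqP ->; by rewrite !(mul0r, mulr0).
Qed.

(** The counit is multiplicative, so its values on orthogonal idempotents of sum 1 are themselves
    orthogonal and of sum 1. *)
Lemma u0_ex : exists u0, forall u, un u * ep u = (u == u0)%:R.
Proof.
apply: orth_sum1; last exact: hb_counit1 hopfH.
move=> w v wv; rewrite mulrACA -(hb_counitM hopfH) mulr_sumr big1 // => e _.
rewrite mulrCA; apply/eqP; rewrite mulf_eq0; apply/orP; right; apply/eqP.
apply: contraNeq wv => nz.
have : un w * mu w v e != 0 by apply: contra nz => /eqP z; rewrite mulrAC z mul0r.
have : un v * mu w v e != 0 by apply: contra nz => /eqP z; rewrite -mulrA z mulr0.
by rewrite (un_l UH) (un_r UH) !pnatr_eq0 !eqb0 !negbK => /andP[_ /eqP ->] /andP[_ /eqP ->].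
Qed.

Variable u0 : I.
Hypothesis u0P : forall u, un u * ep u = (u == u0)%:R.

(** Associativity of [k] is coassociativity on the terms of the unit, and its identity is the unit
    term on which the counit does not vanish. *)
Lemma unit_group : exists (kT : finGroupType) (f : kT -> I),
  [/\ injective f, forall x, un x != 0 <-> exists y, f y = x,
      {morph f : x y / (x * y)%g >-> k x y} & f 1%g = u0].
Proof.
have u0n : un u0 != 0.
  by have /eqP := u0P u0; rewrite eqxx; apply: contraTneq => ->; rewrite mul0r eq_sym oner_neq0.
have kk p q w : un p != 0 -> un q != 0 -> (un w * de w p q != 0) = (w == k p q).
  move=> p0 q0; rewrite (un_k UH) mulr_natl mulrb.
  case: (w == _); last by rewrite eqxx.
  apply: mulf_neq0 => //.
apply: (finGroup_of_pred (A := fun x => un x != 0)) => //.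
- move=> p q p0 q0; have := kk p q (k p q) p0 q0.
  by rewrite eqxx mulf_eq0 => /norP[].
- move=> p q s p0 q0 s0; pose w := k (k p q) s.
  have Ak x y : un x != 0 -> un y != 0 -> un (k x y) != 0 /\ de (k x y) x y != 0.
    by move=> x0 y0; apply/andP; rewrite -negb_or -mulf_eq0 kk.
  have [pq0 dpq] := Ak p q p0 q0; have [w0 dw] := Ak _ s pq0 s0.
  have : \sum_e de e p q * de w e s != 0.
    apply: (sumr_neq0 (j := k p q)); last exact: mulf_neq0.
    by move=> e; rewrite mulr_ge0 ?de_ge0.
  rewrite (hb_coassoc hopfH) => /sumr_neq0_ex[e].
  rewrite mulf_eq0 negb_or => /andP[eqs wpe].
  have : un w * de w p e != 0 by rewrite mulf_neq0.
  rewrite (un_k UH) !mulf_eq0 !negb_or pnatr_eq0 eqb0 negbK => /and3P[/eqP E _ e0].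
  rewrite -/w E; have : un e * de e q s != 0 by rewrite mulf_neq0.
  by rewrite (un_k UH) !mulf_eq0 !negb_or pnatr_eq0 eqb0 negbK => /and3P[/eqP -> _ _].
- move=> q q0; have := hb_counitl hopfH q q => /(congr1 ( *%R (un q))).
  rewrite mulr_sumr eqxx mulr1 (bigD1 u0) //= big1 => [|a au]; last first.
    rewrite mulrCA (un_k UH) mulrCA [ep a * (_ * _)]mulrA [ep a * _]mulrC u0P (negPf au).
    by rewrite mul0r mulr0.
  rewrite addr0 mulrCA (un_k UH); case: eqVneq => [//|_]; rewrite !mul0r mulr0 => z.
  by move: q0 => /=; rewrite -z eqxx.
(* Inverses come from the antipode: [q] occurs in [S(b) c] for some term [b ⊗ c] of the coproduct of
   [u0]. Comparing right idempotents gives [c = q], so [k b q = u0]. *)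
- move=> q q0; have : ep u0 * un q != 0.
    rewrite mulf_neq0 //; have /eqP := u0P u0; rewrite eqxx.
    by apply: contraTneq => ->; rewrite mulr0 eq_sym oner_neq0.
  rewrite -(hb_anti hopfH) => /sumr_neq0_ex[b] /sumr_neq0_ex[c] /sumr_neq0_ex[d].
  rewrite !mulf_eq0 !negb_or => /andP[/andP[de0 _]] /mu_deg[_ _ rq].
  have : un u0 * de u0 b c != 0 by rewrite mulf_neq0.
  rewrite (un_k UH) !mulf_eq0 !negb_or pnatr_eq0 eqb0 negbK => /and3P[/eqP E b0 c0].
  by exists b => //; rewrite r_id // r_id // in rq; rewrite rq.
Qed.

End UnitsTheory.

(** * The two gradings of the basis *)

Section Graded.
Variables (C : numClosedFieldType) (I : finType).

(** A basis vector [b] behaves as a square with edges [L b], [R b] in [kT] and [X b], [Y b] in [gT].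
    By [g_mu] a product glues squares along a [kT] edge; by [g_de] a coproduct cuts a square along a
    [gT] edge. The [f p] and the [h x] are the identity squares of the two gluings. *)
Record graded (H : hdata C I) (kT gT : finGroupType) (f : kT -> I) (h : gT -> I)
    (L R : I -> kT) (X Y : I -> gT) : Prop := Graded {
  g_finj : injective f;
  g_fP a : hunit H a != 0 -> exists p, a = f p;
  g_fn p : hunit H (f p) != 0;
  g_hP a : hcounit H a != 0 -> exists x, a = h x;
  g_hn x : hcounit H (h x) != 0;
  g_f1 : f 1%g = h 1%g;
  g_f1n : hunit H (f 1%g) * hcounit H (f 1%g) = 1;
  g_L p b c : hunit H (f p) * hmul H (f p) b c = ((p == L b) && (b == c))%:R;
  g_R p b c : hunit H (f p) * hmul H b (f p) c = ((p == R b) && (b == c))%:R;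
  g_X x b c : hcounit H (h x) * hcomul H b (h x) c = ((x == X b) && (b == c))%:R;
  g_Y x b c : hcounit H (h x) * hcomul H b c (h x) = ((x == Y b) && (b == c))%:R;
  g_fde w p q : hunit H w * hcomul H w (f p) (f q)
              = (w == f (p * q)%g)%:R * (hunit H (f p) * hunit H (f q));
  g_fde_neq0 w a b : hunit H w != 0 -> hcomul H w a b != 0 ->
     hunit H a != 0 /\ hunit H b != 0;
  g_hmu w x y : hcounit H w * hmul H (h x) (h y) w
              = (w == h (x * y)%g)%:R * (hcounit H (h x) * hcounit H (h y));
  g_Lf p : L (f p) = p;
  g_Rf p : R (f p) = p;
  g_Xh x : X (h x) = x;
  g_Yh x : Y (h x) = x;
  g_Xf p : X (f p) = 1%g;
  g_Yf p : Y (f p) = 1%g;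
  g_Lh x : L (h x) = 1%g;
  g_Rh x : R (h x) = 1%g;
  g_mu a b c : hmul H a b c != 0 ->
    [/\ R a = L b, L c = L a, R c = R b, X c = (X a * X b)%g & Y c = (Y a * Y b)%g];
  g_de a b c : hcomul H a b c != 0 ->
    [/\ Y b = X c, X b = X a, Y c = Y a, L a = (L b * L c)%g & R a = (R b * R c)%g]
}.

Lemma unit_factor (J K : finType) (f : J -> K) (P : pred K) (l : I -> K) :
  injective f -> (forall x, P x <-> exists y, f y = x) -> (forall b, P (l b)) ->
  exists L : I -> J, forall b, f (L b) = l b.
Proof.
move=> finj fP Pl.
suff /fin_all_exists[L LP] : forall b, exists y, f y = l b by exists L.
by move=> b; apply/fP/Pl.
Qed.

Lemma graded_ex (H : hdata C I) :
  arch_pos C -> hopf_basis H -> positive_basis H ->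
  exists (kT gT : finGroupType) f h L R X Y, @graded H kT gT f h L R X Y.
Proof.
move=> arch hopfH posH.
have hopfD := hopf_basis_dual hopfH; have posD := positive_basis_dual posH.
have [l [r [k UH]]] := units_ex arch hopfH posH.
have [ld [rd [k' UD]]] := units_ex arch hopfD posD.
have [u0 u0P] := u0_ex hopfH UH.
have u0P' : forall u, hunit (dualH H) u * hcounit (dualH H) u = (u == u0)%:R.
  by move=> u; rewrite mulrC; apply: u0P.
have [kT [f [finj fP fM f1]]] := unit_group hopfH posH UH u0P.
have [gT [h [hinj hP hM h1]]] := unit_group hopfD posD UD u0P'.
have [L LP] := unit_factor finj fP (l_neq0 UH).
have [R RP] := unit_factor finj fP (r_neq0 UH).
have [X XP] := unit_factor hinj hP (l_neq0 UD).
have [Y YP] := unit_factor hinj hP (r_neq0 UD).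
have fn p : hunit H (f p) != 0 by apply/fP; exists p.
have hn x : hcounit H (h x) != 0 by apply/(hP (h x)); exists x.
have un1 : hunit H u0 * hcounit H u0 = 1 by rewrite u0P eqxx.
have fde_neq0 w a b : hunit H w != 0 -> hcomul H w a b != 0 ->
     hunit H a != 0 /\ hunit H b != 0.
  move=> w0 d0; have : hunit H w * hcomul H w a b != 0 by rewrite mulf_neq0.
  by rewrite (un_k UH) !mulf_eq0 !negb_or => /and3P[].
have hmu_neq0 w a b : hcounit H w != 0 -> hmul H a b w != 0 ->
     hcounit H a != 0 /\ hcounit H b != 0.
  move=> w0 d0; have : hcounit H w * hmul H a b w != 0 by rewrite mulf_neq0.
  by have := un_k UD w a b; rewrite /= => ->; rewrite !mulf_eq0 !negb_or => /and3P[].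
(* The supports of the unit and of the counit meet only in [u0]. This is what makes the [gT] degrees
   of each [f p] and the [kT] degrees of each [h x] trivial. *)
have u0_uniq u : hunit H u != 0 -> hcounit H u != 0 -> u = u0.
  move=> a b; have : hunit H u * hcounit H u != 0 by rewrite mulf_neq0.
  by rewrite u0P pnatr_eq0 eqb0 negbK => /eqP.
exists kT, gT, f, h, L, R, X, Y; split => //.
- by move=> a /fP[p <-]; exists p.
- by move=> a /(hP a)[p <-]; exists p.
- by rewrite f1 h1.
- by rewrite f1.
- by move=> p b c; rewrite (un_l UH) -LP (inj_eq finj).
- by move=> p b c; rewrite (un_r UH) -RP (inj_eq finj).
- move=> x b c; have := un_l UD (h x) c b; rewrite /= -XP (inj_eq hinj) => ->.
  by case: (eqVneq c b) => [->|]; rewrite ?andbF // andbT eqxx andbT.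
- move=> x b c; have := un_r UD (h x) c b; rewrite /= -YP (inj_eq hinj) => ->.
  by case: (eqVneq c b) => [->|]; rewrite ?andbF // andbT eqxx andbT.
- by move=> w p q; rewrite (un_k UH) fM.
- by move=> w x y; have := un_k UD w (h x) (h y); rewrite /= hM.
- by move=> p; apply: finj; rewrite LP (l_id UH).
- by move=> p; apply: finj; rewrite RP (r_id UH).
- by move=> p; apply: hinj; rewrite XP (l_id UD (hn p)).
- by move=> p; apply: hinj; rewrite YP (r_id UD (hn p)).
- move=> p; apply: hinj; rewrite XP h1; have := un_l UD (ld (f p)) (f p) (f p).
  rewrite !eqxx /= => E; have : hcomul H (f p) (ld (f p)) (f p) != 0.
    by apply: contra_eq_neq E => ->; rewrite mulr0 eq_sym oner_neq0.
  by move=> /(fde_neq0 _ _ _ (fn p))[a _]; apply: u0_uniq a (l_neq0 UD _).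
- move=> p; apply: hinj; rewrite YP h1; have := un_r UD (rd (f p)) (f p) (f p).
  rewrite !eqxx /= => E; have : hcomul H (f p) (f p) (rd (f p)) != 0.
    by apply: contra_eq_neq E => ->; rewrite mulr0 eq_sym oner_neq0.
  by move=> /(fde_neq0 _ _ _ (fn p))[_ a]; apply: u0_uniq a (r_neq0 UD _).
- move=> p; apply: finj; rewrite LP f1; have := un_l UH (l (h p)) (h p) (h p).
  rewrite !eqxx /= => E; have : hmul H (l (h p)) (h p) (h p) != 0.
    by apply: contra_eq_neq E => ->; rewrite mulr0 eq_sym oner_neq0.
  by move=> /(hmu_neq0 _ _ _ (hn p))[a _]; apply: u0_uniq (l_neq0 UH _) a.
- move=> p; apply: finj; rewrite RP f1; have := un_r UH (r (h p)) (h p) (h p).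
  rewrite !eqxx /= => E; have : hmul H (h p) (r (h p)) (h p) != 0.
    by apply: contra_eq_neq E => ->; rewrite mulr0 eq_sym oner_neq0.
  by move=> /(hmu_neq0 _ _ _ (hn p))[_ a]; apply: u0_uniq (r_neq0 UH _) a.
- move=> a b c nz; have [E1 E2 E3] := mu_deg hopfH UH nz.
  have [E4 E5] := de_deg (a := c) (b := a) (c := b) hopfD UD nz.
  split; [apply: finj|apply: finj|apply: finj|apply: hinj|apply: hinj].
  + by rewrite RP LP.
  + by rewrite !LP.
  + by rewrite !RP.
  + by rewrite hM !XP.
  + by rewrite hM !YP.
- move=> a b c nz; have [E1 E2 E3] := mu_deg (a := b) (b := c) (c := a) hopfD UD nz.
  have [E4 E5] := de_deg hopfH UH nz.
  split; [apply: hinj|apply: hinj|apply: hinj|apply: finj|apply: finj].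
  + by rewrite YP XP.
  + by rewrite !XP.
  + by rewrite !YP.
  + by rewrite fM !LP.
  + by rewrite fM !RP.
Qed.

End Graded.

(** * Basis vectors of trivial degree *)

Section Vectors.
Variables (C : numClosedFieldType) (I : finType) (H : hdata C I).
Hypotheses (isH : is_hopf H) (posH : positive_basis H).

Definition nneg (J : finType) (x : J -> C) := forall j, 0 <= x j.
Definition vle (J : finType) (x y : J -> C) := forall j, x j <= y j.
Definition tens (x y : I -> C) : vec C (I * I) := fun p => x p.1 * y p.2.
Definition vadd (J : finType) (x y : J -> C) : J -> C := fun j => x j + y j.
Definition vpow (x : I -> C) n := iter n (mulH H x) (oneH H).
Definition ev (g v : I -> C) := \sum_a v a * g a.

Lemma mulHA x y z : mulH H (mulH H x y) z = mulH H x (mulH H y z).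
Proof. by case: isH => A _; apply/funext; apply: A. Qed.
Lemma mul1H x : mulH H (oneH H) x = x.
Proof. by case: isH => _ [U _]; apply/funext; case: (U x). Qed.
Lemma mulH1 x : mulH H x (oneH H) = x.
Proof. by case: isH => _ [U _]; apply/funext; case: (U x). Qed.
Lemma comulHM x y : comulH H (mulH H x y) = mul2 H (comulH H x) (comulH H y).
Proof. by case: isH => _ [_ [_ [_ [K _]]]]; apply/funext; apply: K. Qed.
Lemma comulH1 : comulH H (oneH H) = tens (oneH H) (oneH H).
Proof. by case: isH => _ [_ [_ [_ [_ [K _]]]]]; apply/funext; apply: K. Qed.

Lemma vpowD x m n : vpow x (m + n) = mulH H (vpow x m) (vpow x n).
Proof.
elim: m => [|m IH]; first by rewrite mul1H.
by rewrite addSn /= -/(vpow x (m + n)) IH mulHA.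
Qed.

Lemma sum_pair_mul (J K : finType) (F : J -> C) (G : K -> C) :
  \sum_(q : J * K) F q.1 * G q.2 = (\sum_j F j) * (\sum_k G k).
Proof.
rewrite big_distrlr -(pair_bigA _ (fun j k => F j * G k)) /=; exact: eq_bigr.
Qed.

Lemma mul2_tens a b c d :
  mul2 H (tens a b) (tens c d) = tens (mulH H a c) (mulH H b d).
Proof.
apply/funext => -[p q]; rewrite /mul2 /tens /mulH /=.
rewrite -sum_pair_mul; apply: eq_bigr => -[a1 b1] _ /=.
rewrite -sum_pair_mul; apply: eq_bigr => -[c1 d1] _ /=.
by rewrite [X in X * _ * _ = _]mulrACA -mulrA [LHS]mulrACA.
Qed.

Lemma mulH_nneg x y : nneg x -> nneg y -> nneg (mulH H x y).
Proof.
move=> x0 y0 c; do 2!(apply: sumr_ge0 => ? _).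
by rewrite !mulr_ge0 ?mu_ge0.
Qed.

Lemma mul2_nneg s t : nneg s -> nneg t -> nneg (mul2 H s t).
Proof.
move=> x0 y0 c; do 2!(apply: sumr_ge0 => ? _).
by rewrite !mulr_ge0 ?mu_ge0.
Qed.

Lemma mul2_mono s s' t t' : nneg s -> nneg t -> vle s s' -> vle t t' ->
  vle (mul2 H s t) (mul2 H s' t').
Proof.
move=> s0 t0 ss tt p; do 2!(apply: ler_sum => ? _).
do 2!(apply: ler_wpM2r; first exact: mu_ge0).
exact: ler_pM.
Qed.

Lemma mul2_addl s s' t : mul2 H (vadd s s') t = vadd (mul2 H s t) (mul2 H s' t).
Proof.
apply/funext => p; rewrite /mul2 /vadd -big_split; apply: eq_bigr => q _ /=.
by rewrite -big_split; apply: eq_bigr => r _ /=; rewrite !mulrDl.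
Qed.

Lemma mul2_addr s t t' : mul2 H s (vadd t t') = vadd (mul2 H s t) (mul2 H s t').
Proof.
apply/funext => p; rewrite /mul2 /vadd -big_split; apply: eq_bigr => q _ /=.
by rewrite -big_split; apply: eq_bigr => r _ /=; rewrite mulrDr !mulrDl.
Qed.

Lemma tens_nneg x y : nneg x -> nneg y -> nneg (tens x y).
Proof. by move=> x0 y0 p; rewrite mulr_ge0. Qed.

Lemma vle_neq0 (J : finType) (x y : J -> C) j : nneg x -> vle x y -> x j != 0 -> y j != 0.
Proof.
move=> x0 xy xj; have : 0 < x j by rewrite lt_def xj x0.
by move=> /lt_le_trans/(_ (xy j)); rewrite lt_def => /andP[].
Qed.

Lemma mulH_neq0 x y a b c : nneg x -> nneg y ->
  x a != 0 -> y b != 0 -> hmul H a b c != 0 -> mulH H x y c != 0.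
Proof.
move=> x0 y0 xa yb m0; rewrite /mulH.
have P i j : 0 <= x i * y j * hmul H i j c by rewrite !mulr_ge0 ?mu_ge0.
apply: (sumr_neq0 (j := a)) => [i|]; first by apply: sumr_ge0.
by apply: (sumr_neq0 (j := b)) => //; rewrite !mulf_neq0.
Qed.

End Vectors.

Section DegreeOne.
Variables (C : numClosedFieldType) (I : finType) (H : hdata C I).
Hypotheses (arch : arch_pos C) (isH : is_hopf H) (posH : positive_basis H).
Variables (kT gT : finGroupType) (f : kT -> I) (h : gT -> I).
Variables (L R : I -> kT) (X Y : I -> gT).
Hypothesis (gr : graded H f h L R X Y).

Let hopfH := is_hopf_basis isH.
Let mu := hmul H.
Let un := hunit H.
Let de := hcomul H.
Let ep := hcounit H.
Let mu0 : forall a b c, 0 <= mu a b c := mu_ge0 posH.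
Let de0 : forall a b c, 0 <= de a b c := de_ge0 posH.
Let un0 : nneg un := un_ge0 arch hopfH posH.
Let ep0 : nneg ep := ep_ge0 arch hopfH posH.

(** A diagonal entry of a product of nonnegative matrices is at least the product of the diagonal
    entries; here the matrices are those of left multiplications. *)
Lemma diag_superm c : superm H (fun a => mu a c c).
Proof.
split=> [a|a b]; first exact: mu0.
rewrite (hb_assoc hopfH) mulrC; apply: (term_le_sum c) => e; exact: mulr_ge0.
Qed.

(** Evaluating a convolution on [v] amounts to evaluating [g1 ⊗ g2] on the coproduct of [v], which
    is monotone. *)
Lemma ev_conv_ge g1 g2 v v1 v2 : nneg g1 -> nneg g2 ->
  vle (tens v1 v2) (comulH H v) -> ev g1 v1 * ev g2 v2 <= ev (conv H g1 g2) v.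
Proof.
move=> g10 g20 le; rewrite /ev /conv.
rewrite -(sum_pair_mul (fun a => v1 a * g1 a) (fun a => v2 a * g2 a)).
have -> : \sum_a v a * (\sum_b \sum_c hcomul H a b c * (g1 b * g2 c)) =
          \sum_p comulH H v p * (g1 p.1 * g2 p.2).
  under [RHS]eq_bigr do rewrite mulr_suml.
  rewrite [RHS]exchange_big; apply: eq_bigr => a _ /=.
  rewrite mulr_sumr -(pair_bigA _ (fun b c => v a * hcomul H a b c * (g1 b * g2 c))) /=.
  by apply: eq_bigr => b _; rewrite mulr_sumr; apply: eq_bigr => c _; rewrite mulrA.
apply: ler_sum => p _; rewrite mulrACA; apply: ler_wpM2r (le p).
exact: mulr_ge0.
Qed.

Lemma ev_conv_ge2 g1 g2 v v1 v2 w1 w2 : nneg g1 -> nneg g2 ->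
  vle (vadd (tens v1 v2) (tens w1 w2)) (comulH H v) ->
  ev g1 v1 * ev g2 v2 + ev g1 w1 * ev g2 w2 <= ev (conv H g1 g2) v.
Proof.
move=> g10 g20 le; rewrite /ev /conv.
rewrite -(sum_pair_mul (fun a => v1 a * g1 a) (fun a => v2 a * g2 a)).
rewrite -(sum_pair_mul (fun a => w1 a * g1 a) (fun a => w2 a * g2 a)).
have -> : \sum_a v a * (\sum_b \sum_c hcomul H a b c * (g1 b * g2 c)) =
          \sum_p comulH H v p * (g1 p.1 * g2 p.2).
  under [RHS]eq_bigr do rewrite mulr_suml.
  rewrite [RHS]exchange_big; apply: eq_bigr => a _ /=.
  rewrite mulr_sumr -(pair_bigA _ (fun b c => v a * hcomul H a b c * (g1 b * g2 c))) /=.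
  by apply: eq_bigr => b _; rewrite mulr_sumr; apply: eq_bigr => c _; rewrite mulrA.
rewrite -big_split; apply: ler_sum => p _ /=; rewrite mulrACA [X in _ + X]mulrACA.
by rewrite -mulrDl; apply: ler_wpM2r (le p); exact: mulr_ge0.
Qed.

Lemma ev_conv1 g1 g2 : ev (conv H g1 g2) un = ev g1 un * ev g2 un.
Proof.
rewrite /ev /conv -(sum_pair_mul (fun a => un a * g1 a) (fun a => un a * g2 a)).
under eq_bigr do rewrite mulr_sumr; rewrite exchange_big /=.
rewrite -(pair_bigA _ (fun b c => un b * g1 b * (un c * g2 c))) /=; apply: eq_bigr => b _.
under eq_bigr do rewrite mulr_sumr; rewrite exchange_big /=; apply: eq_bigr => c _.
under eq_bigr do rewrite mulrA; by rewrite -mulr_suml (hb_comul1 hopfH) mulrACA.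
Qed.

Lemma ev_diag1 c : ev (fun a => mu a c c) un = 1.
Proof. by rewrite /ev (hb_unitl hopfH) eqxx. Qed.

(* [conv H (mu _ c c) (mu _ d d)] is a diagonal coefficient of the regular
   representation tensored with itself; for [d = f (L c)^-1] it sends the
   idempotent of [f 1] to at least 1. *)
Lemma diag_pair_f1 c :
  1 <= un (f 1%g) * conv H (fun a => mu a c c)
         (fun a => mu a (f (L c)^-1%g) (f (L c)^-1%g)) (f 1%g).
Proof.
rewrite /conv; set p := L c; set d := f p^-1%g.
have T x y : 0 <= hcomul H (f 1%g) x y * (mu x c c * mu y d d).
  by rewrite !mulr_ge0 //; apply: de0.
have P1 : un (f p) * mu (f p) c c = 1 by rewrite (g_L gr) !eqxx.
have P2 : un d * mu d d d = 1 by rewrite (g_L gr) (g_Lf gr) !eqxx.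
have -> : 1 = un (f 1%g) * (de (f 1%g) (f p) d * (mu (f p) c c * mu d d d)).
  by rewrite mulrA (g_fde gr) mulgV eqxx mul1r mulrACA P1 P2 mulr1.
apply: ler_wpM2l; first exact: un0.
apply: le_trans (term_le_sum (f p) _); last by move=> x; apply: sumr_ge0.
exact: le_trans (term_le_sum d _).
Qed.

Section Power.
Variables (x : I -> C) (dl : gT).
Hypothesis x0 : nneg x.
(** The multiple of [h dl] with counit 1. The inequality [Dx] imitates a skew-primitive element;
    together with [xn] it is refuted in [pow_acyclic]. *)
Let dv : I -> C := fun c => (c == h dl)%:R / ep (h dl).
Hypothesis Dx : vle (vadd (tens x un) (tens dv x)) (comulH H x).
Hypothesis xn : exists c, x c != 0.

Let dv0 : nneg dv. Proof. by move=> c; rewrite mulr_ge0 ?invr_ge0 ?ler0n ?ep0. Qed.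

Let pow_nneg v n : nneg v -> nneg (vpow H v n).
Proof.
by move=> v0; elim: n => [|n IH]; [exact: un0 | apply: mulH_nneg].
Qed.

Let Dx1 : vle (tens x un) (comulH H x).
Proof.
move=> p; apply: le_trans (Dx p); rewrite /vadd lerDl.
exact: tens_nneg.
Qed.

Let Dx2 : vle (tens dv x) (comulH H x).
Proof.
move=> p; apply: le_trans (Dx p); rewrite /vadd lerDr.
exact: tens_nneg.
Qed.

Let pow_D1 n : vle (tens (vpow H x n) un) (comulH H (vpow H x n)).
Proof.
elim: n => [|n IH]; first by rewrite (comulH1 isH) => p.
rewrite /= (comulHM isH) -{1}[un](mulH1 isH) -(mul2_tens) => p.
apply: mul2_mono => //; apply: tens_nneg => //; exact: pow_nneg.
Qed.

(** Each [f q] occurs in the unit, so [c ⊗ f q] occurs in the coproduct of [y]. Taking [q] inverse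
    to [L c] makes the left degree of the term it comes from trivial. *)
Let shift_unit y : nneg y -> (exists c, y c != 0) -> vle (tens y un) (comulH H y) ->
  exists e, y e != 0 /\ L e = 1%g.
Proof.
move=> y0 [c yc] Dy; set q := (L c)^-1%g.
have := vle_neq0 (j := (c, f q)) (tens_nneg y0 un0) Dy.
rewrite /tens mulf_neq0 ?(g_fn gr) // => /(_ isT) /sumr_neq0_ex[e].
rewrite /= mulf_eq0 negb_or => /andP[ye /(g_de gr)[_ _ _ Le _]].
by exists e; rewrite Le (g_Lf gr) mulgV.
Qed.

(** The product of [h dl^-1] and [h dl] contains [h 1 = f 1], which fixes [e] on the left; by
    associativity [h dl] cannot kill [e]. *)
Let mul_h_neq0 e : L e = 1%g -> exists z, mu (h dl) e z != 0.
Proof.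
move=> Le; pose d' := h dl^-1%g.
have : \sum_z mu d' (h dl) z * mu z e e != 0.
  apply: (sumr_neq0 (j := f 1%g)) => [z|]; first exact: mulr_ge0.
  apply: mulf_neq0.
    have := g_hmu gr (h 1%g) dl^-1%g dl; rewrite mulVg eqxx mul1r => E.
    have : ep (h dl^-1%g) * ep (h dl) != 0 by rewrite mulf_neq0 ?(g_hn gr).
    by rewrite -E (g_f1 gr) mulf_eq0 => /norP[].
  have := g_L gr 1%g e e; rewrite Le !eqxx => E.
  by apply: contra_eq_neq E => z0; rewrite [hmul _ _ _ _]z0 mulr0 eq_sym oner_neq0.
rewrite (hb_assoc hopfH) => /sumr_neq0_ex[z]; rewrite mulf_eq0 negb_or => /andP[? _].
by exists z.
Qed.

(** With [y] the previous power, the coproduct of [x y] dominates [(dv ⊗ x) (y ⊗ 1) = dv y ⊗ x]. By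
    [shift_unit], [y] contains a vector that [dv] does not kill. *)
Let pow_neq0 n : exists c, vpow H x n c != 0.
Proof.
elim: n => [|n IH]; first by exists (f 1%g); apply: (g_fn gr).
set y := vpow H x n in IH *.
have y0 : nneg y by apply: pow_nneg.
have [e [ye Le]] := shift_unit y0 IH (pow_D1 n).
have [z mz] := mul_h_neq0 Le.
have [c xc] := xn.
have dvn : dv (h dl) != 0 by rewrite /dv eqxx mul1r invr_neq0 // (g_hn gr).
have dyz : mulH H dv y z != 0 by apply: mulH_neq0 dvn ye mz.
have : comulH H (mulH H x y) (z, c) != 0.
  apply: (vle_neq0 (x := tens (mulH H dv y) x)).
  - by apply: tens_nneg => //; apply: mulH_nneg.
  - rewrite (comulHM isH) -[X in tens _ X](mulH1 isH) -mul2_tens.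
    apply: mul2_mono => //; [exact: tens_nneg|exact: tens_nneg|exact: pow_D1].
  - by rewrite /tens mulf_neq0.
rewrite /comulH => /sumr_neq0_ex[c' ]; rewrite mulf_eq0 negb_or => /andP[? _].
by exists c'.
Qed.

(** Only the two extreme terms of the power of [x ⊗ 1 + dv ⊗ x] are kept; the mixed ones are
    nonnegative. *)
Let pow_D2 n : vle (vadd (tens (vpow H x n.+1) un) (tens (vpow H dv n.+1) (vpow H x n.+1)))
   (comulH H (vpow H x n.+1)).
Proof.
elim: n => [|n IH]; first by rewrite /= !(mulH1 isH).
set X1 := vpow H x n.+1 in IH *; set D1 := vpow H dv n.+1 in IH *.
change (vpow H x n.+2) with (mulH H x X1); change (vpow H dv n.+2) with (mulH H dv D1).
rewrite (comulHM isH) -[X in tens _ X](mulH1 isH) -(mul2_tens H x un X1 un) -(mul2_tens H dv x D1 X1).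
have X10 : nneg X1 by apply: pow_nneg.
have D10 : nneg D1 by apply: pow_nneg.
move=> p; apply: le_trans (mul2_mono posH _ _ Dx IH p).
- rewrite mul2_addl !mul2_addr /vadd; apply: lerD.
    by rewrite lerDl; apply: mul2_nneg => //; apply: tens_nneg.
  by rewrite lerDr; apply: mul2_nneg => //; apply: tens_nneg.
- by move=> q; rewrite addr_ge0 //; apply: tens_nneg.
- by move=> q; rewrite addr_ge0 //; apply: tens_nneg.
Qed.

(** When [dl ^+ n = 1] the bound is, by [g_f1n], the coefficient of [f 1] in the unit, which is the
    factor appearing in [diag_pair_f1]. *)
Let pow_dv n : (ep (h (dl ^+ n)%g))^-1 <= vpow H dv n (h (dl ^+ n)%g).
Proof.
elim: n => [|n IH].
  rewrite expg0 /vpow /= -(g_f1 gr) /oneH -[X in _ <= X]mulr1.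
  by rewrite -(mulfV (g_hn gr 1%g)) -(g_f1 gr) mulrA (g_f1n gr) mul1r.
rewrite expgS; set s := (dl ^+ n)%g in IH *; set w := (dl * s)%g.
have E : mu (h dl) (h s) (h w) = ep (h dl) * ep (h s) / ep (h w).
  apply: (mulfI (g_hn gr w)); rewrite (g_hmu gr) eqxx mul1r [RHS]mulrC mulfVK //.
  exact: g_hn gr w.
have P a b : 0 <= dv a * vpow H dv n b * mu a b (h w).
  exact: mulr_ge0 (mulr_ge0 (dv0 a) (pow_nneg n dv0 b)) (mu0 _ _ _).
rewrite /= /mulH.
apply: le_trans (term_le_sum (h dl) _); last by move=> a; apply: sumr_ge0.
apply: le_trans (term_le_sum (h s) _) => //.
rewrite [hmul _ _ _ _]E /dv eqxx mul1r.
have dn : ep (h dl) != 0 := g_hn gr dl.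
have sn : ep (h s) != 0 := g_hn gr s.
have E' : (ep (h w))^-1 = (ep (h dl))^-1 * (ep (h s))^-1 * (ep (h dl) * ep (h s) / ep (h w)).
  by rewrite -invfM [_ / _]mulrC mulrCA mulVf ?mulr1 // mulf_neq0.
rewrite [X in X <= _]E'; apply: ler_wpM2r; first by rewrite divr_ge0 ?mulr_ge0 ?ep0.
by apply: ler_wpM2l; rewrite ?invr_ge0 ?ep0.
Qed.

(* With [Z = x^n] and [n] a multiple of the order of [dl], the coproduct of [Z]
   dominates [Z (x) 1 + e (x) Z], where [e] is the basis vector of the trivial
   degree up to a scalar: evaluating the convolution powers of [G] on [Z] gives
   numbers that grow linearly unless [g] vanishes on [Z]. *)
Lemma pow_diag0 m c : mulH H (vpow H x (#[dl]%g * m.+1)) (bvec C c) c = 0.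
Proof.
have [n nE] : exists n, (#[dl]%g * m.+1 = n.+1)%N.
  by exists (#[dl]%g * m.+1).-1; rewrite prednK // muln_gt0 order_gt0.
have dn1 : (dl ^+ n.+1)%g = 1%g by rewrite -nE expgM expg_order expg1n.
rewrite nE; set Z := vpow H x n.+1; set D := vpow H dv n.+1.
have Z0 : nneg Z by apply: pow_nneg.
have D0 : nneg D by apply: pow_nneg.
have ZD : vle (vadd (tens Z un) (tens D Z)) (comulH H Z) := pow_D2 n.
rewrite mulH_bvecr; pose g a := mu a c c; pose d := f (L c)^-1%g.
pose g' a := mu a d d; pose G := conv H g g'.
have gS : superm H g := diag_superm c.
have GS : superm H G by apply: (superm_conv hopfH posH) => //; exact: diag_superm.
have G1 : ev G un = 1 by rewrite ev_conv1 !ev_diag1 mulr1.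
have ev0 u v : nneg u -> nneg v -> 0 <= ev u v.
  by move=> u0' v0'; apply: sumr_ge0 => a _; rewrite mulr_ge0.
have GD : 1 <= ev G D.
  apply: le_trans (diag_pair_f1 c) _.
  apply: (@le_trans _ _ (D (f 1%g) * G (f 1%g))); last first.
    by apply: (term_le_sum (f 1%g)) => a; exact: mulr_ge0 (D0 a) (GS.1 a).
  apply: ler_wpM2r; first exact: GS.1.
  have := pow_dv n.+1; rewrite dn1 -(g_f1 gr).
  by rewrite -[_^-1]mul1r -{1}(g_f1n gr) mulfK // (g_f1 gr) (g_hn gr).
have GZ : ev g Z <= ev G Z.
  rewrite -[ev g Z]mulr1 -(ev_diag1 d); apply: ev_conv_ge.
  - exact: gS.1.
  - exact: (diag_superm d).1.
  - exact: pow_D1.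
pose F k := iter k (conv H G) ep.
have epS : superm H ep.
  split=> // a b; rewrite -(hb_counitM hopfH) le_eqVlt; apply/orP; left.
  by apply/eqP/eq_bigr => e _; rewrite mulrC.
have FS k : superm H (F k).
  by elim: k => //= k IH; apply: (superm_conv hopfH posH).
have F1 k : ev (F k) un = 1.
  by elim: k => [|k IH]; [exact: hb_counit1 hopfH | rewrite /= ev_conv1 G1 IH mulr1].
(* One more convolution adds at least [ev G Z]: this comes from [Z ⊗ 1], since [F k] is 1 on the
   unit, while [D ⊗ Z] returns at least the previous value, since [G] is at least 1 on [D]. *)
have FZ k : ev G Z *+ k <= ev (F k) Z.
  elim: k => [|k IH]; first by rewrite mulr0n; apply: ev0 => //; exact: (FS 0%N).1.
  rewrite mulrS; apply: le_trans (ev_conv_ge2 _ _ ZD); first last.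
  - exact: (FS k).1.
  - exact: GS.1.
  - rewrite F1 mulr1 lerD2l; apply: le_trans IH _; rewrite -[X in X <= _]mul1r.
    by apply: ler_wpM2r GD; apply: ev0 => //; exact: (FS k).1.
have FB k : ev (F k) Z <= \sum_a Z a * superm_cst H.
  apply: ler_sum => a _; apply: ler_wpM2l => //; exact: superm_bound (FS k) a.
have cst0 : 0 <= \sum_a Z a * superm_cst H.
  by apply: sumr_ge0 => a _; rewrite mulr_ge0 // superm_cst_ge0.
have gZ0 : 0 <= ev g Z by apply: ev0 => //; exact: gS.1.
apply: contraTeq isT => gZn; have gZ_gt : 0 < ev g Z by rewrite lt_def gZn gZ0.
have [k] := arch (lt_le_trans gZ_gt GZ) cst0.
by move=> /lt_le_trans/(_ (le_trans (FZ k) (FB k))); rewrite ltxx.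
Qed.

(* [x^N] has no cycle as a graph on the basis, hence is nilpotent, although no
   power of [x] vanishes. *)
Lemma pow_acyclic : False.
Proof.
pose N := #[dl]%g; pose P j := vpow H x (N * j).
have P0 j : nneg (P j) by apply: pow_nneg.
have PS j : P j.+1 = mulH H (P 1%N) (P j).
  by rewrite /P muln1 mulnS vpowD.
pose e := fun a c : I => mulH H (P 1%N) (bvec C c) a != 0.
have eE a c : e a c -> exists2 i, P 1%N i != 0 & mu i c a != 0.
  rewrite /e mulH_bvecr => S; have [j] := sumr_neq0_ex S.
  by rewrite mulf_eq0 negb_or => /andP[Pi mi]; exists j.
have b0 c : nneg (bvec C c) by move=> a; rewrite ler0n.
have path_ex a b : connect e a b -> exists j, mulH H (P j) (bvec C b) a != 0.
  case/connectP => s; elim: s a => [|c s IH] a /=.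
    by move=> _ ->; exists 0%N; rewrite /P muln0 /vpow /= (mul1H isH) /bvec eqxx oner_neq0.
  case/andP => eac /IH{}IH /IH[j jP]; exists j.+1.
  have [i Pi mi] := eE _ _ eac.
  rewrite (PS j) (mulHA isH (P 1%N) (P j) (bvec C b)).
  exact: (mulH_neq0 posH (P0 1%N) (mulH_nneg posH (P0 j) (@b0 _ b)) Pi jP mi).
have acyc a c : e a c -> connect e c a -> False.
  move=> eac /path_ex[j jP].
  have /eqP := pow_diag0 j a; rewrite -/N -/(P j.+1) (PS j) (mulHA isH (P 1%N) (P j) (bvec C a)).
  apply/negP.
  have [i Pi mi] := eE _ _ eac.
  exact: (mulH_neq0 posH (P0 1%N) (mulH_nneg posH (P0 j) (@b0 _ a)) Pi jP mi).
(* The set of reachable vectors shrinks strictly along an edge leaving [a], since acyclicity removes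
   [a] from it. Hence a nonzero [P j] bounds [j] by the size of the basis. *)
have len j a : P j a != 0 -> (j <= #|connect e a|)%N.
  elim: j a => // j IH a; rewrite (PS j) => /sumr_neq0_ex[ i ] /sumr_neq0_ex[c].
  rewrite !mulf_eq0 !negb_or => /andP[/andP[Pi Pc] mi].
  have eac : e a c.
    rewrite /e mulH_bvecr; apply: (sumr_neq0 (j := i)) => [z|]; last exact: mulf_neq0.
    exact: mulr_ge0 (P0 1%N z) (mu0 _ _ _).
  apply: leq_ltn_trans (IH c Pc) _; apply: proper_card; apply/properP; split.
    by apply/subsetP => b; apply: connect_trans; apply: connect1.
  exists a; first exact: connect0.
  by apply/negP => /(acyc _ _ eac).
have [a aP] := pow_neq0 (N * #|I|.+1).
by have := leq_trans (len _ _ aP) (max_card _); rewrite ltnn.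
Qed.

End Power.

(** Otherwise, contracting the coproduct of [b] with a functional supported on the [f p] gives a
    nonzero vector satisfying [Dx] for [dl = X b], which [pow_acyclic] excludes. *)
Lemma Y1_unit b : Y b = 1%g -> un b != 0.
Proof.
move=> Yb; apply: contraT; rewrite negbK => /eqP ub; exfalso.
(* The functional takes the value [1 / un (f p)] at [f p] and is applied to the right leg. These
   weights make each [y (f q)] a multiple of the unit; [Y b = 1] makes [y b] nonzero. *)
pose y e c := \sum_p de e c (f p) / un (f p).
have y0 e : nneg (y e) by move=> c; apply: sumr_ge0 => p _; rewrite divr_ge0.
apply: (@pow_acyclic (y b) (X b)) => //.
- move=> [c c'].
  have -> : comulH H (y b) (c, c') = \sum_e de b c e * y e c'.
    rewrite /comulH /= /y; under eq_bigr do rewrite mulr_suml.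
    under [RHS]eq_bigr do rewrite mulr_sumr.
    rewrite exchange_big [RHS]exchange_big; apply: eq_bigr => p _ /=.
    under eq_bigr do rewrite mulrAC [_ * hcomul _ _ _ _]mulrC.
    under [RHS]eq_bigr do rewrite mulrA [de _ _ _ * _]mulrC.
    by rewrite -!mulr_suml (hb_coassoc hopfH).
  have yf q : y (f q) c' = un c' / un (f q).
    rewrite /y; have [c0|c0] := eqVneq (un c') 0.
      rewrite c0 mul0r big1 // => p _; suff -> : de (f q) c' (f p) = 0 by rewrite mul0r.
      apply/eqP/negPn/negP => d0.
      have [+ _] := g_fde_neq0 gr (g_fn gr q) d0.
      by rewrite (c0 : hunit H c' = 0) eqxx.
    have [s ->] := g_fP gr c0.
    have E p : de (f q) (f s) (f p) / un (f p) = un (f s) / un (f q) * (p == s^-1 * q)%g%:R.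
      apply: (mulfI (g_fn gr q)); rewrite mulrA (g_fde gr) (inj_eq (g_finj gr)).
      rewrite eq_sym; have -> : (s * p == q)%g = (p == s^-1 * q)%g.
        by apply/eqP/eqP => [<-|->]; rewrite ?mulKg ?mulKVg.
      case: (p == _); last by rewrite !(mul0r, mulr0).
      by rewrite mul1r mulr1 mulfK ?(g_fn gr) // mulrC mulfVK ?(g_fn gr).
    by under eq_bigr do rewrite E; rewrite sum_delta.
  have T e : 0 <= de b c e * y e c' by exact: mulr_ge0 (de0 _ _ _) (y0 e c').
  have bf q : b != f q by apply/eqP => E; have := g_fn gr q; rewrite -E (ub : hunit H b = 0) eqxx.
  (* The terms [e = f q] add up to [y b ⊗ 1], and the term [e = b] at [c = h (X b)] gives
     [dv ⊗ y b]. They do not overlap because [b] is none of the [f q]. *)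
  rewrite (bigD1 b) //= addrC /vadd /tens; apply: lerD.
    rewrite (bigID (mem [set f q | q in setT])) /=.
    have -> : \sum_(i | (i != b) && (i \in [set f q | q in [set: kT]])) de b c i * y i c'
            = \sum_q de b c (f q) * y (f q) c'.
      rewrite (eq_bigl (mem [set f q | q in [set: kT]])); last first.
        move=> i /=; case: imsetP => [[q _ ->]|]; rewrite ?andbF // andbT eq_sym.
        exact: bf.
      rewrite big_imset /=; last by move=> p q _ _; exact: (g_finj gr).
      by apply: eq_bigl => q; rewrite in_setT.
    have -> : \sum_q de b c (f q) * y (f q) c' = y b c * un c'.
      rewrite {2}/y mulr_suml; apply: eq_bigr => q _.
      by rewrite yf mulrA mulrAC.
    by rewrite lerDl; apply: sumr_ge0.
  have [->|ch] := eqVneq c (h (X b)); last by rewrite !mul0r T.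
  rewrite !mul1r; apply: ler_wpM2r; first exact: y0.
  rewrite -[_^-1]mul1r ler_pdivrMr; last first.
    by rewrite lt_def ep0 (g_hn gr).
  have := g_X gr (X b) b b; rewrite !eqxx => E.
  by rewrite mulrC E.
- exists b; rewrite /y; apply: (sumr_neq0 (j := 1%g)) => [p|]; first by rewrite divr_ge0.
  rewrite mulf_neq0 ?invr_neq0 ?(g_fn gr) //.
  have := g_Y gr 1%g b b; rewrite Yb !eqxx -(g_f1 gr) => E.
  by apply: contra_eq_neq E => z; rewrite [hcomul _ _ _ _]z mulr0 eq_sym oner_neq0.
Qed.

End DegreeOne.

(** * The matched pair *)

(** The rules satisfied by the two factors in [u x = (^u x) (u^x)], with [lact u x] for [^u x] and
    [ract u x] for [u^x]. *)
Record matched_pair (kT gT : finGroupType) (ract : kT -> gT -> kT)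
    (lact : kT -> gT -> gT) : Prop := MatchedPair {
  ract1 u : ract u 1%g = u;
  ract1l x : ract 1%g x = 1%g;
  lact1 x : lact 1%g x = x;
  lact1r u : lact u 1%g = 1%g;
  ractM u x y : ract u (x * y)%g = ract (ract u x) y;
  lactM u v x : lact (u * v)%g x = lact u (lact v x);
  ractMl u v x : ract (u * v)%g x = (ract u (lact v x) * ract v x)%g;
  lactMr u x y : lact u (x * y)%g = (lact u x * lact (ract u x) y)%g
}.

Section Structure.
Variables (C : numClosedFieldType) (I : finType).

Lemma sum_only (J : finType) (F : J -> C) j :
  (forall i, i != j -> F i = 0) -> \sum_i F i = F j.
Proof. by move=> F0; rewrite (bigD1 j) //= big1 ?addr0. Qed.

Record bicrossed (H : hdata C I) (kT gT : finGroupType) (ract : kT -> gT -> kT)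
    (lact : kT -> gT -> gT) (beta : kT * gT -> I)
    (m : kT -> gT -> gT -> C) (d : kT -> kT -> gT -> C) : Prop := Bicrossed {
  bc_mp : matched_pair ract lact;
  bc_bij : bijective beta;
  bc_m0 u x y : 0 < m u x y;
  bc_d0 u v x : 0 < d u v x;
  bc_mul a b e : hmul H (beta a) (beta b) (beta e) =
    ((b.1 == ract a.1 a.2) && (e == (a.1, (a.2 * b.2)%g)))%:R * m a.1 a.2 b.2;
  bc_comul a b e : hcomul H (beta a) (beta b) (beta e) =
    ((a == ((b.1 * e.1)%g, e.2)) && (b.2 == lact e.1 e.2))%:R * d b.1 e.1 e.2;
  bc_unit a : hunit H (beta a) * m a.1 1%g 1%g = (a.2 == 1%g)%:R;
  bc_counit a : hcounit H (beta a) * d 1%g 1%g a.2 = (a.1 == 1%g)%:R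
}.

Variable H : hdata C I.
Hypotheses (arch : arch_pos C) (isH : is_hopf H) (posH : positive_basis H).

Section Given.
Variables (kT gT : finGroupType) (f : kT -> I) (h : gT -> I).
Variables (L R : I -> kT) (X Y : I -> gT).
Hypothesis (gr : graded H f h L R X Y).

Let hopfH := is_hopf_basis isH.
Let mu := hmul H.
Let un := hunit H.
Let de := hcomul H.
Let ep := hcounit H.
Let mu0 : forall a b c, 0 <= mu a b c := mu_ge0 posH.
Let de0 : forall a b c, 0 <= de a b c := de_ge0 posH.

Lemma Y1_f b : Y b = 1%g -> b = f (L b).
Proof.
by move=> /(Y1_unit arch isH posH gr) /(g_fP gr)[p ->]; rewrite (g_Lf gr).
Qed.

Let mu_f b : mu (f (L b)) b b != 0.
Proof.
have := g_L gr (L b) b b; rewrite !eqxx => E.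
by apply: contra_eq_neq E => z; rewrite (z : hmul H _ _ _ = 0) mulr0 eq_sym oner_neq0.
Qed.

Let de_f p q : de (f (p * q)%g) (f p) (f q) != 0.
Proof.
have := g_fde gr (f (p * q)%g) p q; rewrite eqxx mul1r => E.
have : un (f p) * un (f q) != 0 by rewrite mulf_neq0 ?(g_fn gr).
by rewrite -E mulf_eq0 => /norP[].
Qed.

Lemma mu_Rf b p c : mu b (f p) c != 0 -> b = c.
Proof.
move=> nz; have : un (f p) * mu b (f p) c != 0 by rewrite mulf_neq0 ?(g_fn gr).
by rewrite (g_R gr) pnatr_eq0 eqb0 negbK => /andP[_ /eqP].
Qed.

(** The product of [h x] and [h x^-1] contains [h 1 = f 1], whose coproduct contains [f u^-1 ⊗ f u].
    Hence [f u] occurs in a product [c d] of right legs of the coproducts of [h x] and [h x^-1]. In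
    particular [(L, Y)] takes every value. *)
Lemma right_inv_ex u x : exists c d,
  [/\ L c = u, Y c = x, L d = R c & Y d = x^-1%g] /\ mu c d (f u) != 0.
Proof.
have : \sum_e mu (h x) (h x^-1%g) e * de e (f u^-1%g) (f u) != 0.
  apply: (sumr_neq0 (j := f 1%g)) => [z|]; first exact: mulr_ge0.
  rewrite mulf_neq0 //; last by rewrite -(mulVg u).
  have := g_hmu gr (h 1%g) x x^-1%g; rewrite mulgV eqxx mul1r => E.
  have : ep (h x) * ep (h x^-1%g) != 0 by rewrite mulf_neq0 ?(g_hn gr).
  by rewrite -E (g_f1 gr) mulf_eq0 => /norP[].
rewrite (hb_compat hopfH) => /sumr_neq0_ex[a1] /sumr_neq0_ex[a2].
move=> /sumr_neq0_ex[b1] /sumr_neq0_ex[b2].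
rewrite !mulf_eq0 !negb_or => /andP[/andP[/(g_de gr)[_ _ Ya _ _]]].
move=> /(g_de gr)[_ _ Yb _ _] /andP[_ nz]; exists a2, b2; split=> //.
have [E1 E2 _ _ _] := g_mu gr nz.
by rewrite (g_Lf gr) in E2; rewrite Ya Yb !(g_Yh gr) E1 E2.
Qed.

(* The pairs [(L, Y)] behave like arrows of a groupoid: [right_inv_ex] provides
   right inverses up to nonzero coefficients. *)
Lemma LY_uniq b c : L b = L c -> Y b = Y c -> b = c.
Proof.
have [c0 [d0 [[Lc Yc Ld Yd] nz]]] := right_inv_ex (L c) (Y c).
suff P e : L e = L c -> Y e = Y c -> c0 = e.
  by move=> Lb Yb; rewrite -(P b) // (P c).
(* Since [(c0 d0) e] contains [e], some [z] in [d0 e] has [e] in [c0 z]. As [Y z = 1], [Y1_f] makes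
   [z] a unit term, and this forces [c0 = e]. *)
move=> Le Ye; have : \sum_z mu c0 d0 z * mu z e e != 0.
  apply: (sumr_neq0 (j := f (L c))) => [z|]; first exact: mulr_ge0.
  by rewrite mulf_neq0 // -Le mu_f.
rewrite (hb_assoc hopfH) => /sumr_neq0_ex[z]; rewrite mulf_eq0 negb_or => /andP[m1 m2].
have [_ _ _ _ Yz] := g_mu gr m1.
by move: m2; rewrite (Y1_f (b := z)) ?Yz ?Yd ?Ye ?mulVg // => /mu_Rf.
Qed.

(** A right inverse [d] of [b] is also a left inverse: reassociating [(b d) b] shows that [d b]
    contains [f (L c)]. Then [(d b) c] contains [c], so [b c] is nonzero. *)
Lemma mu_neq0_ex b c : R b = L c -> exists e, mu b c e != 0.
Proof.
move=> RL; have [b' [d [[Lb Yb Ld Yd] nz]]] := right_inv_ex (L b) (Y b).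
have E := LY_uniq Lb Yb; rewrite {b' Lb Yb}E in Ld nz.
have : \sum_z mu b d z * mu z b b != 0.
  by apply: (sumr_neq0 (j := f (L b))) => [z|]; [exact: mulr_ge0|rewrite mulf_neq0].
rewrite (hb_assoc hopfH) => /sumr_neq0_ex[z]; rewrite mulf_eq0 negb_or => /andP[m1 m2].
have [_ Lz _ _ Yz] := g_mu gr m1.
have Ez : z = f (L c) by rewrite (Y1_f (b := z)) ?Lz ?Ld ?RL // Yz Yd mulVg.
have : \sum_z mu d b z * mu z c c != 0.
  apply: (sumr_neq0 (j := f (L c))) => [y|]; first exact: mulr_ge0.
  by rewrite mulf_neq0 // -Ez.
rewrite (hb_assoc hopfH) => /sumr_neq0_ex[e]; rewrite mulf_eq0 negb_or => /andP[me _].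
by exists e.
Qed.

(** The device of [right_inv_ex] for [b] and a right inverse: their product contains [f (v * w)],
    whose coproduct contains [f v ⊗ f w]. *)
Lemma de_neq0_ex b v w : (v * w)%g = L b -> exists c c',
  [/\ de b c c' != 0, L c = v & L c' = w].
Proof.
move=> vw; have [b' [d [[Lb Yb Ld Yd] nz]]] := right_inv_ex (L b) (Y b).
have E := LY_uniq Lb Yb; rewrite {b' Lb Yb}E in Ld nz.
have : \sum_e mu b d e * de e (f v) (f w) != 0.
  apply: (sumr_neq0 (j := f (L b))) => [z|]; first exact: mulr_ge0.
  by rewrite mulf_neq0 // -vw.
rewrite (hb_compat hopfH) => /sumr_neq0_ex[a1] /sumr_neq0_ex[a2].
move=> /sumr_neq0_ex[b1] /sumr_neq0_ex[b2].
rewrite !mulf_eq0 !negb_or => /andP[/andP[nd _]].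
move=> /andP[/(g_mu gr)[_ E1 _ _ _] /(g_mu gr)[_ E2 _ _ _]]; exists a1, a2.
by rewrite !(g_Lf gr) in E1 E2; rewrite nd E1 E2.
Qed.

(** The actions are the two remaining degrees, [R] and [X], of the vector with prescribed [L] and
    [Y]. The multiplicative rules of a matched pair are then degree equations of nonzero structure
    constants. *)
Lemma bicrossed_of_graded : exists ract lact beta m d,
  @bicrossed H kT gT ract lact beta m d.
Proof.
have /fin_all_exists[beta betaP] (p : kT * gT) : exists b, L b = p.1 /\ Y b = p.2.
  by have [c [_ [[? ? _ _] _]]] := right_inv_ex p.1 p.2; exists c.
have betaL p : L (beta p) = p.1 by case: (betaP p).
have betaY p : Y (beta p) = p.2 by case: (betaP p).
have betaK b : beta (L b, Y b) = b by apply: LY_uniq; rewrite ?betaL ?betaY.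
have Kbeta p : (L (beta p), Y (beta p)) = p by rewrite betaL betaY -surjective_pairing.
have beta_inj : injective beta by move=> p q E; rewrite -(Kbeta p) E Kbeta.
pose ract u x := R (beta (u, x)).
pose lact u x := X (beta (u, x)).
have bf u : beta (u, 1%g) = f u.
  by apply: LY_uniq; rewrite ?betaL ?betaY /= ?(g_Lf gr) ?(g_Yf gr).
have bh x : beta (1%g, x) = h x.
  by apply: LY_uniq; rewrite ?betaL ?betaY /= ?(g_Lh gr) ?(g_Yh gr).
have mu_e b c e : mu b c e != 0 -> e = beta (L b, (Y b * Y c)%g).
  move=> /(g_mu gr)[_ E1 _ _ E2]; by rewrite -E1 -E2 betaK.
have mu_n b c : R b = L c -> mu b c (beta (L b, (Y b * Y c)%g)) != 0.
  by move=> /mu_neq0_ex[e nz]; rewrite -(mu_e _ _ _ nz).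
have de_e b c c' : de b c c' != 0 ->
    b = beta ((L c * L c')%g, Y c') /\ Y c = lact (L c') (Y c').
  move=> /(g_de gr)[E1 E2 E3 E4 E5].
  by rewrite -E4 E3 betaK /lact -E3 betaK.
have de_n v w x : de (beta ((v * w)%g, x)) (beta (v, lact w x)) (beta (w, x)) != 0.
  have [|c [c' [nz Lc Lc']]] := @de_neq0_ex (beta ((v * w)%g, x)) v w.
    by rewrite betaL.
  have [_ _ Y' _ _] := g_de gr nz; rewrite betaY /= in Y'.
  have [_ Yc] := de_e _ _ _ nz.
  have -> : beta (v, lact w x) = c by apply: LY_uniq; rewrite ?betaL ?betaY //= Yc Lc' Y'.
  by have -> : beta (w, x) = c' by apply: LY_uniq; rewrite ?betaL ?betaY.
pose m u x y := mu (beta (u, x)) (beta (ract u x, y)) (beta (u, (x * y)%g)).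
pose d v w x := de (beta ((v * w)%g, x)) (beta (v, lact w x)) (beta (w, x)).
have m_n u x y : m u x y != 0.
  have := mu_n (beta (u, x)) (beta (ract u x, y)).
  by rewrite !betaL !betaY; apply.
exists ract, lact, beta, m, d; split.
- split.
  + by move=> u; rewrite /ract bf (g_Rf gr).
  + by move=> x; rewrite /ract bh (g_Rh gr).
  + by move=> x; rewrite /lact bh (g_Xh gr).
  + by move=> u; rewrite /lact bf (g_Xf gr).
  + by move=> u x y; have [_ _ E _ _] := g_mu gr (m_n u x y).
  + by move=> u v x; have [_ E _ _ _] := g_de gr (de_n u v x).
  + by move=> u v x; have [_ _ _ _ E] := g_de gr (de_n u v x).
  + by move=> u x y; have [_ _ _ E _] := g_mu gr (m_n u x y).
- by exists (fun b => (L b, Y b)) => // p.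
- by move=> u x y; rewrite lt_def m_n mu0.
- by move=> u v x; rewrite lt_def de_n de0.
- move=> [u x] [v y] e /=; case: andP => [[/eqP -> /eqP ->]|N].
    by rewrite mul1r.
  rewrite mul0r; apply/eqP/negPn/negP => nz; apply: N.
  have [E1 _ _ _ _] := g_mu gr nz; have := mu_e _ _ _ nz.
  by rewrite !betaL !betaY /= => /beta_inj ->; rewrite -[v](betaL (v, y)) -E1 !eqxx.
- move=> a [v y] [w z] /=; case: andP => [[/eqP -> /eqP ->]|N].
    by rewrite mul1r.
  rewrite mul0r; apply/eqP/negPn/negP => nz; apply: N.
  have [] := de_e _ _ _ nz; rewrite !betaL !betaY /= => /beta_inj -> ->.
  by rewrite !eqxx.
- move=> [u x] /=; have [->|x1] := eqVneq x 1%g.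
    have := g_L gr u (f u) (f u); rewrite !(g_Lf gr) !eqxx.
    by rewrite /m mulg1 /ract bf (g_Rf gr) bf.
  have -> : hunit H (beta (u, x)) = 0; last by rewrite mul0r.
  apply/eqP/negPn/negP => /(g_fP gr)[p E]; have := betaY (u, x).
  by rewrite E (g_Yf gr) /= => E'; rewrite E' eqxx in x1.
- move=> [u x] /=; have [->|u1] := eqVneq u 1%g.
    have := g_X gr x (h x) (h x); rewrite !(g_Xh gr) !eqxx.
    by rewrite /d mulg1 /lact bh (g_Xh gr) bh.
  have -> : hcounit H (beta (u, x)) = 0; last by rewrite mul0r.
  apply/eqP/negPn/negP => /(g_hP gr)[p E]; have := betaL (u, x).
  by rewrite E (g_Lh gr) /= => E'; rewrite E' eqxx in u1.
Qed.

End Given.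

Lemma bicrossed_ex : exists (kT gT : finGroupType) ract lact beta m d,
  @bicrossed H kT gT ract lact beta m d.
Proof.
have [kT [gT [f [h [L [R [X [Y gr]]]]]]]] := graded_ex arch (is_hopf_basis isH) posH.
by exists kT, gT; apply: bicrossed_of_graded gr.
Qed.

End Structure.

(** * Normalization of the structure constants *)

Section Scaling.
Variables (C : numClosedFieldType) (kT gT : finGroupType).
Variables (ract : kT -> gT -> kT) (lact : kT -> gT -> gT).
Hypothesis mp : matched_pair ract lact.

Lemma ract_inj z : injective (fun v => ract v z).
Proof.
by apply: (can_inj (g := fun v => ract v z^-1%g)) => v; rewrite -(ractM mp) mulgV (ract1 mp).
Qed.

Lemma root_eq n (x y : C) : (0 < n)%N -> 0 < x -> 0 < y -> x ^+ n = y ^+ n -> x = y.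
Proof. by move=> n0 x0 y0 /pexpIrn; apply; rewrite // nnegrE ltW. Qed.

Lemma prodr_constT (T : finType) (x : C) : \prod_(z : T) x = x ^+ #|T|.
Proof. by rewrite -(prodr_const T); apply: eq_bigl. Qed.

(* The inverse geometric mean [c1] of [m u x z] over [z] absorbs [m]; the geometric
   mean over [kT] of what remains of [d] then absorbs [d]. *)
Lemma scaling_ex (m : kT -> gT -> gT -> C) (d : kT -> kT -> gT -> C) :
  (forall u x y, 0 < m u x y) -> (forall u v x, 0 < d u v x) ->
  (forall u x y z, m u x y * m u (x * y)%g z = m (ract u x) y z * m u x (y * z)%g) ->
  (forall u v w x, d (u * v)%g w x * d u v (lact w x) = d u (v * w)%g x * d v w x) ->
  (forall v w x y, m (v * w)%g x y * d v w (x * y)%g =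
     d v w x * d (ract v (lact w x)) (ract w x) y *
       (m v (lact w x) (lact (ract w x) y) * m w x y)) ->
  exists c : kT -> gT -> C, [/\ forall u x, 0 < c u x,
    forall u x y, c u (x * y)%g = c u x * c (ract u x) y * m u x y &
    forall v w x, c (v * w)%g x * d v w x = c v (lact w x) * c w x].
Proof.
move=> m0 d0 em ed ec.
have N0 (T : finGroupType) : (0 < #|T|)%N by apply/card_gt0P; exists 1%g.
pose M u x := \prod_z m u x z.
have M0 u x : 0 < M u x by apply: prodr_gt0.
pose c1 u x := (#|gT|.-root (M u x))^-1.
have c10 u x : 0 < c1 u x by rewrite invr_gt0 rootC_gt0.
have rootM u x : #|gT|.-root (M u x) ^+ #|gT| = M u x by apply: rootCK.
have c1M u x y : c1 u (x * y)%g = c1 u x * c1 (ract u x) y * m u x y.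
  apply: (@root_eq #|gT|) => //; first by rewrite !mulr_gt0.
  rewrite /c1 !exprMn !exprVn !rootM.
  have : m u x y ^+ #|gT| * M u (x * y)%g = M (ract u x) y * M u x.
    rewrite -prodr_constT -big_split /=.
    rewrite [M u x](reindex_inj (mulgI y)) -big_split /=.
    by apply: eq_bigr => z _; apply: em.
  move=> E; apply: (mulIf (lt0r_neq0 (M0 u (x * y)%g))).
  rewrite mulVf ?lt0r_neq0 // -[RHS]mulrA E -invfM [M u x * _]mulrC mulVf //.
  by rewrite mulf_neq0 ?lt0r_neq0.
pose d1 v w x := c1 (v * w)%g x * d v w x / (c1 v (lact w x) * c1 w x).
have d10 v w x : 0 < d1 v w x by rewrite divr_gt0 ?mulr_gt0.
have nz u x : c1 u x != 0 by rewrite lt0r_neq0.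
have ed1 u v w x : d1 (u * v)%g w x * d1 u v (lact w x) = d1 u (v * w)%g x * d1 v w x.
  rewrite /d1 (lactM mp) mulgA.
  have -> : c1 (u * v * w)%g x * d (u * v)%g w x / (c1 (u * v)%g (lact w x) * c1 w x) *
    (c1 (u * v)%g (lact w x) * d u v (lact w x) / (c1 u (lact v (lact w x)) * c1 v (lact w x)))
   = (d (u * v)%g w x * d u v (lact w x)) * (c1 (u * v * w)%g x
     / (c1 w x * (c1 u (lact v (lact w x)) * c1 v (lact w x)))).
    by field; rewrite !nz.
  by rewrite ed; field; rewrite !nz.
(* The rescaling by [c1] has removed [m] from the compatibility, so [d1] is multiplicative in its
   last argument. Its means [c2] inherit this, hence multiplying by them does not spoil [c1M]. *)
have d1M v w x y : d1 v w (x * y)%g = d1 v w x * d1 (ract v (lact w x)) (ract w x) y.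
  rewrite /d1 (lactMr mp) !c1M -(ractMl mp).
  set m1 := m (v * w)%g x y; set dd := d v w (x * y)%g.
  have mn u' x' y' : m u' x' y' != 0 by rewrite lt0r_neq0.
  have -> : dd = d v w x * d (ract v (lact w x)) (ract w x) y *
       (m v (lact w x) (lact (ract w x) y) * m w x y) / m1.
    by rewrite -ec mulrC mulKf // mn.
  by rewrite /m1; field; rewrite !nz !mn.
pose F v x := \prod_u d1 u v x.
have F0 v x : 0 < F v x by apply: prodr_gt0.
pose c2 v x := #|kT|.-root (F v x).
have c20 v x : 0 < c2 v x by rewrite rootC_gt0.
have rootF u x : c2 u x ^+ #|kT| = F u x by apply: rootCK.
have c2M u x y : c2 u (x * y)%g = c2 u x * c2 (ract u x) y.
  apply: (@root_eq #|kT|) => //; first by rewrite mulr_gt0.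
  rewrite exprMn !rootF /F [X in _ * X](reindex_inj (@ract_inj (lact u x))) -big_split /=.
  by apply: eq_bigr.
have c2D v w x : c2 (v * w)%g x * d1 v w x = c2 v (lact w x) * c2 w x.
  apply: (@root_eq #|kT|) => //; [exact: mulr_gt0|exact: mulr_gt0|].
  have E : F w x = \prod_u d1 (u * v)%g w x by rewrite /F (reindex_inj (mulIg v)).
  rewrite [LHS]exprMn [RHS]exprMn !rootF E -prodr_constT /F -!big_split /=.
  by apply: eq_bigr => u _; rewrite -ed1 mulrC.
exists (fun u x => c1 u x * c2 u x); split.
- by move=> u x; rewrite mulr_gt0.
- by move=> u x y; rewrite c1M c2M; ring.
- move=> v w x; have : c1 (v * w)%g x * d v w x = d1 v w x * (c1 v (lact w x) * c1 w x).
    by rewrite mulfVK // mulf_neq0.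
  move=> E; rewrite mulrAC E mulrAC [_ * c2 _ _]mulrC c2D.
  by rewrite mulrACA; congr (_ * _); rewrite mulrC.
Qed.
End Scaling.

Section BicrossedScaling.
Variables (C : numClosedFieldType) (I : finType) (H : hdata C I).
Variables (kT gT : finGroupType) (ract : kT -> gT -> kT) (lact : kT -> gT -> gT).
Variables (beta : kT * gT -> I) (m : kT -> gT -> gT -> C) (d : kT -> kT -> gT -> C).
Hypotheses (hopfH : hopf_basis H) (bc : bicrossed H ract lact beta m d).
Let mp := bc_mp bc.

Lemma bc_m_assoc u x y z :
  m u x y * m u (x * y)%g z = m (ract u x) y z * m u x (y * z)%g.
Proof.
have := hb_assoc hopfH (beta (u, x)) (beta (ract u x, y))
  (beta (ract u (x * y)%g, z)) (beta (u, (x * y * z)%g)).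
rewrite !(reindex beta (onW_bij _ (bc_bij bc))).
rewrite (sum_only (j := (u, (x * y)%g))); last first.
  by move=> i ne; rewrite !(bc_mul bc) (negPf ne) andbF !mul0r.
rewrite [in RHS](sum_only (j := (ract u x, (y * z)%g))); last first.
  by move=> i ne; rewrite !(bc_mul bc) (negPf ne) andbF !mul0r.
by rewrite !(bc_mul bc) /= (ractM mp) mulgA !eqxx !mul1r.
Qed.

Lemma bc_d_coassoc u v w x :
  d (u * v)%g w x * d u v (lact w x) = d u (v * w)%g x * d v w x.
Proof.
have := hb_coassoc hopfH (beta (u, lact v (lact w x))) (beta (v, lact w x))
  (beta (w, x)) (beta ((u * v * w)%g, x)).
rewrite !(reindex beta (onW_bij _ (bc_bij bc))).
rewrite (sum_only (j := ((u * v)%g, lact w x))); last first.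
  by move=> i ne; rewrite (bc_comul bc) (negPf ne) !mul0r.
rewrite [in RHS](sum_only (j := ((v * w)%g, x))); last first.
  by move=> i ne; rewrite (bc_comul bc) (negPf ne) !mul0r.
rewrite !(bc_comul bc) /= (lactM mp) mulgA !eqxx !mul1r => E.
by rewrite mulrC E mulrC.
Qed.

Lemma bc_compat v w x y : m (v * w)%g x y * d v w (x * y)%g =
     d v w x * d (ract v (lact w x)) (ract w x) y *
       (m v (lact w x) (lact (ract w x) y) * m w x y).
Proof.
have := hb_compat hopfH (beta ((v * w)%g, x)) (beta (ract (v * w)%g x, y))
  (beta (v, lact w (x * y)%g)) (beta (w, (x * y)%g)).
rewrite !(reindex beta (onW_bij _ (bc_bij bc))).
rewrite (sum_only (j := ((v * w)%g, (x * y)%g))); last first.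
  by move=> i ne; rewrite !(bc_mul bc) (negPf ne) andbF !mul0r.
set S := (X in _ = X); have -> : S = \sum_p \sum_q \sum_r \sum_s
    hcomul H (beta ((v * w)%g, x)) (beta p) (beta q) *
    hcomul H (beta (ract (v * w)%g x, y)) (beta r) (beta s) *
    (hmul H (beta p) (beta r) (beta (v, lact w (x * y)%g)) *
     hmul H (beta q) (beta s) (beta (w, (x * y)%g))).
  rewrite /S; apply: eq_bigr => p _; rewrite (reindex beta (onW_bij _ (bc_bij bc))).
  apply: eq_bigr => q _; rewrite (reindex beta (onW_bij _ (bc_bij bc))).
  by apply: eq_bigr => r _; rewrite (reindex beta (onW_bij _ (bc_bij bc))).
have T p q r s : hcomul H (beta ((v * w)%g, x)) (beta p) (beta q) *
    hcomul H (beta (ract (v * w)%g x, y)) (beta r) (beta s) *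
    (hmul H (beta p) (beta r) (beta (v, lact w (x * y)%g)) *
     hmul H (beta q) (beta s) (beta (w, (x * y)%g))) != 0 ->
  [/\ p = (v, lact w x), q = (w, x), s = (ract w x, y) &
      r = (ract v (lact w x), lact (ract w x) y)].
  case: p q r s => [p1 p2] [q1 q2] [r1 r2] [s1 s2].
  rewrite !(bc_comul bc) !(bc_mul bc) /= !mulf_eq0 !negb_or !pnatr_eq0 !eqb0 !negbK.
  case/andP=> /andP[/andP[/andP[/eqP[_ <-] /eqP ->] _] /andP[/andP[/eqP[_ <-] /eqP ->] _]].
  by case/and3P=> /andP[/andP[/eqP -> /eqP[<- _]] _] /andP[/eqP -> /eqP[<-]] _.
rewrite {}/S (sum_only (j := (v, lact w x))); last first.
  move=> p /eqP np; apply: big1 => q _; apply: big1 => r _; apply: big1 => s _.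
  by apply/eqP/negPn/negP => /T[E _ _ _]; apply: np.
rewrite (sum_only (j := (w, x))); last first.
  move=> q /eqP nq; apply: big1 => r _; apply: big1 => s _.
  by apply/eqP/negPn/negP => /T[_ E _ _]; apply: nq.
rewrite (sum_only (j := (ract v (lact w x), lact (ract w x) y))); last first.
  move=> r /eqP nr; apply: big1 => s _.
  by apply/eqP/negPn/negP => /T[_ _ _ E]; apply: nr.
rewrite (sum_only (j := (ract w x, y))); last first.
  by move=> s /eqP ns; apply/eqP/negPn/negP => /T[_ _ E _]; apply: ns.
rewrite !(bc_mul bc) !(bc_comul bc) /=.
rewrite -(ractMl mp) -(lactMr mp) !eqxx !mul1r => ->.
by rewrite [d _ _ _ * d _ _ _ * _]mulrC.
Qed.

Lemma bc_scaling : exists c : kT * gT -> C, [/\ forall p, 0 < c p,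
    forall u x y, c (u, (x * y)%g) = c (u, x) * c (ract u x, y) * m u x y &
    forall v w x, c ((v * w)%g, x) * d v w x = c (v, lact w x) * c (w, x)].
Proof.
have [c [c0 c1 c2]] := scaling_ex mp (bc_m0 bc) (bc_d0 bc) bc_m_assoc bc_d_coassoc bc_compat.
by exists (fun p => c p.1 p.2).
Qed.

End BicrossedScaling.

(** * Transport along rescaled bijections of bases *)

Section BilinearProduct.
Variable C : numClosedFieldType.

Definition gmul (J : finType) (m : J -> J -> J -> C) (x y : J -> C) : J -> C :=
  fun c => \sum_a \sum_b x a * y b * m a b c.

Lemma gmul_assoc (J : finType) (m : J -> J -> J -> C) :
  (forall a b c d, \sum_e m a b e * m e c d = \sum_e m b c e * m a e d) ->
  forall x y z, gmul m (gmul m x y) z = gmul m x (gmul m y z).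
Proof.
move=> A x y z; apply/funext => d; rewrite /gmul.
transitivity (\sum_a \sum_b \sum_c x a * y b * z c * \sum_e m a b e * m e c d).
  under eq_bigr do under eq_bigr do rewrite !mulr_suml.
  under eq_bigr do rewrite exchange_big /=.
  rewrite exchange_big; apply: eq_bigr => a _ /=.
  under eq_bigr do under eq_bigr do rewrite !mulr_suml.
  under eq_bigr do rewrite exchange_big /=.
  rewrite exchange_big; apply: eq_bigr => b _ /=.
  rewrite exchange_big; apply: eq_bigr => c _ /=.
  by rewrite mulr_sumr; apply: eq_bigr => e _; ring.
apply: eq_bigr => a _.
under eq_bigr do under eq_bigr do rewrite A mulr_sumr.
under eq_bigr do rewrite exchange_big /=.
rewrite exchange_big; apply: eq_bigr => e _ /=.
rewrite mulr_sumr mulr_suml; apply: eq_bigr => b _.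
rewrite mulr_sumr mulr_suml; apply: eq_bigr => c _.
by rewrite !mulrA.
Qed.

Lemma gmul_unitr (J : finType) (m : J -> J -> J -> C) (u : J -> C) :
  (forall b c, \sum_a u a * m b a c = (b == c)%:R) -> forall x, gmul m x u = x.
Proof.
move=> U x; apply/funext => d; rewrite /gmul -[RHS](sum_delta d x).
apply: eq_bigr => a _; rewrite -U mulr_sumr; apply: eq_bigr => b _.
by rewrite mulrA.
Qed.

Definition tmul (J K : finType) (m : J -> J -> J -> C) (m' : K -> K -> K -> C)
   (a b c : J * K) : C := m a.1 b.1 c.1 * m' a.2 b.2 c.2.

Lemma mulHE (J : finType) (H : hdata C J) x y : mulH H x y = gmul (hmul H) x y.
Proof. by []. Qed.

Lemma mul2E (J : finType) (H : hdata C J) x y :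
  mul2 H x y = gmul (tmul (hmul H) (hmul H)) x y.
Proof.
apply/funext => p; apply: eq_bigr => q _; apply: eq_bigr => r _.
by rewrite /tmul mulrA.
Qed.

Lemma mul3E (J : finType) (H : hdata C J) x y :
  mul3 H x y = gmul (tmul (tmul (hmul H) (hmul H)) (hmul H)) x y.
Proof.
apply/funext => p; apply: eq_bigr => q _; apply: eq_bigr => r _.
by rewrite /tmul !mulrA.
Qed.

Section Alg.
Variables (J : finType) (H : hdata C J).
Hypothesis A : forall a b c d, \sum_e hmul H a b e * hmul H e c d
                   = \sum_e hmul H b c e * hmul H a e d.
Hypothesis U : forall b c, \sum_a hunit H a * hmul H b a c = (b == c)%:R.

Lemma mul2A x y z : mul2 H (mul2 H x y) z = mul2 H x (mul2 H y z).
Proof.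
rewrite !mul2E; apply: gmul_assoc => a b c d; rewrite /tmul.
have S (F G : J -> C) (F' G' : J -> C) :
    \sum_(e : J * J) F e.1 * G e.2 * (F' e.1 * G' e.2)
  = (\sum_e F e * F' e) * (\sum_e G e * G' e).
  by rewrite -sum_pair_mul; apply: eq_bigr => e _; rewrite mulrACA.
by rewrite (S (hmul H a.1 b.1) (hmul H a.2 b.2) (fun e => hmul H e c.1 d.1)
  (fun e => hmul H e c.2 d.2)) (S (hmul H b.1 c.1) (hmul H b.2 c.2)
  (fun e => hmul H a.1 e d.1) (fun e => hmul H a.2 e d.2)) !A.
Qed.

Lemma mul2_one2 x : mul2 H x (one2 H) = x.
Proof.
rewrite mul2E; apply: gmul_unitr => b c; rewrite /tmul /one2.
transitivity (\sum_(a : J * J) (hunit H a.1 * hmul H b.1 a.1 c.1) *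
   (hunit H a.2 * hmul H b.2 a.2 c.2)).
  by apply: eq_bigr => a _; rewrite mulrACA.
rewrite (sum_pair_mul (fun a => hunit H a * hmul H b.1 a c.1)
  (fun a => hunit H a * hmul H b.2 a c.2)) !U.
by rewrite -natrM mulnb -xpair_eqE -!surjective_pairing.
Qed.

Lemma mul2_divr T Tinv x y : inverse2 H T Tinv -> mul2 H y T = x -> mul2 H x Tinv = y.
Proof.
case=> TT _ <-; rewrite mul2A (_ : mul2 H T Tinv = one2 H) ?mul2_one2 //.
exact/funext.
Qed.

Lemma mul2_mulr T Tinv x y : inverse2 H T Tinv -> mul2 H x Tinv = y -> mul2 H y T = x.
Proof.
case=> _ TT <-; rewrite mul2A (_ : mul2 H Tinv T = one2 H) ?mul2_one2 //.
exact/funext.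
Qed.

End Alg.

Section Push.
Variables (J I : finType) (beta : J -> I) (gam : I -> J) (c : J -> C).
Hypotheses (betaK : cancel beta gam) (gamK : cancel gam beta) (cn : forall j, c j != 0).

Definition push (x : J -> C) : I -> C := fun i => x (gam i) * c (gam i).

Lemma push_beta x j : push x (beta j) = x j * c j.
Proof. by rewrite /push betaK. Qed.

Lemma beta_bij : bijective beta. Proof. by exists gam. Qed.

Lemma sum_beta (F : I -> C) : \sum_i F i = \sum_j F (beta j).
Proof. exact: (reindex beta (onW_bij _ beta_bij)). Qed.

Lemma push_ext (x y : I -> C) : (forall j, x (beta j) = y (beta j)) -> x = y.
Proof. by move=> E; apply/funext => i; rewrite -(gamK i). Qed.

Lemma push_inj x y : push x = push y -> x = y.
Proof.
move=> E; apply/funext => j; have := congr1 (fun f => f (beta j)) E.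
by rewrite !push_beta => /mulIf; apply.
Qed.

Lemma push_gmul m m' x y :
  (forall a b e, m' (beta a) (beta b) (beta e) * (c a * c b) = m a b e * c e) ->
  gmul m' (push x) (push y) = push (gmul m x y).
Proof.
move=> mm; apply: push_ext => e; rewrite push_beta /gmul sum_beta mulr_suml.
apply: eq_bigr => a _; rewrite sum_beta mulr_suml; apply: eq_bigr => b _.
by rewrite !push_beta -[RHS]mulrA -mm; ring.
Qed.

Definition unpush (y : I -> C) : J -> C := fun j => y (beta j) / c j.

Lemma unpushK y : push (unpush y) = y.
Proof. by apply: push_ext => j; rewrite push_beta mulfVK. Qed.

End Push.
End BilinearProduct.

Section Relabel.
Variables (C : numClosedFieldType) (J I : finType).

(** Expresses that the linear map sending the basis vector [a] of [H'] to [c a] times the vector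
    [beta a] of [H] respects the bialgebra structures; [push] is this map on coordinates. *)
Record relabel (H' : hdata C J) (H : hdata C I) (beta : J -> I) (c : J -> C) : Prop :=
  Relabel {
  rl_neq0 a : c a != 0;
  rl_mul a b e : hmul H (beta a) (beta b) (beta e) * (c a * c b) = hmul H' a b e * c e;
  rl_comul a b e : hcomul H (beta a) (beta b) (beta e) * c a
                 = hcomul H' a b e * (c b * c e);
  rl_unit a : hunit H (beta a) = hunit H' a * c a;
  rl_counit a : hcounit H (beta a) * c a = hcounit H' a }.

Variables (H' : hdata C J) (H : hdata C I) (beta : J -> I) (gam : I -> J) (c : J -> C).
Hypotheses (betaK : cancel beta gam) (gamK : cancel gam beta).
Hypothesis (rl : relabel H' H beta c).

Definition beta2 (p : J * J) := (beta p.1, beta p.2).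
Definition gam2 (p : I * I) := (gam p.1, gam p.2).
Definition c2 (p : J * J) := c p.1 * c p.2.
Definition beta3 (p : J * J * J) := (beta2 p.1, beta p.2).
Definition gam3 (p : I * I * I) := (gam2 p.1, gam p.2).
Definition c3 (p : J * J * J) := c2 p.1 * c p.2.

Lemma beta2K : cancel beta2 gam2. Proof. by case=> a b; rewrite /gam2 /= !betaK. Qed.
Lemma gam2K : cancel gam2 beta2. Proof. by case=> a b; rewrite /beta2 /= !gamK. Qed.
Lemma beta3K : cancel beta3 gam3. Proof. by case=> a b; rewrite /gam3 /= beta2K betaK. Qed.
Lemma gam3K : cancel gam3 beta3. Proof. by case=> a b; rewrite /beta3 /= gam2K gamK. Qed.
Lemma c2_neq0 p : c2 p != 0. Proof. by rewrite mulf_neq0 ?(rl_neq0 rl). Qed.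
Lemma c3_neq0 p : c3 p != 0. Proof. by rewrite mulf_neq0 ?c2_neq0 ?(rl_neq0 rl). Qed.

Notation push1 := (push gam c).
Notation push2 := (push gam2 c2).
Notation push3 := (push gam3 c3).

Let P1 := push_beta c betaK.
Let P2 := push_beta c2 beta2K.
Let P3 := push_beta c3 beta3K.

Lemma rl_mulH x y : mulH H (push1 x) (push1 y) = push1 (mulH H' x y).
Proof. by rewrite !mulHE; apply: (push_gmul betaK gamK); apply: rl_mul rl. Qed.

Lemma rl_mul2 x y : mul2 H (push2 x) (push2 y) = push2 (mul2 H' x y).
Proof.
rewrite !mul2E; apply: (push_gmul beta2K gam2K) => a b e.
have := rl_mul rl a.1 b.1 e.1; have := rl_mul rl a.2 b.2 e.2; rewrite /tmul /c2 /= => E1 E2.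
transitivity (hmul H (beta a.1) (beta b.1) (beta e.1) * (c a.1 * c b.1) *
 (hmul H (beta a.2) (beta b.2) (beta e.2) * (c a.2 * c b.2))); first by ring.
by rewrite E1 E2; ring.
Qed.

Lemma rl_mul3 x y : mul3 H (push3 x) (push3 y) = push3 (mul3 H' x y).
Proof.
rewrite !mul3E; apply: (push_gmul beta3K gam3K) => a b e.
have := rl_mul rl a.1.1 b.1.1 e.1.1; have := rl_mul rl a.1.2 b.1.2 e.1.2.
have := rl_mul rl a.2 b.2 e.2; rewrite /tmul /c3 /c2 /= => E1 E2 E3.
transitivity (hmul H (beta a.1.1) (beta b.1.1) (beta e.1.1) * (c a.1.1 * c b.1.1) *
 (hmul H (beta a.1.2) (beta b.1.2) (beta e.1.2) * (c a.1.2 * c b.1.2)) *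
 (hmul H (beta a.2) (beta b.2) (beta e.2) * (c a.2 * c b.2))); first by ring.
by rewrite E1 E2 E3; ring.
Qed.

Lemma rl_oneH : oneH H = push1 (oneH H').
Proof. by apply: (push_ext gamK) => j; rewrite P1; apply: rl_unit rl j. Qed.

Lemma rl_one2 : one2 H = push2 (one2 H').
Proof.
apply: (push_ext gam2K) => j; rewrite P2 /one2 /= !(rl_unit rl) /c2; ring.
Qed.

Lemma rl_comulH x : comulH H (push1 x) = push2 (comulH H' x).
Proof.
apply: (push_ext gam2K) => p; rewrite P2 /comulH (sum_beta betaK gamK) mulr_suml.
apply: eq_bigr => a _; rewrite P1 /=.
by rewrite -mulrA [c a * _]mulrC (rl_comul rl) mulrA.
Qed.

Lemma rl_comul_l t : comul_l H (push2 t) = push3 (comul_l H' t).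
Proof.
apply: (push_ext gam3K) => p; rewrite P3 /comul_l (sum_beta betaK gamK) mulr_suml.
apply: eq_bigr => a _; rewrite (P2 t (a, p.2)) /c3 /c2 /=.
have := rl_comul rl a p.1.1 p.1.2 => E.
transitivity (t (a, p.2) * c p.2 * (hcomul H (beta a) (beta p.1.1) (beta p.1.2) * c a)).
  by ring.
by rewrite E; ring.
Qed.

Lemma rl_comul_r t : comul_r H (push2 t) = push3 (comul_r H' t).
Proof.
apply: (push_ext gam3K) => p; rewrite P3 /comul_r (sum_beta betaK gamK) mulr_suml.
apply: eq_bigr => a _; rewrite (P2 t (p.1.1, a)) /c3 /c2 /=.
have := rl_comul rl a p.1.2 p.2 => E.
transitivity (t (p.1.1, a) * c p.1.1 * (hcomul H (beta a) (beta p.1.2) (beta p.2) * c a)).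
  by ring.
by rewrite E; ring.
Qed.

Lemma rl_counit_l t : counit_l H (push2 t) = push1 (counit_l H' t).
Proof.
apply: (push_ext gamK) => b; rewrite P1 /counit_l (sum_beta betaK gamK) mulr_suml.
apply: eq_bigr => a _; rewrite (P2 t (a, b)) /c2 /= -(rl_counit rl); ring.
Qed.

Lemma rl_counit_r t : counit_r H (push2 t) = push1 (counit_r H' t).
Proof.
apply: (push_ext gamK) => b; rewrite P1 /counit_r (sum_beta betaK gamK) mulr_suml.
apply: eq_bigr => a _; rewrite (P2 t (b, a)) /c2 /= -(rl_counit rl); ring.
Qed.

Lemma rl_flip t : flip (push2 t) = push2 (flip t).
Proof.
by apply: (push_ext gam2K) => p; rewrite P2 /flip (P2 t (p.2, p.1)) /c2 /= mulrC [c _ * _]mulrC mulrC.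
Qed.

Lemma rl_leg12 t : leg12 H (push2 t) = push3 (leg12 H' t).
Proof.
apply: (push_ext gam3K) => p; rewrite P3 /leg12 (P2 t p.1) /c3 /= (rl_unit rl); ring.
Qed.

Lemma rl_leg13 t : leg13 H (push2 t) = push3 (leg13 H' t).
Proof.
apply: (push_ext gam3K) => p; rewrite P3 /leg13 (P2 t (p.1.1, p.2)) /c3 /c2 /= (rl_unit rl); ring.
Qed.

Lemma rl_leg23 t : leg23 H (push2 t) = push3 (leg23 H' t).
Proof.
apply: (push_ext gam3K) => p; rewrite P3 /leg23 (P2 t (p.1.2, p.2)) /c3 /c2 /= (rl_unit rl); ring.
Qed.

Lemma rl_is_qt t : is_qt H' t <-> is_qt H (push2 t).
Proof.
have inj3 := push_inj beta3K c3_neq0; have inj2 := push_inj beta2K c2_neq0.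
have inj1 := push_inj betaK (rl_neq0 rl).
have eqf (A : finType) (f g : A -> C) : f =1 g <-> f = g.
  by split=> [/funext|->].
rewrite /is_qt; split=> -[s [[s1 s2] q1 q2 q3 [q4 q5]]].
- exists (push2 s); split; [split|move=> a|..].
  + by rewrite eqf rl_mul2 rl_one2; congr push; apply/eqf.
  + by rewrite eqf rl_mul2 rl_one2; congr push; apply/eqf.
  + rewrite eqf -(unpushK betaK gamK (rl_neq0 rl) a) rl_comulH rl_flip !rl_mul2.
    by congr push; apply/eqf; apply: q1.
  + by rewrite eqf rl_comul_l rl_leg13 rl_leg23 rl_mul3; congr push; apply/eqf.
  + by rewrite eqf rl_comul_r rl_leg13 rl_leg12 rl_mul3; congr push; apply/eqf.
  + by split; rewrite eqf ?rl_counit_l ?rl_counit_r rl_oneH; congr push; apply/eqf.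
- have [s' Es] : exists s', push2 s' = s.
    by exists (unpush beta2 c2 s); apply: unpushK beta2K gam2K c2_neq0 s.
  rewrite -{s}Es in s1 s2 q1; exists s'; split; [split|move=> a|..].
  + by apply/eqf/inj2; rewrite -rl_mul2 -rl_one2; apply/eqf.
  + by apply/eqf/inj2; rewrite -rl_mul2 -rl_one2; apply/eqf.
  + by apply/eqf/inj2; rewrite -!rl_mul2 -rl_flip -rl_comulH; apply/eqf.
  + by apply/eqf/inj3; rewrite -rl_mul3 -rl_leg13 -rl_leg23 -rl_comul_l; apply/eqf.
  + by apply/eqf/inj3; rewrite -rl_mul3 -rl_leg13 -rl_leg12 -rl_comul_r; apply/eqf.
  + by split; apply/eqf/inj1; rewrite -rl_oneH -?rl_counit_l -?rl_counit_r; apply/eqf.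
Qed.

End Relabel.

(** * Positive R-matrices on a bicrossed product *)

Section Model.
Variables (C : numClosedFieldType) (kT gT : finGroupType).
Notation J := (kT * gT)%type.

(* [op] is the product of [kT] used by the comultiplication; the twist changes
   it (and [lact]) but not the algebra structure.  The antipode is irrelevant to
   quasi-triangular structures and to twists, hence the dummy [0]. *)
Definition mpH (ract : kT -> gT -> kT) (lact : kT -> gT -> gT) (op : kT -> kT -> kT) :
  hdata C J := HData
  (fun a b e => ((b.1 == ract a.1 a.2) && (e == (a.1, (a.2 * b.2)%g)))%:R)
  (fun a => (a.2 == 1%g)%:R)
  (fun a b e => ((a == (op b.1 e.1, e.2)) && (b.2 == lact e.1 e.2))%:R)
  (fun a => (a.1 == 1%g)%:R)
  (fun _ _ => 0).

Lemma sum_deltal (T : finType) (j : T) (F : T -> C) :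
  \sum_i (i == j)%:R * F i = F j.
Proof. exact: sum_bvecl. Qed.

Lemma sum_pairE (V : nmodType) (T1 T2 : finType) (F : T1 * T2 -> V) :
  \sum_p F p = \sum_a \sum_b F (a, b).
Proof. by rewrite pair_bigA; apply: eq_bigr => -[]. Qed.

(** The hypotheses say that a product coefficient is a sum over one factorization variable instead
    of over pairs of basis vectors. This shape passes to tensor products, so [mul2] and [mul3]
    follow from [mp_gmul]. *)
Lemma gmul_tmul (J1 J2 W1 W2 : finType) (m1 : J1 -> J1 -> J1 -> C) (m2 : J2 -> J2 -> J2 -> C)
    (p1 q1 : J1 -> W1 -> J1) (p2 q2 : J2 -> W2 -> J2) :
  (forall x y e, gmul m1 x y e = \sum_w x (p1 e w) * y (q1 e w)) ->
  (forall x y e, gmul m2 x y e = \sum_w x (p2 e w) * y (q2 e w)) ->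
  forall x y e, gmul (tmul m1 m2) x y e =
    \sum_w x (p1 e.1 w.1, p2 e.2 w.2) * y (q1 e.1 w.1, q2 e.2 w.2).
Proof.
move=> M1 M2 x y e; rewrite /gmul /tmul.
transitivity (\sum_a2 \sum_b2 (\sum_a1 \sum_b1 x (a1, a2) * y (b1, b2) * m1 a1 b1 e.1)
   * m2 a2 b2 e.2).
  rewrite sum_pairE exchange_big /=; apply: eq_bigr => a2 _.
  under [RHS]eq_bigr do rewrite mulr_suml.
  rewrite [RHS]exchange_big; apply: eq_bigr => a1 _ /=.
  under [RHS]eq_bigr do rewrite mulr_suml.
  rewrite [RHS]exchange_big /= [LHS]sum_pairE; apply: eq_bigr => b1 _.
  by apply: eq_bigr => b2 _; rewrite mulrA.
rewrite [RHS]sum_pairE /=.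
transitivity (\sum_w1 \sum_a2 \sum_b2 x (p1 e.1 w1, a2) * y (q1 e.1 w1, b2) * m2 a2 b2 e.2).
  rewrite [RHS]exchange_big; apply: eq_bigr => a2 _ /=.
  rewrite [RHS]exchange_big; apply: eq_bigr => b2 _ /=.
  by rewrite -mulr_suml -(M1 (fun a => x (a, a2)) (fun b => y (b, b2))).
by apply: eq_bigr => w1 _; rewrite -(M2 (fun a => x (_, a)) (fun b => y (_, b))).
Qed.

Section Products.
Variables (ract : kT -> gT -> kT) (lact : kT -> gT -> gT) (op : kT -> kT -> kT).
Let H := mpH ract lact op.

Let psi (e : J) (w : gT) : J := (e.1, w).
Let phi (e : J) (w : gT) : J := (ract e.1 w, (w^-1 * e.2)%g).

Lemma mp_gmul x y e : gmul (hmul H) x y e = \sum_w x (psi e w) * y (phi e w).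
Proof.
rewrite /gmul sum_pairE.
rewrite (sum_only (j := e.1)); last first.
  move=> u ne; apply: big1 => w _; apply: big1 => b _ /=; rewrite -pair_eqE /=.
  by rewrite [e.1 == u]eq_sym (negPf ne) andbF mulr0.
apply: eq_bigr => w _; rewrite (sum_only (j := phi e w)) => [|b ne] /=.
  by rewrite -pair_eqE /= !eqxx mulKVg eqxx mulr1.
case: andP => [[/eqP b1 /eqP eb]|]; last by rewrite mulr0.
by case/eqP: ne; rewrite /phi eb /= mulKg -b1 -surjective_pairing.
Qed.

Lemma mp_mul2 s t p : mul2 H s t p = \sum_(w : gT * gT)
  s ((p.1.1, w.1), (p.2.1, w.2)) *
  t ((ract p.1.1 w.1, (w.1^-1 * p.1.2)%g), (ract p.2.1 w.2, (w.2^-1 * p.2.2)%g)).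
Proof. by rewrite mul2E (gmul_tmul mp_gmul mp_gmul). Qed.

Lemma mp_mul3 s t p : mul3 H s t p = \sum_(w : gT * gT * gT)
  s (((p.1.1.1, w.1.1), (p.1.2.1, w.1.2)), (p.2.1, w.2)) *
  t (((ract p.1.1.1 w.1.1, (w.1.1^-1 * p.1.1.2)%g),
      (ract p.1.2.1 w.1.2, (w.1.2^-1 * p.1.2.2)%g)),
     (ract p.2.1 w.2, (w.2^-1 * p.2.2)%g)).
Proof. by rewrite mul3E (gmul_tmul (gmul_tmul mp_gmul mp_gmul) mp_gmul). Qed.

Lemma mp_comulH x v y w z :
  comulH H x ((v, y), (w, z)) = (y == lact w z)%:R * x (op v w, z).
Proof.
rewrite /comulH /=; under eq_bigr do rewrite mulrC -mulnb natrM -mulrA mulrCA.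
by rewrite -mulr_sumr sum_deltal.
Qed.

Lemma mp_comul_l t v y w z q :
  comul_l H t (((v, y), (w, z)), q) = (y == lact w z)%:R * t ((op v w, z), q).
Proof. exact: (mp_comulH (fun a => t (a, q))). Qed.

Lemma mp_comul_r t v y w z q :
  comul_r H t ((q, (v, y)), (w, z)) = (y == lact w z)%:R * t (q, (op v w, z)).
Proof. exact: (mp_comulH (fun a => t (q, a))). Qed.

Lemma mp_counit_l t b : counit_l H t b = \sum_x t ((1%g, x), b).
Proof.
rewrite /counit_l sum_pairE /=.
rewrite (sum_only (j := 1%g)) => [|u ne].
  by apply: eq_bigr => x _; rewrite eqxx mulr1.
by apply: big1 => x _; rewrite (negPf ne) mulr0.
Qed.

Lemma mp_counit_r t b : counit_r H t b = \sum_x t (b, (1%g, x)).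
Proof. exact: (mp_counit_l (fun p => t (p.2, p.1))). Qed.

(* A tensor with exactly one term for each pair of left units: the sum of
   the [(u, s u v) (x) (v, t u v)]. *)
Definition sect2 (s t : kT -> kT -> gT) : vec C (J * J) := fun p =>
  ((p.1.2 == s p.1.1 p.2.1) && (p.2.2 == t p.1.1 p.2.1))%:R.

Definition sect3 (s t r : kT -> kT -> kT -> gT) : vec C (J * J * J) := fun p =>
  ([&& p.1.1.2 == s p.1.1.1 p.1.2.1 p.2.1, p.1.2.2 == t p.1.1.1 p.1.2.1 p.2.1
    & p.2.2 == r p.1.1.1 p.1.2.1 p.2.1])%:R.

(** Left multiplication by such a tensor is a substitution, as exactly one term contributes to each
    coefficient. The twist identities thereby reduce to identities in the two groups. *)
Lemma sect2_mul s t x u z v y : mul2 H (sect2 s t) x ((u, z), (v, y)) =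
  x ((ract u (s u v), ((s u v)^-1 * z)%g), (ract v (t u v), ((t u v)^-1 * y)%g)).
Proof.
rewrite mp_mul2 /sect2 /=.
under eq_bigr => w _ do rewrite -xpair_eqE -surjective_pairing.
by rewrite sum_deltal.
Qed.

Lemma sect3_mul s t r x u z v y w k : mul3 H (sect3 s t r) x (((u, z), (v, y)), (w, k)) =
  x (((ract u (s u v w), ((s u v w)^-1 * z)%g), (ract v (t u v w), ((t u v w)^-1 * y)%g)),
     (ract w (r u v w), ((r u v w)^-1 * k)%g)).
Proof.
rewrite mp_mul3 /sect3 /=.
under eq_bigr => q _ do rewrite andbA -xpair_eqE -surjective_pairing
  -xpair_eqE -surjective_pairing.
by rewrite sum_deltal.
Qed.

Lemma leg12_sect2 s t : leg12 H (sect2 s t) =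
  sect3 (fun u v _ => s u v) (fun u v _ => t u v) (fun _ _ _ => 1%g).
Proof. by apply/funext => p; rewrite /leg12 /sect2 /sect3 -natrM mulnb andbA. Qed.

Lemma leg13_sect2 s t : leg13 H (sect2 s t) =
  sect3 (fun u _ w => s u w) (fun _ _ _ => 1%g) (fun u _ w => t u w).
Proof.
by apply/funext => p; rewrite /leg13 /sect2 /sect3 -natrM mulnb -andbA [X in _ && X]andbC.
Qed.

Lemma leg23_sect2 s t : leg23 H (sect2 s t) =
  sect3 (fun _ _ _ => 1%g) (fun _ v w => s v w) (fun _ v w => t v w).
Proof. by apply/funext => p; rewrite /leg23 /sect2 /sect3 -natrM mulnb. Qed.

End Products.
End Model.

(** [zeta v] is the inverse of [eta(v)] in the general form of a positive R-matrix: as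
    [(x^u)^-1 = ^(u^-1) (x^-1)], the factor [(eta(v)^u)^-1] becomes [lact u^-1 (zeta v)]. The laws
    [rd_xi_act], [rd_mul], [rd_zeta_act] come from the intertwining axiom, the others from the
    formulas for [(Δ ⊗ id) R] and [(id ⊗ Δ) R]. *)
Record r_data (kT gT : finGroupType) (ract : kT -> gT -> kT) (lact : kT -> gT -> gT)
    (xi zeta : kT -> gT) : Prop := RData {
  rd_xiM a b : xi (a * b)%g = (xi a * xi b)%g;
  rd_zetaM a b : zeta (a * b)%g = (zeta b * zeta a)%g;
  rd_xi_act u z : (xi u * z)%g = (lact u z * xi (ract u z))%g;
  rd_zeta_ract v a : zeta (ract v (xi a)) = lact a^-1%g (zeta v);
  rd_xi_ract u b : xi (ract u (lact u^-1%g (zeta b))) = lact b (xi u);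
  rd_mul u v : (v * u)%g = (ract u (lact u^-1%g (zeta v)) * ract v (xi u))%g;
  rd_zeta_act v z : (zeta v * lact v z)%g = (z * zeta (ract v z))%g }.

Section RMatrix.
Variables (C : numClosedFieldType) (kT gT : finGroupType).
Variables (ract : kT -> gT -> kT) (lact : kT -> gT -> gT).
Hypothesis mp : matched_pair ract lact.
Notation J := (kT * gT)%type.
Let H : hdata C J := mpH C ract lact (fun a b => a * b)%g.
Variable R : vec C (J * J).
Hypotheses (R0 : forall p, 0 <= R p)
  (Rl : comul_l H R = mul3 H (leg13 H R) (leg23 H R))
  (Rr : comul_r H R = mul3 H (leg13 H R) (leg12 H R))
  (Rel : counit_l H R = oneH H) (Rer : counit_r H R = oneH H)
  (Rq : forall x, mul2 H (flip (comulH H x)) R = mul2 H R (comulH H x)).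

Lemma R_left a xa b xb v y :
  (xa == lact b xb)%:R * R (((a * b)%g, xb), (v, y)) =
  \sum_w R ((a, xa), (v, w)) * R ((b, xb), (ract v w, (w^-1 * y)%g)).
Proof.
rewrite -(mp_comul_l ract lact (fun a b => a * b)%g) [comul_l _ _]Rl mp_mul3 /=.
rewrite sum_pairE (sum_only (j := (xa, 1%g))) => [|[w1 w2] ne].
  apply: eq_bigr => w _; rewrite /leg13 /leg23 /= eqxx mulr1 mulVg eqxx mul1r.
  by rewrite (ract1 mp) invg1 mul1g.
apply: big1 => w _; rewrite /leg13 /leg23 /=.
case: (eqVneq w2 1%g) => [w21|_]; last by rewrite mulr0 mul0r.
case: (eqVneq (w1^-1 * xa)%g 1%g) => [/eqP|_]; last by rewrite mul0r mulr0.
by rewrite -eq_invg_mul eq_sym => /eqP E; rewrite w21 E invgK eqxx in ne.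
Qed.

Lemma R_right u x a ya b yb :
  (ya == lact b yb)%:R * R ((u, x), ((a * b)%g, yb)) =
  \sum_w R ((u, w), (b, yb)) * R ((ract u w, (w^-1 * x)%g), (a, ya)).
Proof.
rewrite -(mp_comul_r ract lact (fun a b => a * b)%g) [comul_r _ _]Rr mp_mul3 /=.
rewrite sum_pairE exchange_big (sum_only (j := yb)) => [|w3 ne] /=.
  rewrite sum_pairE; apply: eq_bigr => w _.
  rewrite (sum_only (j := 1%g)) => [|w2 ne]; rewrite /leg13 /leg12 /=.
    by rewrite eqxx mulr1 mulVg eqxx mulr1 (ract1 mp) invg1 mul1g.
  by rewrite (negPf ne) mulr0 mul0r.
apply: big1 => w _; rewrite /leg12 /= (_ : (w3^-1 * yb == 1)%g = false) ?mulr0 //.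
by rewrite -eq_invg_mul invgK (negPf ne).
Qed.

Let R1l x v y : y != 1%g -> R ((1%g, x), (v, y)) = 0.
Proof.
move=> y1; apply: (@sumr_eq0_term _ _ (fun x => R ((1%g, x), (v, y)))) => //.
by rewrite -(mp_counit_l ract lact (fun a b => a * b)%g) [counit_l _ _]Rel /= (negPf y1).
Qed.

Let R1r x v y : y != 1%g -> R ((v, y), (1%g, x)) = 0.
Proof.
move=> y1; apply: (@sumr_eq0_term _ _ (fun x => R ((v, y), (1%g, x)))) => //.
by rewrite -(mp_counit_r ract lact (fun a b => a * b)%g) [counit_r _ _]Rer /= (negPf y1).
Qed.

Let zeta_ex v : exists z, forall x, R ((1%g, x), (v, 1%g)) = (x == z)%:R.
Proof.
apply: orth_sum1 => [w w' ne|]; last first.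
  by rewrite -(mp_counit_l ract lact (fun a b => a * b)%g) [counit_l _ _]Rel /= eqxx.
have := R_left 1%g w 1%g w' v 1%g; rewrite (lact1 mp) (negPf ne) mul0r.
rewrite (sum_only (j := 1%g)) => [|i ni]; last by rewrite R1l ?mul0r.
by rewrite (ract1 mp) invg1 mul1g.
Qed.

Let xi_ex u : exists z, forall y, R ((u, 1%g), (1%g, y)) = (y == z)%:R.
Proof.
apply: orth_sum1 => [w w' ne|]; last first.
  by rewrite -(mp_counit_r ract lact (fun a b => a * b)%g) [counit_r _ _]Rer /= eqxx.
have := R_right u 1%g 1%g w' 1%g w; rewrite (lact1 mp) eq_sym (negPf ne) mul0r.
rewrite (sum_only (j := 1%g)) => [|i ni]; last by rewrite R1r ?mul0r.
by rewrite (ract1 mp) invg1 mul1g.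
Qed.

(** The counit axioms determine [R] where one of the [kT] labels is 1. Any nonzero coefficient is
    multiplied, through [R_left] or [R_right], by another that carries it to such a place;
    positivity keeps the result nonzero, and this determines the support. *)
Lemma R_form_ex : exists xi zeta : kT -> gT, r_data ract lact xi zeta /\
  R = sect2 C (fun u v => lact u^-1%g (zeta v)) (fun u _ => xi u).
Proof.
have /fin_all_exists[zeta Rz] := zeta_ex.
have /fin_all_exists[xi Rx] := xi_ex.
pose X u v := lact u^-1%g (zeta v).
have termn (F : gT -> C) w : (forall i, 0 <= F i) -> F w != 0 -> \sum_i F i != 0.
  by move=> F0 Fw; apply: (sumr_neq0 (j := w)).
have lactK u z : lact u (lact u^-1%g z) = z by rewrite -(lactM mp) mulgV (lact1 mp).
have ex u v : exists w, R ((u, X u v), (v, w)) != 0.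
  have := R_left u (X u v) u^-1%g (zeta v) v 1%g.
  rewrite mulgV Rz !eqxx mul1r => /esym E.
  have : \sum_w R ((u, X u v), (v, w)) * R ((u^-1%g, zeta v), (ract v w, (w^-1 * 1)%g)) != 0.
    by rewrite E oner_neq0.
  by move=> /sumr_neq0_ex[w]; rewrite mulf_eq0 negb_or => /andP[nz _]; exists w.
have suppy u x v y : R ((u, x), (v, y)) != 0 -> y = xi u.
  move=> nz; have [y' nz'] := ex (ract u x) v^-1%g; set x' := X _ _ in nz'.
  have := R_right u (x * x')%g v^-1%g y' v y; rewrite mulVg => E.
  have : (y' == lact v y)%:R * R ((u, (x * x')%g), (1%g, y)) != 0.
    rewrite E; apply: (termn _ x) => [i|]; first exact: mulr_ge0.
    by rewrite mulKg mulf_neq0.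
  rewrite mulf_eq0 negb_or => /andP[_ nz2].
  have [E1|n1] := eqVneq (x * x')%g 1%g; last by rewrite R1r ?eqxx in nz2.
  by move: nz2; rewrite E1 Rx pnatr_eq0 eqb0 negbK => /eqP.
have suppx u x v y : R ((u, x), (v, y)) != 0 -> x = X u v.
  move=> nz; have [y' nz'] := ex u^-1%g (ract v y); set x' := X _ _ in nz'.
  have := R_left u x u^-1%g x' v (y * y')%g; rewrite mulgV => E.
  have : (x == lact u^-1%g x')%:R * R ((1%g, x'), (v, (y * y')%g)) != 0.
    rewrite E; apply: (termn _ y) => [i|]; first exact: mulr_ge0.
    by rewrite mulKg mulf_neq0.
  rewrite mulf_eq0 negb_or pnatr_eq0 eqb0 negbK => /andP[/eqP -> nz2].
  have [E1|n1] := eqVneq (y * y')%g 1%g; last by rewrite R1l ?eqxx in nz2.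
  by move: nz2; rewrite E1 Rz pnatr_eq0 eqb0 negbK => /eqP ->.
pose r u v := R ((u, X u v), (v, xi u)).
have rn u v : r u v != 0 by have [w nz] := ex u v; rewrite /r -(suppy _ _ _ _ nz).
have r0 u v : 0 < r u v by rewrite lt_def rn R0.
have RE u x v y : R ((u, x), (v, y)) = ((x == X u v) && (y == xi u))%:R * r u v.
  case: andP => [[/eqP -> /eqP ->]|N]; first by rewrite mul1r.
  rewrite mul0r; apply/eqP/negPn/negP => nz; apply: N.
  by rewrite (suppy _ _ _ _ nz) (suppx _ _ _ _ nz) !eqxx.
have left a b v : [/\ xi (a * b)%g = (xi a * xi b)%g,
     zeta (ract v (xi a)) = lact a^-1%g (zeta v) &
     r (a * b)%g v = r a v * r b (ract v (xi a))].
  have := R_left a (lact b (X (a * b)%g v)) b (X (a * b)%g v) v (xi (a * b)%g).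
  rewrite eqxx mul1r -/(r (a * b)%g v) (sum_only (j := xi a)) => [E|w ne]; last first.
    by rewrite RE (negPf ne) andbF !mul0r.
  have := rn (a * b)%g v; rewrite E mulf_eq0 negb_or => /andP[n1 n2].
  have Y1 := suppy _ _ _ _ n2; have X1 := suppx _ _ _ _ n2; have X2 := suppx _ _ _ _ n1.
  have xiab : xi (a * b)%g = (xi a * xi b)%g by rewrite -Y1 mulKVg.
  split=> //.
    apply: (can_inj (lactK b)); rewrite -/(X b _) -X1 /X invMg.
    exact: (lactM mp).
  by move: E; rewrite X2 X1 -/(r a v) xiab mulKg.
have right u a b : [/\ lact b (xi u) = xi (ract u (X u b)),
     X u (a * b)%g = (X u b * X (ract u (X u b)) a)%g &
     r u (a * b)%g = r u b * r (ract u (X u b)) a].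
  have := R_right u (X u (a * b)%g) a (lact b (xi u)) b (xi u).
  rewrite eqxx mul1r -/(r u (a * b)%g) (sum_only (j := X u b)) => [E|w ne]; last first.
    by rewrite RE (negPf ne) !mul0r.
  have := rn u (a * b)%g; rewrite E mulf_eq0 negb_or => /andP[n1 n2].
  have Y1 := suppy _ _ _ _ n2; have X1 := suppx _ _ _ _ n2.
  split; [exact: Y1|by rewrite -X1 mulKVg|by move: E; rewrite X1 Y1].
have X1 v : X 1%g v = zeta v by rewrite /X invg1 (lact1 mp).
have r1v v : r 1%g v = 1.
  rewrite /r X1; have xi1 : xi 1%g = 1%g.
    by apply/eqP/negPn/negP => ne; have := rn 1%g v; rewrite /r R1l ?eqxx.
  by rewrite xi1 Rz eqxx.
have xi1 : xi 1%g = 1%g.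
  have [E _ _] := left 1%g 1%g 1%g; rewrite mulg1 in E.
  by apply: (mulgI (xi 1%g)); rewrite -E mulg1.
(* The product over [a] is a positive character of a finite group, hence 1. Multiplying the rule for
   [r u (a * v)] over all [a] then gives [r u v ^+ #|kT| = 1]. *)
pose P u := \prod_a r u a.
have P0 u : 0 < P u by apply: prodr_gt0.
have P1 : P 1%g = 1 by rewrite /P big1.
have PM a b : P (a * b)%g = P a * P b.
  rewrite /P [X in _ * X](reindex_inj (ract_inj mp (z := xi a))) -big_split /=.
  by apply: eq_bigr => v _; have [_ _ ->] := left a b v.
have N0 : (0 < #|kT|)%N by apply/card_gt0P; exists 1%g.
have PX a n : P (a ^+ n)%g = P a ^+ n.
  by elim: n => [|n IH]; rewrite ?expg0 ?P1 ?expr0 // expgS PM IH exprS.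
have Pe a : P a = 1.
  apply: (@root_eq _ #[a]%g) => //.
  by rewrite -PX expg_order P1 expr1n.
have re u v : r u v = 1.
  apply: (@root_eq _ #|kT|) => //; rewrite expr1n -(Pe u).
  rewrite /P (reindex_inj (mulIg v)) /= -[LHS]mulr1 -[Z in _ * Z = _](Pe (ract u (X u v))).
  rewrite -prodr_constT -big_split /=; apply: eq_bigr => a _.
  by have [_ _ ->] := right u a v.
have RS : R = sect2 C (fun u v => lact u^-1%g (zeta v)) (fun u _ => xi u).
  by apply/funext => -[[u x] [v y]]; rewrite RE re mulr1.
(* The intertwining axiom for the basis vector [(v * u, k)] is read at a position where its left
   side is 1. The support condition of the right side yields the three equations. *)
have Q u v k : [/\ (v * u)%g = (ract u (X u v) * ract v (xi u))%g,
   (lact u k * xi (ract u k))%g = (xi u * k)%g &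
   (k * X (ract u k) (ract v (lact u k)))%g = (X u v * lact (ract v (xi u)) k)%g].
  have := congr1 (fun f => f ((u, (k * X (ract u k) (ract v (lact u k)))%g),
     (v, (lact u k * xi (ract u k))%g))) (Rq (bvec C ((v * u)%g, k))).
  rewrite {2}RS sect2_mul mp_mul2 /= mp_comulH.
  rewrite sum_pairE (sum_only (j := k)) => [|w1 ne]; last first.
    apply: big1 => w2 _; rewrite /flip /= mp_comulH /bvec xpair_eqE eqxx (negPf ne).
    by rewrite mulr0 mul0r.
  rewrite (sum_only (j := lact u k)) => [|w2 ne]; last first.
    by rewrite /flip /= mp_comulH (negPf ne) !mul0r.
  rewrite /flip /= mp_comulH /bvec !eqxx mul1r !mulKg RS /sect2 /= !eqxx mul1r -natrM mulnb.
  move/esym/eqP; rewrite eqr_nat eqb1 xpair_eqE => /andP[/eqP E1 /andP[/eqP E2 /eqP E3]].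
  split; first exact: esym E2.
    by apply: (mulgI (xi u)^-1%g); rewrite mulKg.
  by apply: (mulgI (X u v)^-1%g); rewrite mulKg E1 E3.
exists xi, zeta; split=> //; split=> //.
- by move=> a b; have [-> _ _] := left a b 1%g.
- by move=> a b; have [_ E _] := right 1%g a b; rewrite (ract1l mp) !X1 in E.
- by move=> u z; have [_ E _] := Q u 1%g z.
- by move=> v a; have [_ -> _] := left a 1%g v.
- by move=> u b; have [-> _ _] := right u 1%g b.
- by move=> u v; have [E _ _] := Q u v 1%g.
- move=> v z; have [_ _ E] := Q 1%g v z.
  by rewrite xi1 (ract1 mp) (lact1 mp) (ract1l mp) !X1 in E.
Qed.

End RMatrix.

(** * Twisting to a semidirect product *)

Section Star.
Variables (kT gT : finGroupType).
Variables (ract : kT -> gT -> kT) (lact : kT -> gT -> gT) (xi zeta : kT -> gT).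
Hypotheses (mp : matched_pair ract lact) (rd : r_data ract lact xi zeta).
Local Open Scope group_scope.

(* In the bicrossed product, the elements [(xi u)^-1 * u] form a normal
   complement of [gT]; this is their product. *)
Definition star (a b : kT) : kT := ract a (xi b)^-1 * b.
Definition kap (v : kT) : gT := zeta v * xi v.

Lemma xi1 : xi 1 = 1.
Proof. by apply: (mulgI (xi 1)); rewrite -(rd_xiM rd) !mulg1. Qed.
Lemma zeta1 : zeta 1 = 1.
Proof. by apply: (mulgI (zeta 1)); rewrite -(rd_zetaM rd) !mulg1. Qed.
Lemma xiV a : xi a^-1 = (xi a)^-1.
Proof. by apply: (mulgI (xi a)); rewrite -(rd_xiM rd) !mulgV xi1. Qed.
Lemma kap1 : kap 1 = 1.
Proof. by rewrite /kap xi1 zeta1 mulg1. Qed.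

(** Multiplied on the right by [ract b z], this says that conjugating [(xi b)^-1 b] by [z] in the
    factorized group gives the same expression in [ract b z]. *)
Lemma xi_inv_act b z : z * (xi (ract b z))^-1 = (xi b)^-1 * lact b z.
Proof.
apply: (mulgI (xi b)); rewrite mulKVg; apply: (mulIg (xi (ract b z))).
by rewrite mulgA mulgKV (rd_xi_act rd).
Qed.

Lemma ractK a z : ract (ract a z^-1) z = a.
Proof. by rewrite -(ractM mp) mulVg (ract1 mp). Qed.

(** The right side is the [gT] part of the product of [(xi a)^-1 a] and [(xi b)^-1 b], whose [kT]
    part is [star a b]: these elements are closed under products. *)
Lemma xi_star a b : (xi (star a b))^-1 = (xi a)^-1 * lact a (xi b)^-1.
Proof. by rewrite /star (rd_xiM rd) invMg xi_inv_act. Qed.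

Lemma star1l a : star 1 a = a. Proof. by rewrite /star (ract1l mp) mul1g. Qed.
Lemma star1r a : star a 1 = a. Proof. by rewrite /star xi1 invg1 (ract1 mp) mulg1. Qed.

Lemma starV a : star (ract a^-1 (xi a)) a = 1.
Proof. by rewrite /star -(ractM mp) mulgV (ract1 mp) mulVg. Qed.

Lemma ract_star a b z : ract (star a b) z = star (ract a z) (ract b z).
Proof. by rewrite /star (ractMl mp) -!(ractM mp) -xi_inv_act. Qed.

Lemma starA a b c : star a (star b c) = star (star a b) c.
Proof.
rewrite {1}/star xi_star -xi_inv_act (ractM mp) [in RHS]/star ract_star /star.
by rewrite mulgA.
Qed.

Lemma kapM a b : kap (star a b) = kap b * kap a.
Proof.
rewrite /kap; have -> : xi (star a b) = (lact a (xi b)^-1)^-1 * xi a.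
  by apply: invg_inj; rewrite xi_star invMg invgK.
rewrite /star (rd_zetaM rd) -xiV (rd_zeta_ract rd) invgK.
have E := rd_xi_act rd b (zeta a).
have E2 : xi (ract b (zeta a)) = (lact a (xi b)^-1)^-1.
  have := rd_xi_ract rd b (ract a (xi b)^-1).
  rewrite -{1}xiV (rd_zeta_ract rd) invgK -(lactM mp) mulVg (lact1 mp) => ->.
  apply: (mulgI (lact a (xi b)^-1)); rewrite mulgV.
  by have := lactMr mp a (xi b)^-1 (xi b); rewrite mulVg (lact1r mp) => <-.
rewrite xiV -E2 -!mulgA; congr (_ * _); rewrite !mulgA; congr (_ * _).
by rewrite E.
Qed.

Lemma kap_act q z : kap (ract q z) = z^-1 * kap q * z.
Proof.
rewrite /kap; have E1 := rd_zeta_act rd q z; have E2 := rd_xi_act rd q z.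
have -> : zeta (ract q z) = z^-1 * (zeta q * lact q z) by rewrite E1 mulKg.
have -> : xi (ract q z) = (lact q z)^-1 * (xi q * z) by rewrite E2 mulKg.
by rewrite !mulgA mulgK.
Qed.

(** This is the Peiffer identity. With [kapM] and [kap_act] it makes the inverse of [kap] the
    boundary of a crossed module, for the law [star] and the right action [ract]. *)
Lemma kap_star q p : star q p = star (ract p (kap q)) q.
Proof.
have := rd_mul rd p (ract q (xi p)^-1).
rewrite ractK -xiV (rd_zeta_ract rd) invgK -(lactM mp) mulVg (lact1 mp) xiV => E.
by rewrite /star E /kap -(ractM mp) mulgK.
Qed.

End Star.

Section Twist.
Variables (C : numClosedFieldType) (kT gT : finGroupType).
Variables (ract : kT -> gT -> kT) (lact : kT -> gT -> gT) (xi zeta : kT -> gT).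
Hypotheses (mp : matched_pair ract lact) (rd : r_data ract lact xi zeta).
Notation J := (kT * gT)%type.
Notation star := (star ract xi).
Notation kap := (kap xi zeta).
Let H : hdata C J := mpH C ract lact (fun a b => a * b)%g.
Let H' : hdata C J := mpH C ract (fun _ x => x) star.

Definition twT : vec C (J * J) := sect2 C (fun _ b => (xi b)^-1%g) (fun _ _ => 1%g).
Definition twTi : vec C (J * J) := sect2 C (fun _ b => xi b) (fun _ _ => 1%g).
Definition twR : vec C (J * J) := sect2 C (fun _ v => kap v) (fun _ _ => 1%g).
Definition twRi : vec C (J * J) := sect2 C (fun _ v => (kap v)^-1%g) (fun _ _ => 1%g).

Lemma sect2_inv (s t : kT -> gT) : (forall b, t b = (s b)^-1%g) ->
  inverse2 H (sect2 C (fun _ b => s b) (fun _ _ => 1%g))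
             (sect2 C (fun _ b => t b) (fun _ _ => 1%g)).
Proof.
move=> st; split=> -[[u z] [v y]]; rewrite sect2_mul /sect2 /one2 /= -natrM mulnb invg1 mul1g
  (ract1 mp) st.
- by rewrite -{2}[(s v)^-1%g]mulg1 (inj_eq (mulgI _)).
- by rewrite invgK -{2}[s v]mulg1 (inj_eq (mulgI _)).
Qed.

Lemma mp_assoc a b c d : \sum_e hmul H a b e * hmul H e c d
                   = \sum_e hmul H b c e * hmul H a e d.
Proof.
rewrite (sum_only (j := (a.1, (a.2 * b.2)%g))) => [|e ne]; last first.
  by rewrite /= (negPf ne) andbF mul0r.
rewrite (sum_only (j := (b.1, (b.2 * c.2)%g))) => [|e ne]; last first.
  by rewrite /= (negPf ne) andbF mul0r.
rewrite /= !eqxx !andbT -!natrM !mulnb (ractM mp) mulgA.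
by case: eqP => [->|]; rewrite ?andbT ?andbF //= !andbT.
Qed.

Lemma mp_unitr b c : \sum_a hunit H a * hmul H b a c = (b == c)%:R.
Proof.
rewrite (sum_only (j := (ract b.1 b.2, 1%g))) => [|[u x] ne] /=.
  by rewrite !eqxx mul1r mulg1 -surjective_pairing eq_sym.
rewrite -natrM mulnb; case: (eqVneq x 1%g) => //= x1.
case: (eqVneq u _) => //= E; by rewrite x1 E eqxx in ne.
Qed.

Let divr := mul2_divr mp_assoc mp_unitr.

Lemma tw_inv : inverse2 H twT twTi.
Proof. by apply: sect2_inv => b; rewrite invgK. Qed.

Lemma tw_comul x : comulH H' x = mul2 H (mul2 H twT (comulH H x)) twTi.
Proof.
(* Cleared of the inverse, the claim is [Δ'(x) T = T Δ(x)]. Both sides are one coefficient of [x]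
   under a support condition, and [xi_inv_act] matches the conditions. *)
symmetry; apply: (divr tw_inv); apply/funext => -[[u z] [v y]].
rewrite [RHS]sect2_mul mp_mul2 /= mp_comulH invg1 mul1g (ract1 mp) invgK.
rewrite (sum_only (j := (y, y))) => [|[w1 w2] ne] /=; rewrite mp_comulH /twT /sect2 /=.
  rewrite eqxx mul1r mulVg eqxx andbT mulrC; congr ((nat_of_bool _)%:R * _).
  rewrite -(inj_eq (mulgI y)) mulKVg (xi_inv_act rd).
  by rewrite -(inj_eq (mulgI (xi v))) mulKVg.
rewrite (_ : (w2^-1 * y == 1)%g = (w2 == y)); last by rewrite -eq_invg_mul invgK.
case: (eqVneq w1 w2) => [E|]; last by rewrite !mul0r.
case: (eqVneq w2 y) => [E2|]; last by rewrite andbF mulr0.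
by rewrite E E2 eqxx in ne.
Qed.

Lemma tw_cocycle : mul3 H (tens_1 H twT) (comul_l H twT) = mul3 H (tens1_ H twT) (comul_r H twT).
Proof.
apply/funext => -[[[u z] [v y]] [w k]].
rewrite /tens_1 /tens1_ leg12_sect2 leg23_sect2 !sect3_mul mp_comul_l mp_comul_r /twT /sect2 /=.
rewrite !invg1 !mul1g !(ract1 mp) !invgK -!natrM !mulnb.
case: (eqVneq k 1%g) => [->|]; last by rewrite !andbF.
rewrite !andbT (lact1r mp) -/(star v w) (xi_star rd).
rewrite (_ : (xi w * y == 1)%g = (y == (xi w)^-1)%g); last first.
  by rewrite -(inj_eq (mulgI (xi w)^-1%g)) mulKg mulg1.
rewrite andbC; case: (eqVneq y) => //= ->.
by rewrite -(inj_eq (mulgI (xi v)^-1%g)) mulKg.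
Qed.

Lemma tw_counit : counit_l H twT = oneH H /\ counit_r H twT = oneH H.
Proof.
split; apply/funext => -[u x]; rewrite ?mp_counit_l ?mp_counit_r.
  by rewrite (sum_only (j := (xi u)^-1%g)) => [|w ne]; rewrite /twT /sect2 /= ?eqxx ?(negPf ne).
rewrite (sum_only (j := 1%g)) => [|w ne]; rewrite /twT /sect2 /= ?(negPf ne) ?andbF //.
by rewrite eqxx andbT (xi1 rd) invg1.
Qed.

(** The flip of [T] cancels [xi u] and, by [rd_zeta_ract], straightens [lact u^-1 (zeta v)] into
    [zeta v]. The inverse of [T] then contributes [xi v], whence [kap v]. *)
Lemma tw_R : twR = mul2 H (mul2 H (flip twT)
    (sect2 C (fun u v => lact u^-1%g (zeta v)) (fun u _ => xi u))) twTi.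
Proof.
have flipT : flip twT = sect2 C (fun _ _ => 1%g) (fun a _ => (xi a)^-1%g).
  by apply/funext => p; rewrite /flip /twT /sect2 andbC.
symmetry; apply: (divr tw_inv); rewrite flipT; apply/funext => -[[u z] [v y]].
rewrite !sect2_mul /sect2 /= !invg1 !mul1g !(ract1 mp) invgK.
rewrite -(xiV rd) (rd_zeta_ract rd) invgK -(lactM mp) mulVg (lact1 mp).
congr (_ && _)%:R; last by rewrite -{2}[xi u]mulg1 (inj_eq (mulgI _)).
by rewrite -(inj_eq (mulgI (kap v))) mulKVg /kap mulgK.
Qed.

(** A direct check: intertwining rests on [kap_star] and [kap_act], the formula for [(id ⊗ Δ) R] on
    [kapM]. The products of [H] and [H'] are convertible, so [divr] applies to both. *)
Lemma tw_qt : is_qt H' twR.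
Proof.
exists twRi; split.
- exact: sect2_inv.
- move=> x p; congr (_ p); symmetry; apply: (divr (sect2_inv (fun=> erefl))).
  apply/funext => -[[u z] [v y]] {p}; rewrite [RHS]sect2_mul mp_mul2 /= mp_comulH.
  rewrite invg1 mul1g (ract1 mp).
  rewrite (sum_only (j := (y, y))) => [|[w1 w2] ne] /=; rewrite /flip mp_comulH /twR /sect2 /=.
    rewrite eqxx mul1r mulVg eqxx andbT mulrC (kap_star mp rd); congr ((nat_of_bool _)%:R * _).
    rewrite (kap_act rd) -mulgA (inj_eq (mulgI _)) -(inj_eq (mulgI (kap v)^-1%g)).
    by rewrite mulKg.
  rewrite (_ : (w2^-1 * y == 1)%g = (w2 == y)); last by rewrite -eq_invg_mul invgK.
  case: (eqVneq w2 w1) => [E|]; last by rewrite !mul0r.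
  case: (eqVneq w2 y) => [E2|]; last by rewrite andbF mulr0.
  by rewrite -E E2 eqxx in ne.
- move=> [[[u z] [v y]] [w k]]; rewrite leg13_sect2 sect3_mul mp_comul_l leg23_sect2.
  rewrite /twR /sect2 /sect3 /= !invg1 !mul1g !(ract1 mp) -natrM mulnb.
  rewrite (_ : ((kap w)^-1 * z == 1)%g = (z == kap w)); last first.
    by rewrite -eq_invg_mul invgK eq_sym.
  by case: (eqVneq y (kap w)) => [->|]; rewrite ?andbF.
- move=> [[[u z] [v y]] [w k]]; rewrite leg13_sect2 sect3_mul mp_comul_r leg12_sect2.
  rewrite /twR /sect2 /sect3 /= !invg1 !mul1g !(ract1 mp) -natrM mulnb.
  rewrite -/(star v w) (kapM mp rd).
  rewrite -(inj_eq (mulgI (kap w)^-1%g) z) mulKg andbCA.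
  by case: (eqVneq k 1%g) => [->|]; rewrite ?andbF.
- split=> -[u x]; rewrite ?mp_counit_l ?mp_counit_r.
    by rewrite (sum_only (j := kap u)) => [|w ne]; rewrite /twR /sect2 /= ?eqxx ?(negPf ne).
  rewrite (sum_only (j := 1%g)) => [|w ne]; rewrite /twR /sect2 /= ?(negPf ne) ?andbF //.
  by rewrite eqxx andbT (kap1 rd).
Qed.

End Twist.

(** * The factorized group as a semidirect product *)

Section Semidirect.
Variables (C : numClosedFieldType) (kT gT : finGroupType).
Variables (ract : kT -> gT -> kT) (star : kT -> kT -> kT) (sinv : kT -> kT).
Notation J := (kT * gT)%type.
Hypothesis starA : associative star.
Hypothesis star1l : forall a, star 1%g a = a.
Hypothesis star1r : forall a, star a 1%g = a.
Hypothesis starV : forall a, star (sinv a) a = 1%g.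
Hypothesis ract1 : forall a, ract a 1%g = a.
Hypothesis ract1l : forall x, ract 1%g x = 1%g.
Hypothesis ractM : forall a x y, ract a (x * y)%g = ract (ract a x) y.
Hypothesis ract_star : forall a b z, ract (star a b) z = star (ract a z) (ract b z).
Let H' : hdata C J := mpH C ract (fun _ x => x) star.

(* The pair [(u, z)] stands for the product of [u] by [z], in this order. *)
Definition sdop (a b : J) : J := (star a.1 (ract b.1 a.2^-1%g), (a.2 * b.2)%g).
Definition sdinv (a : J) : J := (ract (sinv a.1) a.2, a.2^-1%g).

Lemma sdopA : associative sdop.
Proof.
move=> [u z] [v y] [w x]; rewrite /sdop /= mulgA ract_star starA.
by rewrite -ractM -invMg.
Qed.
Lemma sdop1 : left_id (1%g, 1%g) sdop.
Proof. by move=> [v y]; rewrite /sdop /= invg1 ract1 star1l mul1g. Qed.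
Lemma sdopV : left_inverse (1%g, 1%g) sdinv sdop.
Proof. by move=> [v y]; rewrite /sdop /= invgK -ract_star starV ract1l mulVg. Qed.

Section Group.
Variables (G : finGroupType) (f : J -> G) (finv : G -> J).
Hypotheses (fK1 : cancel f finv) (fK2 : cancel finv f).
Hypothesis fM : forall x y, f (sdop x y) = (f x * f y)%g.

Let finj : injective f := can_inj fK1.

Lemma sd_one : f (1%g, 1%g) = 1%g.
Proof. by apply: (mulgI (f (1%g, 1%g))); rewrite -fM sdop1 mulg1. Qed.

Lemma sd_mulK u v : (f (u, 1) * f (v, 1) = f (star u v, 1))%g.
Proof. by rewrite -fM /sdop /= invg1 ract1 mulg1. Qed.
Lemma sd_mulM z y : (f (1, z) * f (1, y) = f (1, z * y))%g.
Proof. by rewrite -fM /sdop /= ract1l star1l. Qed.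
Lemma sd_mulr u z y : (f (u, z) * f (1, y) = f (u, z * y))%g.
Proof. by rewrite -fM /sdop /= ract1l star1r. Qed.
Lemma sd_join u z : (f (u, 1) * f (1, z) = f (u, z))%g.
Proof. by rewrite sd_mulr mul1g. Qed.
Lemma sd_swap z u : (f (1, z) * f (u, 1) = f (ract u z^-1, z))%g.
Proof. by rewrite -fM /sdop /= star1l mulg1. Qed.
Lemma sd_invK u : ((f (u, 1))^-1 = f (sinv u, 1))%g.
Proof. by apply: (mulIg (f (u, 1%g))); rewrite mulVg sd_mulK starV sd_one. Qed.
Lemma sd_invM z : ((f (1, z))^-1 = f (1, z^-1))%g.
Proof. by apply: (mulIg (f (1%g, z))); rewrite mulVg sd_mulM mulVg sd_one. Qed.

Definition sdK : {set G} := [set f (u, 1%g) | u in [set: kT]].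
Definition sdM : {set G} := [set f (1%g, z) | z in [set: gT]].

Lemma sdKE p : (f p \in sdK) = (p.2 == 1%g).
Proof.
apply/imsetP/eqP => [[u _ /finj -> //]|E]; exists p.1 => //.
by rewrite -E -surjective_pairing.
Qed.
Lemma sdME p : (f p \in sdM) = (p.1 == 1%g).
Proof.
apply/imsetP/eqP => [[u _ /finj -> //]|E]; exists p.2 => //.
by rewrite -E -surjective_pairing.
Qed.

Lemma sdK_group : group_set sdK.
Proof.
apply/group_setP; split; first by rewrite -sd_one sdKE.
by move=> x y /imsetP[u _ ->] /imsetP[v _ ->]; rewrite sd_mulK sdKE.
Qed.
Lemma sdM_group : group_set sdM.
Proof.
apply/group_setP; split; first by rewrite -sd_one sdME.
by move=> x y /imsetP[u _ ->] /imsetP[v _ ->]; rewrite sd_mulM sdME.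
Qed.
Definition sdKG : {group G} := Group sdK_group.
Definition sdMG : {group G} := Group sdM_group.

Lemma sd_unique_fact : unique_fact sdKG sdMG.
Proof.
move=> g; rewrite -(fK2 g); case: (finv g) => u z.
exists (f (u, 1%g), f (1%g, z)); split; first by rewrite sdKE sdME sd_join.
case=> a b [/= /imsetP[v _ ->] /imsetP[y _ ->]].
by rewrite sd_join => /finj [-> ->].
Qed.

Lemma sd_fK u z : fK sdKG sdMG (f (u, z)) = f (u, 1%g).
Proof.
rewrite /fK; case: pickP => [k /andP[/imsetP[v _ ->]]|/(_ (f (u, 1%g)))] /=.
  move=> /imsetP[y _ E]; congr (f (_, _)).
  suff: f (u, z) = f (v, y) by move=> /finj [].
  by rewrite -[f (v, y)]sd_join -E mulKVg.
by rewrite sdKE /= -[X in (_^-1 * X)%g]sd_join mulKg sdME /= !eqxx.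
Qed.

Lemma sd_fm u z : fm sdKG sdMG (f (u, z)) = f (1%g, z).
Proof. by rewrite /fm sd_fK -sd_join mulKg. Qed.

Lemma sd_split u x : f (u, x) = (f (1, x) * f (ract u x, 1))%g.
Proof. by rewrite sd_swap -ractM mulgV ract1. Qed.

Lemma sd_fK' u x : fK' sdKG sdMG (f (u, x)) = f (ract u x, 1%g).
Proof. by rewrite /fK' sd_split (invMg (f (1%g, x))) sd_invK sd_invM sd_join sd_fK -sd_invK invgK. Qed.

Lemma sd_fm' u x : fm' sdKG sdMG (f (u, x)) = f (1%g, x).
Proof. by rewrite /fm' sd_split (invMg (f (1%g, x))) sd_invK sd_invM sd_join sd_fm -sd_invM invgK. Qed.

Lemma sd_deltaE b : delta C b = b%:R. Proof. by case: b. Qed.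

Lemma HG_relabel : relabel H' (HG sdKG sdMG C) f (fun=> 1).
Proof.
split=> /=.
- by move=> _; rewrite oner_neq0.
- move=> [u x] [v y] e; rewrite /HG_mul !sd_deltaE !sd_fm !sd_fK /ract_K sd_join sd_fK'.
  rewrite sd_mulr !(inj_eq finj) !mulr1 /=; congr (nat_of_bool (_ && _))%:R.
  by rewrite eq_sym xpair_eqE eqxx andbT eq_sym.
- move=> [u x] [v y] [w z]; rewrite /HG_comul /= !mulr1 !sd_fm sd_fK.
  rewrite big_imset /=; last by move=> a b _ _ /finj [].
  rewrite (eq_bigl xpredT) => [|i]; last by rewrite inE.
  rewrite (sum_only (j := w)) => [|h ne]; last first.
    by rewrite sd_mulr (inj_eq finj) xpair_eqE [w == h]eq_sym (negPf ne) andbF sd_deltaE.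
  rewrite sd_deltaE /lact_m sd_join sd_fm' sd_invK sd_mulK sd_mulr !(inj_eq finj) !xpair_eqE !mul1g eqxx /=.
  congr (nat_of_bool _)%:R; rewrite -[LHS]andbA -[RHS]andbA; congr (_ && _).
    apply/eqP/eqP => ->; rewrite -starA ?starV ?star1r //.
    suff -> : star w (sinv w) = 1%g by rewrite star1r.
    by have /finj [] : f (star w (sinv w), 1%g) = f (1%g, 1%g) by rewrite -sd_mulK -sd_invK mulgV sd_one.
  by rewrite [x == z]eq_sym; case: (eqVneq z x) => [->|]; rewrite ?andbT ?andbF.
- by move=> [u x]; rewrite /HG_unit sd_deltaE sdKE mulr1.
- by move=> [u x]; rewrite /HG_counit sd_deltaE sd_fK -sd_one (inj_eq finj) xpair_eqE eqxx andbT mulr1.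
Qed.

Variable kap : kT -> gT.
Hypothesis kapM : forall a b, kap (star a b) = (kap b * kap a)%g.
(** The inverse turns the antihomomorphism [kap] into a homomorphism. It is undone by the inverse in
    [R_form], as the action on the [gT] factor is trivial here. *)
Definition eta_of (g : G) : G := f (1%g, (kap (finv g).1)^-1%g).

Lemma eta_hom : hom_to_m sdKG sdMG eta_of.
Proof.
split=> [_ _ /imsetP[u _ ->] /imsetP[v _ ->]|x _]; last by rewrite /eta_of sdME.
by rewrite sd_mulK /eta_of !fK1 sd_mulM kapM invMg.
Qed.

Lemma R_formE : push (gam2 finv) (c2 (fun=> 1)) (sect2 C (fun _ v => kap v) (fun _ _ => 1%g))
  = R_form sdKG sdMG C (fun=> 1%g) eta_of.
Proof.
apply: (push_ext (gam2K fK2)) => -[[u z] [v y]]; rewrite (push_beta _ (beta2K fK1)).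
rewrite /c2 !mulr1 /R_form /beta2 /sect2 /=.
rewrite big_imset /=; last by move=> a b _ _ /finj [].
rewrite (eq_bigl xpredT) => [|i]; last by rewrite inE.
under eq_bigr => a _.
  rewrite big_imset /=; last by move=> a' b _ _ /finj [].
  under eq_bigr => b _ do
    rewrite sd_deltaE mulg1 /eta_of fK1 /ract_m sd_swap sd_fm sd_invM sd_join invgK !(inj_eq finj) !xpair_eqE.
  rewrite (eq_bigl xpredT) => [|i]; last by rewrite inE.
  over.
rewrite (sum_only (j := u)) => [|a ne]; last first.
  by apply: big1 => b _; rewrite eq_sym (negPf ne).
rewrite (sum_only (j := v)) => [|b ne]; last by rewrite [v == b]eq_sym (negPf ne) andbF.
by rewrite !eqxx.
Qed.

End Group.

Lemma semidirect_ex : exists (G : finGroupType) (Kp Gm : {group G}) (f : J -> G) (finv : G -> J),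
  [/\ cancel f finv, cancel finv f, unique_fact Kp Gm, relabel H' (HG Kp Gm C) f (fun=> 1) &
  forall kap : kT -> gT, (forall a b, kap (star a b) = (kap b * kap a)%g) ->
  exists eta, hom_to_m Kp Gm eta /\
    push (gam2 finv) (c2 (fun=> 1)) (sect2 C (fun _ v => kap v) (fun _ _ => 1%g))
    = R_form Kp Gm C (fun=> 1%g) eta].
Proof.
have [G [f [[finv fK1 fK2] fM]]] := finGroup_of_axioms sdopA sdop1 sdopV.
exists G, (sdKG fK1 fM), (sdMG fK1 fM), f, finv; split=> //.
- exact: sd_unique_fact.
- exact: HG_relabel.
- move=> kap kapM; exists (eta_of f finv kap); split; first exact: eta_hom.
  exact: R_formE.
Qed.

End Semidirect.

(** * Assembly of the quasi-isomorphism *)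

Lemma arch_pos_complex (R : realType) : arch_pos R[i].
Proof.
case=> [a b] [c d]; rewrite ltcE lecE /= => /andP[/eqP -> a0] /andP[/eqP -> c0].
exists (Num.bound (c / a)).
have E n : (a +i* 0)%C *+ n = ((a *+ n) +i* 0)%C.
  by elim: n => [|n IH]; rewrite ?mulr0n // !mulrS IH /= ; congr (_ +i* _)%C; rewrite addr0.
rewrite E ltcE /= eqxx /= -mulr_natr mulrC -ltr_pdivrMr //.
by apply: archi_boundP; rewrite divr_ge0 // ltW.
Qed.

Section BicrossedRelabel.
Variables (C : numClosedFieldType) (I : finType) (H : hdata C I) (kT gT : finGroupType).
Variables (ract : kT -> gT -> kT) (lact : kT -> gT -> gT) (beta : kT * gT -> I).
Variables (m : kT -> gT -> gT -> C) (d : kT -> kT -> gT -> C).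
Hypotheses (hopfH : hopf_basis H) (bc : bicrossed H ract lact beta m d).

Lemma bc_relabel : exists c : kT * gT -> C, (forall p, 0 < c p) /\
  relabel (mpH C ract lact (fun a b => a * b)%g) H beta c.
Proof.
have [c [c0 c1 c2]] := bc_scaling hopfH bc; exists c; split=> //.
have mp := bc_mp bc; have cn p : c p != 0 by rewrite gt_eqF.
split=> //=.
- move=> [u x] [v y] e; rewrite (bc_mul bc) /=; case: andP => [[/eqP -> /eqP ->]|]; last first.
    by rewrite !mul0r.
  by rewrite !mul1r c1 mulrC.
- move=> a [v y] [w z]; rewrite (bc_comul bc) /=; case: andP => [[/eqP -> /eqP ->]|]; last first.
    by rewrite !mul0r.
  by rewrite !mul1r -c2 mulrC.
- move=> [u x]; rewrite -(bc_unit bc (u, x)) /= -mulrA.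
  have E : m u 1%g 1%g * c (u, 1%g) = 1.
    have := c1 u 1%g 1%g; rewrite mulg1 (ract1 mp) -mulrA -{1}[c (u, 1%g)]mulr1.
    by move=> /(mulfI (cn _)); rewrite mulrC.
  case: (eqVneq x 1%g) => [->|x1]; first by rewrite E mulr1.
  have /eqP : hunit H (beta (u, x)) * m u 1%g 1%g = 0 by rewrite (bc_unit bc) /= (negPf x1).
  by rewrite mulf_eq0 (gt_eqF (bc_m0 bc _ _ _)) orbF => /eqP ->; rewrite !mul0r.
- move=> [u x]; rewrite -(bc_counit bc (u, x)) /=.
  have E : c (1%g, x) = d 1%g 1%g x.
    have := c2 1%g 1%g x; rewrite mulg1 (lact1 mp).
    by move=> /(mulfI (cn _)).
  case: (eqVneq u 1%g) => [->|u1]; first by rewrite E.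
  have /eqP : hcounit H (beta (u, x)) * d 1%g 1%g x = 0.
    by rewrite (bc_counit bc) /= (negPf u1).
  by rewrite mulf_eq0 (gt_eqF (bc_d0 bc _ _ _)) orbF => /eqP ->; rewrite !mul0r.
Qed.

End BicrossedRelabel.

(** The matrix of the map from [G] to [I] through [J] which undoes the relabelling given by [finv]
    and [c'], then performs the one given by [gam] and [c]. *)
Definition trans (C : numClosedFieldType) (J I G : finType)
    (gam : I -> J) (c : J -> C) (finv : G -> J) (c' : J -> C) (g : G) : vec C I :=
  fun i => (gam i == finv g)%:R * (c (gam i) / c' (gam i)).

Lemma lin_trans (C : numClosedFieldType) (J I G : finType) (gam : I -> J) (c : J -> C)
    (f : J -> G) (finv : G -> J) (c' : J -> C) :
  cancel f finv -> cancel finv f -> (forall j, c' j != 0) ->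
  forall y, lin (trans gam c finv c') (push finv c' y) = push gam c y.
Proof.
move=> fK1 fK2 cn y; apply/funext => i; rewrite /lin /push /trans.
rewrite (sum_only (j := f (gam i))) => [|g ne].
  by rewrite fK1 eqxx mul1r mulrA mulrAC mulfK.
rewrite (_ : _ == _ = false) ?mul0r ?mulr0 //.
by apply: contraNF ne => /eqP ->; rewrite fK2.
Qed.

Lemma lin2_trans (C : numClosedFieldType) (J I G : finType) (gam : I -> J) (c : J -> C)
    (f : J -> G) (finv : G -> J) (c' : J -> C) :
  cancel f finv -> cancel finv f -> (forall j, c' j != 0) ->
  forall y, lin2 (trans gam c finv c') (push (gam2 finv) (c2 c') y)
  = push (gam2 gam) (c2 c) y.
Proof.
move=> fK1 fK2 cn y.
have cn2 p : c2 c' p != 0 by rewrite mulf_neq0.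
rewrite -(lin_trans (gam2 gam) (c2 c) (beta2K fK1) (gam2K fK2) cn2).
apply/funext => p; apply: eq_bigr => q _; rewrite -mulrA; congr (_ * _).
by rewrite /trans /gam2 /c2 /= xpair_eqE -mulnb natrM invfM; ring.
Qed.

Section Transfer.
Variables (C : numClosedFieldType) (J I G : finType).
Variables (HJ H'J : hdata C J) (H : hdata C I) (HG : hdata C G).
Variables (beta : J -> I) (gam : I -> J) (c : J -> C) (f : J -> G) (finv : G -> J) (c' : J -> C).
Hypotheses (betaK : cancel beta gam) (gamK : cancel gam beta).
Hypotheses (fK1 : cancel f finv) (fK2 : cancel finv f).
Hypotheses (rl : relabel HJ H beta c) (rl' : relabel H'J HG f c').
Hypotheses (mulE : hmul HJ = hmul H'J) (unitE : hunit HJ = hunit H'J).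
Let phi := trans gam c finv c'.

Lemma trans_alg_iso : alg_iso HG H phi.
Proof.
have cn := rl_neq0 rl; have cn' := rl_neq0 rl'.
have L y := lin_trans gam c fK1 fK2 cn' y.
have L' y := lin_trans finv c' betaK gamK cn y.
split.
- exists (trans finv c' gam c); split=> x t.
    by rewrite -(unpushK fK1 fK2 cn' x) L L'.
  by rewrite -(unpushK betaK gamK cn x) L' L.
- move=> x y t; rewrite -(unpushK fK1 fK2 cn' x) -(unpushK fK1 fK2 cn' y).
  rewrite (rl_mulH fK1 fK2 rl') !L (rl_mulH betaK gamK rl).
  by rewrite /mulH mulE.
- by move=> t; rewrite (rl_oneH fK1 fK2 rl') L (rl_oneH betaK gamK rl) /oneH unitE.
Qed.

End Transfer.

Section Main.
Variables (C : numClosedFieldType) (I : finType) (H : hdata C I) (Rm : vec C (I * I)).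
Hypothesis arch : arch_pos C.

Lemma quasi_iso_normal : is_hopf H -> positive_basis H -> is_qt H Rm -> positive2 Rm ->
  exists (gT : finGroupType) (Kp Gm : {group gT}),
    unique_fact Kp Gm /\
    exists (R' : vec C (gT * gT)) (phi : gT -> vec C I)
           (T Tinv : vec C (I * I)),
      normal_pos_qt Kp Gm R' /\
      alg_iso (HG Kp Gm C) H phi /\
      inverse2 H T Tinv /\
      (forall a, lin2 phi (comulH (HG Kp Gm C) a)
                 =1 mul2 H (mul2 H T (comulH H (lin phi a))) Tinv) /\
      mul3 H (tens_1 H T) (comul_l H T) =1 mul3 H (tens1_ H T) (comul_r H T) /\
      (counit_l H T =1 oneH H /\ counit_r H T =1 oneH H) /\
      lin2 phi R' =1 mul2 H (mul2 H (flip T) Rm) Tinv.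
Proof.
move=> isH pos qt Rpos.
have [kT [gT [ract [lact [beta [m [d bc]]]]]]] := bicrossed_ex arch isH pos.
have [c [c0 rl]] := bc_relabel (is_hopf_basis isH) bc.
have [gam betaK gamK] := bc_bij bc; have mp := bc_mp bc.
pose push2 := push (gam2 gam) (c2 c).
(* [R] is pulled back to the rescaled basis, where its coefficients remain nonnegative because the
   scaling factors are positive. *)
have RE := unpushK (beta2K betaK) (gam2K gamK) (c2_neq0 rl) Rm.
set RJ := unpush _ _ _ in RE.
have [xi [zeta [rd RJE]]] : exists xi zeta, r_data ract lact xi zeta /\
    RJ = sect2 C (fun u v => lact u^-1%g (zeta v)) (fun u _ => xi u).
  move: qt; rewrite -RE => /(rl_is_qt betaK gamK rl) [Rinv [inv q1 q2 q3 [q4 q5]]].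
  apply: (R_form_ex mp) => [p|||||x]; try exact/funext.
    by rewrite /RJ /unpush divr_ge0 // mulr_ge0 // ltW.
  apply: (mul2_mulr (mp_assoc C mp) (mp_unitr C ract lact) inv); exact/esym/funext.
have [G [Kp [Gm [f [finv [fK1 fK2 uf rl' etaP]]]]]] :=
  semidirect_ex C (starA mp rd) (star1l _ mp) (star1r mp rd) (starV _ mp) (ract1 mp) (ract1l mp)
  (ractM mp) (ract_star mp rd).
exists G, Kp, Gm; split=> //.
have [eta [etah etaE]] := etaP _ (kapM mp rd).
exists (push (gam2 finv) (c2 (fun=> 1)) (twR C xi zeta)), (trans gam c finv (fun=> 1)).
exists (push2 (twT C xi)), (push2 (twTi C xi)).
have n1 : (forall j : kT * gT, (1 : C) != 0) by move=> _; exact: oner_neq0.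
have L := lin_trans gam c fK1 fK2 n1; have L2 := lin2_trans gam c fK1 fK2 n1.
split.
  split.
  - exact: (proj1 (rl_is_qt fK1 fK2 rl' _) (tw_qt C mp rd)).
  - by move=> p; rewrite /push /c2 !mulr1 ler0n.
  - by exists eta; split=> // p; rewrite -etaE.
split; first exact: (trans_alg_iso betaK gamK fK1 fK2 rl rl').
split.
  have [i1 i2] := tw_inv C xi mp.
  split=> p; rewrite /push2 (rl_mul2 betaK gamK rl) (rl_one2 betaK gamK rl); congr (push _ _ _ p).
    exact/funext.
  exact/funext.
split.
  move=> a p; rewrite -(unpushK fK1 fK2 n1 a) L (rl_comulH fK1 fK2 rl') L2.
  by rewrite (rl_comulH betaK gamK rl) /push2 !(rl_mul2 betaK gamK rl) -(tw_comul mp rd).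
split.
  move=> p; rewrite /push2 (rl_comul_l betaK gamK rl) (rl_comul_r betaK gamK rl).
  rewrite /tens_1 /tens1_ (rl_leg12 betaK gamK rl) (rl_leg23 betaK gamK rl).
  by rewrite !(rl_mul3 betaK gamK rl) -[leg12 _ _]/(tens_1 _ _) (tw_cocycle C mp rd).
split.
  have [e1 e2] := tw_counit C rd.
  by split=> p; rewrite /push2 ?(rl_counit_l betaK gamK rl) ?(rl_counit_r betaK gamK rl)
    (rl_oneH betaK gamK rl) ?e1 ?e2.
move=> p; rewrite L2 /push2 -RE (rl_flip c betaK gamK) !(rl_mul2 betaK gamK rl) RJE.
by rewrite (tw_R C mp rd).
Qed.

End Main.

Theorem theorem3 (R : realType) (I : finType) (H : hdata R[i] I)
    (Rm : vec R[i] (I * I)) :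
  is_hopf H -> positive_basis H -> is_qt H Rm -> positive2 Rm ->
  exists (gT : finGroupType) (Kp Gm : {group gT}),
    unique_fact Kp Gm /\
    exists (R' : vec R[i] (gT * gT)) (phi : gT -> vec R[i] I)
           (T Tinv : vec R[i] (I * I)),
      normal_pos_qt Kp Gm R' /\
      alg_iso (HG Kp Gm R[i]) H phi /\
      inverse2 H T Tinv /\
      (forall a, lin2 phi (comulH (HG Kp Gm R[i]) a)
                 =1 mul2 H (mul2 H T (comulH H (lin phi a))) Tinv) /\
      mul3 H (tens_1 H T) (comul_l H T) =1 mul3 H (tens1_ H T) (comul_r H T) /\
      (counit_l H T =1 oneH H /\ counit_r H T =1 oneH H) /\
      lin2 phi R' =1 mul2 H (mul2 H (flip T) Rm) Tinv.
Proof. exact: quasi_iso_normal (@arch_pos_complex R). Qed.
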